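(* Let $d \geq 2$ and let $\mu$ be a compactly supported (nonnegative) Radon measure on $\mathbb{R}^{d}$ such that $I_{s}(\mu) < \infty$ for some $s > d - 1$. Let $$\mathcal{S}(\mu) := \{x \in \mathbb{R}^{d} \setminus \operatorname{spt} \mu : \pi_{x\sharp}\mu \text{ is not absolutely continuous with respect to } \mathcal{H}^{d - 1}|_{S^{d - 1}}\}.$$ Then $\dim_{\mathrm{H}} \mathcal{S}(\mu) \leq 2(d - 1) - s$.
   Context: For $x \in \mathbb{R}^{d}$, $\pi_{x} \colon \mathbb{R}^{d} \setminus \{x\} \to S^{d - 1}$ is the radial projection $\pi_{x}(y) = (y - x)/|y - x|$. For $x \notin \operatorname{spt}\mu$, $\pi_{x}$ is continuous on $\operatorname{spt}\mu$ and $\pi_{x\sharp}\mu$ denotes the push-forward measure on $S^{d-1}$. The $s$-energy of $\mu$ is $I_{s}(\mu) = \iint |x - y|^{-s} \, d\mu(x) \, d\mu(y)$. $\mathcal{H}^{d-1}$ is $(d-1)$-dimensional Hausdorff measure and $\dim_{\mathrm{H}}$ is Hausdorff dimension. *)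

(* Defs.v *)
From HB Require Import structures.
From mathcomp Require Import all_boot all_order all_algebra.
From mathcomp Require Import all_classical all_reals all_analysis.
Set Implicit Arguments. Unset Strict Implicit. Unset Printing Implicit Defensive.
Import Order.TTheory GRing.Theory Num.Theory.
Import numFieldNormedType.Exports.
Local Open Scope classical_set_scope.
Local Open Scope ring_scope.

Section RadialDefs.
Variables (R : realType) (d : nat).

(* R^d is modelled as row vectors 'rV[R]_d with the (product = Euclidean)
   topology of matrix_topology. *)
Definition Rd := 'rV[R]_d.

Definition enorm (v : Rd) : R := Num.sqrt (\sum_(i < d) v ord0 i ^+ 2).

Definition Borel := g_sigma_algebraType (@open Rd).

Definition sphere : set Rd := [set y | enorm y = 1].

Definition radproj (x y : Rd) : Rd := (enorm (y - x))^-1 *: (y - x).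

(* Euclidean diameter (in \bar R; -oo for the empty set). *)
Definition diam (E : set Rd) : \bar R :=
  ereal_sup [set (enorm (x - y))%:E | x in E & y in E].

Definition diam_pow (t : R) (E : set Rd) : R :=
  if pselect (E = set0) then 0 else powR (fine (diam E)) t.

Definition haus_delta (t delta : R) (A : set Rd) : \bar R :=
  ereal_inf [set (\sum_(0 <= i <oo) (diam_pow t (E i))%:E)%E
            | E in [set E : nat -> set Rd |
                     A `<=` \bigcup_i E i /\
                     forall i, (diam (E i) <= delta%:E)%E]].

(* t-dimensional Hausdorff (outer) measure H^t = lim_{delta -> 0} H^t_delta
   (unnormalized; the normalizing constant is irrelevant for null sets and
   for Hausdorff dimension). *)
Definition hausdorff (t : R) (A : set Rd) : \bar R :=
  ereal_sup [set haus_delta t delta A | delta in [set delta : R | 0 < delta]].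

(* Hausdorff dimension: sup { t >= 0 : H^t(A) > 0 } (= -oo for A empty). *)
Definition dimH (A : set Rd) : \bar R :=
  ereal_sup [set t%:E | t in [set t : R | 0 <= t /\ (0 < hausdorff t A)%E]].

Variable mu : {measure set Borel -> \bar R}.

Definition spt : set Rd :=
  [set x | forall U : set Rd, open U -> U x -> (0 < mu U)%E].

Definition radpush (x : Rd) (B : set Rd) : \bar R :=
  mu [set y | y <> x /\ B (radproj x y)].

Definition radpush_abscont (x : Rd) : Prop :=
  forall B : set Rd, measurable (B : set Borel) ->
    (hausdorff (d%:R - 1) (B `&` sphere) = 0)%E -> radpush x B = 0%E.

Definition Sset : set Rd :=
  [set x | ~ spt x /\ ~ radpush_abscont x].

Definition energy (s : R) : \bar R :=
  (\int[mu]_x \int[mu]_y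
     (if x == y then +oo else (powR (enorm (x - y)) (- s))%:E))%E.

End RadialDefs.

(* Main.v *)
(** The radial projections at [x] of [mu] are parametrised by slopes [u]: the
    affine map [p |-> p' - u p_k] collapses the lines of slope [u], so the mass
    near the line of slope [u] through [x] is the mass of a cell of a grid in
    [R^(d-1)], whose position is averaged as well.  Refining the grid turns
    these normalised masses [g_n(x, u)] into a martingale on each projection.
    By orthogonality, the L2 norm of [g_(n+1) - g_n] against the projections of
    [mu] is a double integral of a kernel bounded by
    [2^(-n(s-(d-1))) |y - y'|^(-s)], hence by the energy.  Cauchy-Schwarz against
    the projections of a [t]-dimensional discrete Frostman measure carried by
    [bad n = {x : mean over u of |g_(n+1) - g_n|(x, u) > q^n}] shows that [bad n]
    has [t]-content at most [C rho^n], with [rho < 1] as soon as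
    [t > 2(d-1) - s].  Outside the limsup of the bad sets the densities converge
    in L1, so the projection is absolutely continuous. *)
Require Import Defs.
From HB Require Import structures.
From mathcomp Require Import all_boot all_order all_algebra.
From mathcomp Require Import all_classical all_reals all_analysis.
From mathcomp Require Import measurable_realfun.
From mathcomp Require Import ring lra zify.
Set Implicit Arguments. Unset Strict Implicit. Unset Printing Implicit Defensive.
Import Order.TTheory GRing.Theory Num.Theory.
Import numFieldNormedType.Exports.
Local Open Scope classical_set_scope.
Local Open Scope ring_scope.

(** * Tents and lattice counting *)

(** Three devices keep the argument finite. Slopes and grid shifts run over a lattice of mesh 1 /
    [2 ^ kap], projected coordinates are rounded to it, and [mu] on a cube is replaced by one atom
    per class of points with equal rounded coordinates: averages become finite sums, and no joint
    measurability is needed. The atoms depend on [kap], which tends to infinity along an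
    ultrafilter. A fixed grid sees where points lie relative to its walls; the average over shifts
    depends only on their difference, through a tent. The two-scale relation of the tent turns
    g_(n+1) - g_n into differences of small translates, and translating the tent amounts to changing
    the slope: this is the source of the gain 2^(-n) / |y - y'|. Slopes describe directions in one
    affine chart only, so [x] and [y] are confined to two dyadic cubes far apart; countably many
    pairs suffice because [x] lies off the support. With [tau] = 2^(-t) as cost of one scale and m =
    d - 1, the quantity to be less than 1 is 2^(2m - s - t). The kernel estimate uses s <= d; for s
    > d, finite energy forces [mu] to vanish. *)

Section Tent.
Variable R : realType.
Implicit Types (w a b c h r lo hi v : R) (n N j : nat).

(** [2 ^+ n] times the probability that two points at distance [|w|] share an interval of a randomly
    shifted grid of mesh 2^(-n). *)
Definition tent n w : R := 2 ^+ n * Num.max 0 (1 - 2 ^+ n * `|w|).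

Lemma tent_ge0 n w : 0 <= tent n w.
Proof. by rewrite mulr_ge0 ?exprn_ge0// le_max lexx. Qed.

Lemma tent_le n w : tent n w <= 2 ^+ n.
Proof.
have h : 0 <= 2 ^+ n * `|w| by rewrite mulr_ge0 ?exprn_ge0.
by rewrite ler_piMr ?exprn_ge0// ge_max ler01 gerBl.
Qed.

Lemma tent_eq0 n w : 1 <= 2 ^+ n * `|w| -> tent n w = 0.
Proof. by move=> h; rewrite /tent max_l ?mulr0// subr_le0. Qed.

Lemma tent_ge_half n w : 2 ^+ n * `|w| <= 1 / 2 -> 2 ^+ n / 2 <= tent n w.
Proof.
rewrite /tent; set p := 2 ^+ n * `|w| => h.
rewrite ler_pM2l ?exprn_gt0// le_max; apply/orP; right; lra.
Qed.

Lemma max0_lip (x y : R) : `|Num.max 0 x - Num.max 0 y| <= `|x - y|.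
Proof.
have := ler_norm (x - y); have := ler_norm (y - x); rewrite (distrC y) ler_norml.
set z := `| _ |.
by case: (lerP 0 x) => ?; case: (lerP 0 y) => ? ? ?; apply/andP; split; lra.
Qed.

Lemma tent_lip n w w' : `|tent n w - tent n w'| <= 4 ^+ n * `|w - w'|.
Proof.
rewrite /tent -mulrBr normrM ger0_norm ?exprn_ge0//.
have -> : (4 : R) ^+ n = 2 ^+ n * 2 ^+ n by rewrite -exprMn; congr (_ ^+ _); ring.
rewrite -mulrA ler_pM2l ?exprn_gt0//.
apply: (le_trans (max0_lip _ _)).
have -> : 1 - 2 ^+ n * `|w| - (1 - 2 ^+ n * `|w'|) = 2 ^+ n * (`|w'| - `|w|) by ring.
rewrite normrM ger0_norm ?exprn_ge0// ler_pM2l ?exprn_gt0// distrC.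
exact: ler_dist_dist.
Qed.

Lemma tri_refine (x : R) :
  Num.max 0 (1 - `|x / 2|) = 2^-1 * Num.max 0 (1 - `|x - 1|)
    + Num.max 0 (1 - `|x|) + 2^-1 * Num.max 0 (1 - `|x + 1|).
Proof.
by case: (ger0P (x / 2)) => ?; case: (ger0P (x - 1)) => ?;
  case: (ger0P x) => ?; case: (ger0P (x + 1)) => ?; try lra;
  case: (lerP 0 (1 - _)) => ?; case: (lerP 0 (1 - _)) => ?;
  case: (lerP 0 (1 - _)) => ?; case: (lerP 0 (1 - _)) => ?; lra.
Qed.

(** Two-scale relation of the hat function. The weights 1/4, 1/2, 1/4 sum to 1, so the difference of
    two consecutive scales is a combination of differences of translates by half a coarse mesh. *)
Lemma tent_refine n w : tent n w = 4^-1 * tent n.+1 (w - (2 ^+ n.+1)^-1)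
  + 2^-1 * tent n.+1 w + 4^-1 * tent n.+1 (w + (2 ^+ n.+1)^-1).
Proof.
have p0 : (0 : R) < 2 ^+ n.+1 by rewrite exprn_gt0.
have E (x : R) : 2 ^+ n.+1 * `|x| = `|2 ^+ n.+1 * x|.
  by rewrite normrM (@ger0_norm _ (2 ^+ n.+1)) // ltW.
rewrite /tent !E mulrBr mulrDr mulfV ?gt_eqF//.
have -> : 2 ^+ n * `|w| = `|2 ^+ n.+1 * w / 2|.
  have -> : 2 ^+ n.+1 * w / 2 = 2 ^+ n * w by rewrite exprS; field.
  by rewrite normrM ger0_norm ?exprn_ge0.
rewrite tri_refine exprS.
set A := Num.max _ _; set B := Num.max _ _; set C := Num.max _ _.
by field.
Qed.

Lemma max0E (x : R) : (x <= 0 /\ Num.max 0 x = 0) \/ (0 <= x /\ Num.max 0 x = x).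
Proof. by case: (lerP 0 x) => ?; [right|left]; split=> //; exact: ltW. Qed.

Lemma count_in_le N lo hi :
  \sum_(0 <= j < N) ((lo <= j%:R <= hi)%R%:R : R) <= Num.max 0 (hi - lo + 1).
Proof.
(* Truncating [hi] at the last index [N - 1] makes the bound inductive in [N]. *)
suff: \sum_(0 <= j < N) ((lo <= j%:R <= hi)%R%:R : R)
        <= Num.max 0 (Num.min hi (N%:R - 1) - lo + 1).
  move=> /le_trans; apply; case: (lerP hi (N%:R - 1)) => ?; rewrite ?lexx//.
  have [[? ->]|[? ->]] := max0E (N%:R - 1 - lo + 1);
    have [[? ->]|[? ->]] := max0E (hi - lo + 1); lra.
elim: N => [|N IH]; first by rewrite big_nil le_max lexx.
rewrite big_nat_recr//= -natr1; move: IH.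
set s := \sum_(_ <= _ < _) _.
have [[+ ->]|[+ ->]] := max0E (Num.min hi (N%:R - 1) - lo + 1);
have [[+ ->]|[+ ->]] := max0E (Num.min hi (N%:R + 1 - 1) - lo + 1);
case: (lerP lo N%:R) => h1; case: (lerP N%:R hi) => h2 /=;
case: (lerP hi) => ?; case: (lerP hi) => ?; lra.
Qed.

Lemma count_in_ge N lo hi : 0 <= lo -> hi <= N%:R ->
  hi - lo - 1 <= \sum_(0 <= j < N) ((lo <= j%:R <= hi)%R%:R : R).
Proof.
move=> lo0 hN.
suff: Num.min hi N%:R - lo - 1 <= \sum_(0 <= j < N) ((lo <= j%:R <= hi)%R%:R : R).
  by rewrite min_l.
elim: N {hN} => [|N IH].
  by rewrite big_nil mulr0n; case: (lerP hi 0) => ?; lra.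
rewrite big_nat_recr//= -natr1; move: IH.
set s := \sum_(_ <= _ < _) _; have s0 : 0 <= s by apply: sumr_ge0 => j _; rewrite ler0n.
case: (lerP lo N%:R) => h1; case: (lerP N%:R hi) => h2 /=;
case: (lerP hi N%:R) => ?; case: (lerP hi (N%:R + 1)) => ?; lra.
Qed.

Lemma count_abs_le N a b r : b != 0 -> 0 <= r ->
  \sum_(0 <= j < N) ((`|a - j%:R * b| <= r)%R%:R : R) <= 2 * r / `|b| + 1.
Proof.
move=> b0 r0; have nb : 0 < `|b| by rewrite normr_gt0.
have [s [s1 sb]] : exists s : R, s ^+ 2 = 1 /\ b = s * `|b|.
  case: (ger0P b) => hb; [exists 1|exists (-1)]; split; ring.
have s11 : s * s = 1 by rewrite -expr2.
pose a' := s * a / `|b|.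
have E j : (`|a - j%:R * b| <= r) = (a' - r / `|b| <= j%:R <= a' + r / `|b|).
  have -> : a - j%:R * b = s * `|b| * (a' - j%:R).
    rewrite {1}sb /a' mulrBr; congr (_ - _); last by ring.
    transitivity (s * s * a); first by rewrite s11 mul1r.
    by field; rewrite gt_eqF.
  have ns : `|s| = 1.
    by apply/eqP; rewrite -(@eqrXn2 _ 2)// ?expr1n -normrX s1 normr1.
  rewrite 2!normrM ns mul1r normr_id mulrC -ler_pdivlMr// ler_norml.
  apply/idP/idP => /andP[? ?]; apply/andP; split; lra.
under eq_bigr do rewrite E.
apply: (le_trans (count_in_le _ _ _)).
have := divr_ge0 r0 (ltW nb); set t := r / `|b| => t0.
by rewrite -mulrA -/t; have [[? ->]|[? ->]] := max0E (a' + t - (a' - t) + 1); lra.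
Qed.

(** A Lipschitz cut-off rather than an indicator: shifting all slopes by a small amount then changes
    each weight by at most that amount. *)
Definition chi (v : R) : R := Num.max 0 (Num.min 1 (3 - `|v|)).

Lemma chi_ge0 v : 0 <= chi v. Proof. by rewrite le_max lexx. Qed.
Lemma chi_le1 v : chi v <= 1. Proof. by rewrite ge_max ler01 ge_min lexx. Qed.
Lemma chi_eq0 v : 3 <= `|v| -> chi v = 0.
Proof. by move=> h; rewrite /chi; case: (lerP 1 (3 - `|v|)) => ?; case: lerP => ?; lra. Qed.
Lemma chi_half v : `|v| <= 5 / 2 -> 1 / 2 <= chi v.
Proof.
move=> h; rewrite le_max; apply/orP; right; rewrite le_min; apply/andP; split; lra.
Qed.

Lemma chi_lip v w : `|chi v - chi w| <= `|v - w|.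
Proof.
apply: (le_trans (max0_lip _ _)).
apply: (@le_trans _ _ `| `|w| - `|v| |).
  case: (lerP 1 (3 - `|v|)) => ?; case: (lerP 1 (3 - `|w|)) => ?;
  rewrite ?subrr ?normr0//; case: (ger0P (`|w| - `|v|)) => ?;
  case: ger0P => ?; lra.
by rewrite (distrC v); exact: ler_dist_dist.
Qed.

End Tent.

(** * Averages of tents over slopes *)

Section SlopeAverage.
Variable R : realType.
Variable M : nat.
Hypothesis M0 : (0 < M)%N.
Implicit Types (a b d : R) (n j : nat) (w : nat -> R).

(* Slopes range over the lattice of mesh 1 / M in [-4, 4); the weight [chi]
   lives in [-3, 3], so one unit of margin remains on each side. *)
Definition slope j : R := j%:R / M%:R - 4.

(** Riemann sum of [chi u * tent n (w u)] over the slopes [u]. In the main case [w] is [line a b],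
    the offset in one coordinate of two points projected along slope [u]; a general [w] leaves room
    for rounding. *)
Definition slope_avg n w : R :=
  \sum_(0 <= j < 8 * M) chi (slope j) / M%:R * tent n (w j).

Definition line a b j : R := a - slope j * b.

Let M0' : (0 : R) < M%:R. Proof. by rewrite ltr0n. Qed.
Let iM0 : (0 : R) <= M%:R^-1. Proof. by rewrite invr_ge0 ltW. Qed.
Let Mn0 : (M%:R : R) != 0. Proof. by rewrite gt_eqF. Qed.

Lemma slope_avg_ge0 n w : 0 <= slope_avg n w.
Proof.
apply: sumr_ge0 => j _; apply: mulr_ge0 (tent_ge0 _ _).
by rewrite mulr_ge0 ?chi_ge0 ?iM0.
Qed.

Lemma sum_inv_range : \sum_(0 <= j < 8 * M) (M%:R^-1 : R) = 8.
Proof.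
by rewrite sumr_const_nat subn0 -[LHS]mulr_natl natrM mulfK.
Qed.

Lemma slope_avg_le n w : slope_avg n w <= 8 * 2 ^+ n.
Proof.
rewrite -sum_inv_range mulr_suml; apply: ler_sum => j _.
rewrite ler_pM ?tent_ge0 ?tent_le ?mulr_ge0 ?chi_ge0 ?iM0//.
by rewrite ler_piMl ?chi_le1 ?iM0.
Qed.

Lemma slope_avg_lip n w w' e : (forall j, `|w j - w' j| <= e) ->
  `|slope_avg n w - slope_avg n w'| <= 8 * (4 ^+ n * e).
Proof.
move=> h; rewrite /slope_avg -sumrB.
apply: (le_trans (ler_norm_sum _ _ _)).
rewrite -sum_inv_range mulr_suml; apply: ler_sum => j _.
rewrite -mulrBr normrM ler_pM//.
  rewrite ger0_norm ?mulr_ge0 ?chi_ge0 ?iM0//.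
  by rewrite ler_piMl ?chi_le1 ?iM0.
apply: (le_trans (tent_lip _ _ _)).
by rewrite ler_pM2l ?exprn_gt0.
Qed.

(** Slopes of nonzero weight are below 3 in absolute value, so when [a] dominates [3 * b] the line
    never enters the support of the tent; [M%:R^-1] pays for the rounding. *)
Lemma slope_avg_eq0 n w a b : (forall j, `|w j - line a b j| <= M%:R^-1) ->
  3 * `|b| + (2 ^+ n)^-1 + M%:R^-1 <= `|a| -> slope_avg n w = 0.
Proof.
move=> hw ha; apply: big1 => j _.
case: (lerP 3 `|slope j|) => [h|h]; first by rewrite chi_eq0 ?mul0r.
rewrite tent_eq0 ?mulr0//.
have p0 : (0 : R) < 2 ^+ n by rewrite exprn_gt0.
rewrite -ler_pdivrMl// mulr1.
have h2 : `|a| <= `|w j| + `|w j - line a b j| + `|slope j * b|.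
  have e : a = w j - (w j - line a b j) + slope j * b by rewrite /line; ring.
  by rewrite {1}e (le_trans (ler_normD _ _))// lerD2r ler_normB.
have := hw j; rewrite normrM in h2.
have : `|slope j| * `|b| <= 3 * `|b| by rewrite ler_wpM2r// ltW.
lra.
Qed.

(** As the slope varies, [a - u * b] moves at speed [|b|], so it meets the tent, of height 2^n and
    half-width 2^(-n), for a length of slopes at most 2 * 2^(-n) / [|b|]. The second term is one
    extra lattice point. *)
Lemma tent_sum_le n a b : b != 0 ->
  \sum_(0 <= j < 8 * M) M%:R^-1 * tent n (line a b j) <= 2 / `|b| + 2 ^+ n / M%:R.
Proof.
move=> b0; have p0 : (0 : R) < 2 ^+ n by rewrite exprn_gt0.
have nb : 0 < `|b| by rewrite normr_gt0.
rewrite -mulr_sumr.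
have := @count_abs_le R (8 * M) (a + 4 * b) (b / M%:R) (2 ^+ n)^-1.
rewrite mulf_neq0 ?invr_eq0// => /(_ isT); rewrite invr_ge0 exprn_ge0// => /(_ isT).
rewrite normrM normfV (ger0_norm (ltW M0')).
set s := \sum_(_ <= _ < _) _ => hs.
apply: (@le_trans _ _ (M%:R^-1 * (2 ^+ n * s))); last first.
  apply: (@le_trans _ _ (M%:R^-1 * (2 ^+ n * (2 * (2 ^+ n)^-1 / (`|b| / M%:R) + 1)))).
    by rewrite ler_pM2l ?invr_gt0// ler_pM2l.
  rewrite le_eqVlt; apply/orP; left; apply/eqP; field.
  by rewrite !gt_eqF.
rewrite ler_pM2l ?invr_gt0// mulr_sumr; apply: ler_sum => j _.
have -> : a + 4 * b - j%:R * (b / M%:R) = line a b j by rewrite /line /slope; ring.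
case: (lerP `|line a b j| (2 ^+ n)^-1) => h /=; first by rewrite mulr1 tent_le.
by rewrite mulr0 tent_eq0// -ler_pdivrMl// mulr1 ltW.
Qed.

Lemma slope_avg_line_le n a b : b != 0 ->
  slope_avg n (line a b) <= 2 / `|b| + 2 ^+ n / M%:R.
Proof.
move=> b0; apply: (le_trans _ (tent_sum_le n a b0)); apply: ler_sum => j _.
by rewrite ler_wpM2r ?tent_ge0// ler_piMl ?chi_le1 ?iM0.
Qed.

Lemma chi_slope_eq0 j : (j <= M)%N || (7 * M <= j)%N -> chi (slope j) = 0.
Proof.
move=> h; apply: chi_eq0; rewrite /slope.
case/orP: h => h.
  have : (j%:R / M%:R : R) <= 1 by rewrite ler_pdivrMr// mul1r ler_nat.
  set x := _ / _ => hx; rewrite ler0_norm; lra.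
have : 7 <= (j%:R / M%:R : R) by rewrite ler_pdivlMr// -natrM ler_nat.
set x := _ / _ => hx; rewrite ger0_norm; lra.
Qed.

(* Moving the line by [q] lattice steps of the slope is a translation of the
   summation index; the margins where [chi] vanishes absorb the boundary terms. *)
Lemma slope_avg_translate n a b q : (q <= M)%N ->
  slope_avg n (line (a + q%:R * (b / M%:R)) b) =
  \sum_(0 <= j < 8 * M) chi (slope (j + q)) / M%:R * tent n (line a b j).
Proof.
move=> qM; rewrite /slope_avg.
rewrite (@big_cat_nat _ _ _ q)//=; last by lia.
rewrite big1_seq ?add0r; last first.
  move=> j /andP[_]; rewrite mem_index_iota => /andP[_ jq].
  by rewrite chi_slope_eq0 ?mul0r//; apply/orP; left; lia.
rewrite -{1}[q]add0n big_addn.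
rewrite [RHS](@big_cat_nat _ _ _ (8 * M - q))//=; last by lia.
rewrite [X in _ = _ + X]big1_seq ?addr0; last first.
  move=> j /andP[_]; rewrite mem_index_iota => /andP[jq _].
  by rewrite chi_slope_eq0 ?mul0r//; apply/orP; right; lia.
apply: eq_bigr => j _; congr (_ * tent n _).
by rewrite /line /slope natrD; ring.
Qed.

(** Shifting the offset by [d] amounts to shifting the slope by [d / b]. Whole lattice steps become
    an index translation, which only moves the weight [chi]; the remaining fraction of a step is
    paid by the Lipschitz constant of the tent. *)
Lemma slope_avg_shift_pos n a b d : b != 0 -> 0 <= d / b -> d / b <= 1 ->
  `|slope_avg n (line (a + d) b) - slope_avg n (line a b)|
    <= 8 * (4 ^+ n * (`|b| / M%:R)) + d / b * (2 / `|b| + 2 ^+ n / M%:R).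
Proof.
move=> b0 d0 d1; have nb : 0 < `|b| by rewrite normr_gt0.
(* The number of whole lattice steps contained in the slope shift [d / b]. *)
pose q := Num.truncn (d / b * M%:R).
have x0 : 0 <= d / b * M%:R by rewrite mulr_ge0 ?(ltW M0').
have /andP[q1 q2] := truncn_itv x0.
have qM : (q <= M)%N.
  by rewrite -(ler_nat R) (le_trans q1)// ler_piMl // ltW.
have qd : q%:R / M%:R <= d / b by rewrite ler_pdivrMr.
apply: (le_trans (ler_distD (slope_avg n (line (a + q%:R * (b / M%:R)) b)) _ _)).
apply: lerD.
  apply: slope_avg_lip => j.
  have -> : line (a + d) b j - line (a + q%:R * (b / M%:R)) b j
      = (d / b * M%:R - q%:R) * (b / M%:R).
    by rewrite /line; field; rewrite b0 Mn0.
  rewrite !normrM normfV (ger0_norm (ltW M0')) ler_piMl ?divr_ge0 ?ltW//.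
  rewrite ger0_norm ?subr_ge0//; move: q2; rewrite -addn1 natrD; lra.
rewrite slope_avg_translate// /slope_avg -sumrB.
apply: (le_trans (ler_norm_sum _ _ _)).
apply: (@le_trans _ _ (d / b *
  \sum_(0 <= j < 8 * M) M%:R^-1 * tent n (line a b j))); last first.
  by rewrite ler_wpM2l// tent_sum_le.
rewrite mulr_sumr; apply: ler_sum => j _.
rewrite -mulrBl normrM (ger0_norm (tent_ge0 _ _)) [d / b * _]mulrA ler_wpM2r ?tent_ge0//.
rewrite -mulrBl normrM (ger0_norm iM0) ler_wpM2r ?iM0//.
apply: (le_trans (chi_lip _ _)); apply: le_trans qd.
have -> : slope (j + q) - slope j = q%:R / M%:R by rewrite /slope natrD; ring.
by rewrite ger0_norm ?divr_ge0.
Qed.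

Lemma slope_avg_shift n a b d : b != 0 -> `|d| <= `|b| ->
  `|slope_avg n (line (a + d) b) - slope_avg n (line a b)|
    <= 8 * (4 ^+ n * (`|b| / M%:R)) + `|d| / `|b| * (2 / `|b| + 2 ^+ n / M%:R).
Proof.
move=> b0 db; have nb : 0 < `|b| by rewrite normr_gt0.
have h1 : `|d / b| <= 1 by rewrite normrM normfV ler_pdivrMr// mul1r.
have h2 : `|d| / `|b| = `|d / b| by rewrite normrM normfV.
rewrite h2; case: (ger0P (d / b)) h1 => h h1.
  by apply: slope_avg_shift_pos.
rewrite distrC.
rewrite -{1}[a](addrK d).
have e : - (d / b) = (- d) / b by rewrite mulNr.
rewrite e; apply: slope_avg_shift_pos; rewrite -?e //; lra.
Qed.

(** By the two-scale relation the coarse average is a mean of fine averages at the offsets [a - d],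
    [a], [a + d] with [d] half the coarse mesh, so only two shift errors remain. Each gains the
    factor [d / |b|] over the size 1 / [|b|] of the averages. *)
Lemma slope_avg_line_diff n a b : b != 0 -> (2 ^+ n.+1)^-1 <= `|b| ->
  `|slope_avg n.+1 (line a b) - slope_avg n (line a b)|
    <= 8 * (4 ^+ n.+1 * (`|b| / M%:R))
       + (2 ^+ n.+1)^-1 / `|b| * (2 / `|b| + 2 ^+ n.+1 / M%:R).
Proof.
move=> b0; set d := _^-1 => db.
have d0 : 0 <= d by rewrite invr_ge0 exprn_ge0.
have E : slope_avg n (line a b) = 4^-1 * slope_avg n.+1 (line (a - d) b)
    + 2^-1 * slope_avg n.+1 (line a b) + 4^-1 * slope_avg n.+1 (line (a + d) b).
  rewrite /slope_avg !mulr_sumr -!big_split/=; apply: eq_bigr => j _.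
  rewrite tent_refine -/d.
  have -> : line (a - d) b j = line a b j - d by rewrite /line; ring.
  have -> : line (a + d) b j = line a b j + d by rewrite /line; ring.
  by ring.
have h1 := @slope_avg_shift n.+1 a b d b0.
have h2 := @slope_avg_shift n.+1 a b (- d) b0.
rewrite normrN in h2; rewrite (ger0_norm d0) in h1 h2.
move: (h1 db) (h2 db); rewrite E.
set s0 := slope_avg _ _; set s1 := slope_avg _ _; set s2 := slope_avg _ _.
set B := 8 * _ + _; rewrite !ler_norml => /andP[? ?] /andP[? ?].
apply/andP; split; lra.
Qed.

(** The lower bound on [M] makes the rounding errors, of order 4^n / [M], at most a small multiple
    of 2^(-n); since [|b| <= 1] they are absorbed in the main term. *)
Lemma slope_avg_diff n a b w : b != 0 -> (2 ^+ n.+1)^-1 <= `|b| -> `|b| <= 1 ->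
  64 * 8 ^+ n.+1 <= (M%:R : R) ->
  (forall j, `|w j - line a b j| <= M%:R^-1) ->
  `|slope_avg n.+1 w - slope_avg n w| <= 8 * ((2 ^+ n)^-1 / `|b| ^+ 2)
  /\ slope_avg n w <= 4 / `|b| /\ slope_avg n.+1 w <= 4 / `|b|.
Proof.
move=> b0 db b1 hM hw; have nb : 0 < `|b| by rewrite normr_gt0.
have := slope_avg_line_diff a b0 db.
have := slope_avg_lip n hw; have := slope_avg_lip n.+1 hw.
have := slope_avg_line_le n a b0; have := slope_avg_line_le n.+1 a b0.
set t := 2 ^+ n in db *; set x := `|b| in nb b1 db *.
have t1 : 1 <= t by rewrite exprn_ege1// ler1n.
have e4 : (4 : R) ^+ n = t ^+ 2 by rewrite -exprM mulnC exprM; congr (_ ^+ _); ring.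
have e8 : (8 : R) ^+ n = t ^+ 3 by rewrite -exprM mulnC exprM; congr (_ ^+ _); ring.
rewrite !(exprS _ n) -/t e4 e8 in db hM *.
set y := x^-1; set u := t^-1; set h := M%:R^-1.
have y1 : 1 <= y by rewrite -[1]invr1 lef_pV2 ?posrE.
have t0 : 0 < t by lra.
have u0 : 0 < u by rewrite invr_gt0.
have h0 : 0 < h by rewrite invr_gt0.
have uE : u * t = 1 by rewrite mulVf ?gt_eqF.
have yE : y * x = 1 by rewrite mulVf ?gt_eqF.
have hE : h * (512 * t ^+ 3) <= 1.
  by rewrite mulrC ler_pdivrMr// mul1r; apply: le_trans hM; rewrite mulrA -natrM.
have d2 : (2 * t)^-1 = u / 2 by rewrite invfM mulrC.
have y2 : (x ^+ 2)^-1 = y ^+ 2 by rewrite exprVn.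
rewrite d2 in db *; rewrite y2.
have ht2 : 512 * (t ^+ 2 * h) <= u.
  rewrite -(ler_pM2l t0) mulrC [t * u]mulrC uE; apply: le_trans hE.
  by rewrite le_eqVlt; apply/orP; left; apply/eqP; ring.
have t2h0 : 0 <= t ^+ 2 * h by rewrite mulr_ge0 ?exprn_ge0 ?ltW.
have th : t * h <= t ^+ 2 * h.
  by rewrite expr2 -mulrA ler_peMl// mulr_ge0 ?ltW.
have th0 : 0 <= t * h by rewrite mulr_ge0 ?ltW.
have u1 : u <= 1 by rewrite -[1]invr1 lef_pV2 ?posrE.
have uy : u <= u * y ^+ 2 by rewrite ler_peMr ?exprn_ege1// ltW.
have xt : 4 * t ^+ 2 * (x * h) <= 4 * (t ^+ 2 * h).
  rewrite -mulrA ler_pM2l// mulrCA ler_piMl//.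
have uyh : u / 2 * y * (2 * y + 2 * t * h) <= u / 2 * y * (3 * y).
  rewrite ler_pM2l; last by rewrite !mulr_gt0// ?invr_gt0//; lra.
  lra.
have e1 : u / 2 * y * (3 * y) = 3 / 2 * (u * y ^+ 2) by ring.
rewrite e1 in uyh.
set s1 := slope_avg _ _; set s2 := slope_avg _ _; set s3 := slope_avg _ _.
set s4 := slope_avg _ _.
rewrite !ler_norml => H1 H2 /andP[H3 H4] /andP[H5 H6] /andP[H7 H8].
split; last by split; lra.
apply/andP; split; lra.
Qed.

(** For slopes within [h] of the true slope [a / b], the offset is at most [h * b0] = 2^(-n) / 4
    plus rounding, so the tent is at least half its height, and [chi] is at least 1/2 because
    [|u| <= 5 / 2]. At least [h * M] lattice slopes lie in the window, which gives [h] * 2^n / 4 = 1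
    / (16 [b0]). *)
Lemma slope_window_ge n a b b0 h w : 0 < b0 -> h = (2 ^+ n)^-1 / (4 * b0) -> h <= 1 / 2 ->
  b != 0 -> `|b| <= b0 -> `|a / b| <= 2 -> 1 <= h * M%:R ->
  (M%:R^-1 : R) <= (2 ^+ n)^-1 / 4 ->
  (forall j, `|w j - line a b j| <= M%:R^-1) ->
  (16 * b0)^-1 <= \sum_(0 <= j < 8 * M)
     chi (slope j) / M%:R * ((`|slope j - a / b| <= h)%R%:R : R) * tent n (w j).
Proof.
move=> b00 hE h12 bn0 bb0 v2 hM1 iM hw; set v := a / b in v2 *.
set t := 2 ^+ n in hE iM *; have t0 : 0 < t by rewrite exprn_gt0.
have h0 : 0 < h by rewrite hE !divr_gt0 ?invr_gt0 ?mulr_gt0.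
pose lo : R := (v - h + 4) * M%:R; pose hi : R := (v + h + 4) * M%:R.
move: v2; rewrite ler_norml => /andP[v2 v2'].
have lo0 : 0 <= lo by rewrite mulr_ge0 ?(ltW M0')//; lra.
have hi8 : hi <= (8 * M)%N%:R by rewrite natrM ler_pM2r//; lra.
have inE j : (`|slope j - v| <= h) = (lo <= j%:R <= hi).
  have -> : (lo <= j%:R) = (v - h + 4 <= j%:R / M%:R) by rewrite ler_pdivlMr.
  have -> : (j%:R <= hi) = (j%:R / M%:R <= v + h + 4) by rewrite ler_pdivrMr.
  have : slope j = j%:R / M%:R - 4 by [].
  set x := slope j; set y := j%:R / M%:R => xE.
  by rewrite ler_norml; apply/idP/idP => /andP[? ?]; apply/andP; split; lra.
apply: (@le_trans _ _ ((hi - lo - 1) * (t / (4 * M%:R)))).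
  have -> : (hi - lo - 1) * (t / (4 * M%:R)) = (2 * (h * M%:R) - 1) * (t / (4 * M%:R)).
    by rewrite /hi /lo; congr (_ * _); ring.
  apply: (@le_trans _ _ (h * M%:R * (t / (4 * M%:R)))).
    by rewrite hE le_eqVlt; apply/orP; left; apply/eqP; field; rewrite Mn0 !gt_eqF.
  by rewrite ler_wpM2r ?divr_ge0 ?mulr_ge0 ?(ltW M0') ?(ltW t0)//; lra.
apply: (le_trans (ler_wpM2r _ (count_in_ge lo0 hi8))).
  by rewrite divr_ge0 ?mulr_ge0 ?(ltW M0') ?(ltW t0).
rewrite mulr_suml; apply: ler_sum => j _; rewrite -inE.
case: (lerP `|slope j - v| h) => hj /=; last by rewrite mulr0 !mul0r.
rewrite mul1r mulr1.
have sl : `|slope j| <= 5 / 2.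
  by move: hj; rewrite !ler_norml => /andP[? ?]; apply/andP; split; lra.
have wj : t * `|w j| <= 1 / 2.
  rewrite -ler_pdivlMl//; have hwj := hw j.
  have e : w j = (w j - line a b j) + - (slope j - v) * b by rewrite /line /v; field.
  rewrite e; apply: (le_trans (ler_normD _ _)); rewrite normrM normrN.
  have : `|slope j - v| * `|b| <= h * b0 by rewrite ler_pM.
  have -> : h * b0 = t^-1 / 4 by rewrite hE; field; rewrite !gt_eqF.
  lra.
have -> : t / (4 * M%:R) = 1 / 2 / M%:R * (t / 2) by field.
apply: ler_pM; rewrite ?divr_ge0 ?(ltW t0) ?(ltW M0')//.
  by rewrite ler_pM2r ?invr_gt0// chi_half.
exact: tent_ge_half.
Qed.

Lemma slope_window_le u r : 0 <= r ->
  \sum_(0 <= j < 8 * M) chi (slope j) / M%:R * ((`|slope j - u| <= r)%R%:R : R)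
    <= 2 * r + M%:R^-1.
Proof.
move=> r0; pose lo : R := (u - r + 4) * M%:R; pose hi : R := (u + r + 4) * M%:R.
have inE j : (`|slope j - u| <= r) = (lo <= j%:R <= hi).
  have -> : (lo <= j%:R) = (u - r + 4 <= j%:R / M%:R) by rewrite ler_pdivlMr.
  have -> : (j%:R <= hi) = (j%:R / M%:R <= u + r + 4) by rewrite ler_pdivrMr.
  have : slope j = j%:R / M%:R - 4 by [].
  set x := slope j; set y := j%:R / M%:R => xE.
  by rewrite ler_norml; apply/idP/idP => /andP[? ?]; apply/andP; split; lra.
apply: (@le_trans _ _ (M%:R^-1 * \sum_(0 <= j < 8 * M) (lo <= j%:R <= hi)%R%:R)).
  rewrite mulr_sumr; apply: ler_sum => j _; rewrite -inE ler_wpM2r ?ler0n//.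
  by rewrite ler_piMl ?iM0// chi_le1.
apply: (le_trans (ler_wpM2l iM0 (count_in_le _ _ _))).
have hl : hi - lo = 2 * r * M%:R by rewrite /hi /lo; ring.
have hl0 : 0 <= 2 * r * M%:R by rewrite !mulr_ge0 ?(ltW M0').
rewrite hl max_r; last lra.
by rewrite mulrDr mulr1 lerD2r mulrC mulfK.
Qed.

End SlopeAverage.

(** * Cells of shifted sheared grids *)

Section ShiftedBlocks.
Local Open Scope nat_scope.

Lemma sum_modn_shift (f : nat -> nat) L P A :
  \sum_(0 <= j < P * L) f ((A + j) %% L) = P * \sum_(0 <= r < L) f r.
Proof.
elim: A => [|A <-]; last first.
  case: (posnP (P * L)) => [->|PL]; first by rewrite !big_nil.
  rewrite -[X in \sum_(0 <= j < X) f ((A.+1 + j) %% L)](prednK PL).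
  rewrite big_nat_recr//= -[in RHS](prednK PL) big_nat_recl//= addn0 addnC.
  congr (f _ + _); last by apply: eq_bigr => j _; rewrite addSnnS.
  by rewrite addSnnS prednK// addnC modnMDl.
elim: P => [|P IH]; first by rewrite mul0n big_nil.
rewrite mulSn addnC (@big_cat_nat _ _ _ (P * L))//= ?leq_addr// IH mulSn addnC.
congr (_ + _); rewrite -{1}[P * L]add0n big_addn addKn.
by apply: eq_big_nat => i /andP[_ iL]; rewrite add0n addnC modnMDl modn_small.
Qed.

(** The two points share a block exactly when the residue of the lower one is below [L - D], and
    each residue occurs [P] times. Truncated subtraction gives 0 for [D >= L], as it should. *)
Lemma count_shifted_block_nat L P (A : nat) (D : nat) : 0 < L ->
  \sum_(0 <= j < P * L) ((A + j) %/ L == (A + D + j) %/ L) = P * (L - D).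
Proof.
move=> L0.
transitivity (\sum_(0 <= j < P * L) ((A + j) %% L + D < L : nat)).
  apply: eq_bigr => j _; congr nat_of_bool.
  have := divn_eq (A + j) L; have := ltn_pmod (A + j) L0.
  rewrite addnAC; move: (A + j) => x; set q := x %/ L; set r := x %% L => rL ->.
  rewrite -addnA divnMDl// -{1}[q]addn0 eqn_add2l eq_sym -leqn0 leqNgt divn_gt0//.
  by rewrite -ltnNge.
rewrite (sum_modn_shift (fun r => (r + D < L) : nat)); congr (_ * _).
case: (leqP L D) => LD.
  rewrite (eqP LD) big_nat big1// => i _.
  by rewrite ltnNge (leq_trans LD) // leq_addl.
rewrite (@big_cat_nat _ _ _ (L - D))//= ?leq_subr//.
rewrite (eq_big_nat _ _ (F2 := fun=> 1)); last first.
  by move=> i /andP[_ h]; have -> : i + D < L by lia.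
rewrite sum_nat_const_nat subn0 muln1 [X in _ + X]big_nat [X in _ + X]big1 ?addn0//.
by move=> i /andP[h _]; lia.
Qed.

End ShiftedBlocks.

(** * Averaging common cells over slopes and shifts *)

Section CellKernel.
Variable R : realType.

Lemma count_shifted_block (L P : nat) (A B : int) : (0 < L)%N ->
  \sum_(0 <= j < P * L) ((((A + j%:Z) %/ L%:Z) == ((B + j%:Z) %/ L%:Z))%Z%:R : R)
  = (P * (L - `|A - B|))%N%:R.
Proof.
move=> L0.
wlog AB : A B / A <= B.
  move=> H; case: (lerP A B) => [/H//|/ltW/H].
  by rewrite distnC => <-; apply: eq_bigr => j _; rewrite eq_sym.
pose a := `|A %% L%:Z|%Z%N.
have aE : a%:Z = (A %% L%:Z)%Z by rewrite gez0_abs// modz_ge0//; lia.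
have L0' : L%:Z != 0 by lia.
rewrite -(count_shifted_block_nat P a `|A - B| L0) natr_sum; apply: eq_bigr => j _.
have e1 : A + j%:Z = (A %/ L%:Z)%Z * L%:Z + (a + j)%N%:Z.
  by rewrite PoszD addrA aE -divz_eq.
have e2 : B + j%:Z = (A %/ L%:Z)%Z * L%:Z + (a + `|A - B| + j)%N%:Z.
  by rewrite addnAC PoszD addrA -e1; lia.
by rewrite e1 e2 !divzMDl// (inj_eq (addrI _)) !divz_nat eqz_nat.
Qed.

(** Averaging over integer shifts produces the tent exactly: the shifts run through [2 ^ n] whole
    blocks, and on lattice points the discrete count has no error term. *)
Lemma count_shifted_block_tent (kap n : nat) (A B : int) : (n <= kap)%N ->
  2 ^+ n * (\sum_(0 <= j < 2 ^ kap)
    ((((A + j%:Z) %/ (2 ^ (kap - n))%N%:Z) == ((B + j%:Z) %/ (2 ^ (kap - n))%N%:Z))%Z%:R : R)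
    / (2 ^ kap)%N%:R)
  = tent n ((A - B)%:~R / (2 ^ kap)%N%:R).
Proof.
move=> nk; set L := (2 ^ (kap - n))%N.
have ME : (2 ^ kap = 2 ^ n * L)%N by rewrite -expnD subnKC.
have L0 : (0 < L)%N by rewrite expn_gt0.
rewrite -mulr_suml {1}ME count_shifted_block// /tent; congr (_ * _).
have M0 : (0 : R) < (2 ^ kap)%N%:R by rewrite ltr0n expn_gt0.
have e : 2 ^+ n = (2 ^ n)%N%:R :> R by rewrite natrX.
have p0 : (0 : R) < (2 ^ n)%N%:R by rewrite ltr0n expn_gt0.
have L0' : (0 : R) < L%:R by rewrite ltr0n.
rewrite normrM normfV (ger0_norm (ltW M0)) -intr_norm -abszE -pmulrn e ME natrM.
rewrite natrM -mulrA; set D := `|_|%N.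
have hx (x : R) : (2 ^ n)%:R * (x / ((2 ^ n)%:R * L%:R)) = x / L%:R.
  by field; rewrite !gt_eqF.
rewrite !hx; case: (leqP L D) => LD.
  have -> : (L - D)%N = 0%N by apply/eqP.
  by rewrite mul0r max_l// subr_le0 ler_pdivlMr// mul1r ler_nat.
rewrite max_r ?subr_ge0 ?ler_pdivrMr ?mul1r ?ler_nat 1?ltnW//.
by rewrite natrB 1?ltnW//; field; rewrite gt_eqF.
Qed.

Variables (m : nat) (k : 'I_m.+1) (kap : nat).
Local Notation M := (2 ^ kap)%N.
Implicit Types (p q : 'rV[R]_m.+1) (i : 'I_m) (j n : nat).

(** The coordinate of the projection in units of the lattice, rounded once and for all. Grids of
    every scale are built from these integers, so that a point enters only through finitely many
    integers. *)
Definition icoord p i j : int :=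
  Num.floor (M%:R * (p 0 (lift k i) - slope R M j * p 0 k)).

(* One slope and one shift of the grid for each of the [m] coordinates. *)
Definition param := {ffun 'I_m -> 'I_(8 * M) * 'I_M}.

(** The same shift serves every scale, so cells of scale [n.+1] are nested in cells of scale [n]. *)
Definition cell n (pi : param) p : {ffun 'I_m -> int} :=
  [ffun i => ((icoord p i (pi i).1 + (pi i).2%:Z) %/ (2 ^ (kap - n))%N%:Z)%Z].

Definition pweight (pi : param) : R :=
  \prod_i (chi (slope R M (pi i).1) / M%:R / M%:R).

Definition iline p q i j : R := (icoord p i j - icoord q i j)%:~R / M%:R.

(** The weighted average over all parameters of [2 ^+ (n * m)] times the indicator that [p] and [q]
    share a cell ([cell_kernelE]). It factors because each coordinate has its own slope and
    shift. *)
Definition cell_kernel n p q : R := \prod_i slope_avg M n (iline p q i).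

Lemma pweight_ge0 pi : 0 <= pweight pi.
Proof. by apply: prodr_ge0 => i _; rewrite !mulr_ge0 ?chi_ge0 ?invr_ge0. Qed.

Lemma sum_param_prod (F : 'I_m -> nat -> nat -> R) :
  \sum_(pi : param) \prod_i F i (pi i).1 (pi i).2
  = \prod_i \sum_(0 <= j < 8 * M) \sum_(0 <= j' < M) F i j j'.
Proof.
rewrite -(bigA_distr_bigA (fun i (x : 'I_(8 * M) * 'I_M) => F i x.1 x.2)).
apply: eq_bigr => i _.
rewrite -(pair_bigA _ (fun (a : 'I_(8 * M)) (b : 'I_M) => F i a b))/= big_mkord.
by apply: eq_bigr => j _; rewrite big_mkord.
Qed.

(** The weight is left general: with [chi] it gives the kernel, with [chi] cut to a window of slopes
    it gives the lower bound used at good points. *)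
Lemma weighted_cell_kernelE (phi : 'I_m -> nat -> R) n p q : (n <= kap)%N ->
  \sum_(pi : param) (\prod_i (phi i (pi i).1 / M%:R))
     * (2 ^+ (n * m) * (cell n pi p == cell n pi q)%:R)
  = \prod_i \sum_(0 <= j < 8 * M) phi i j * tent n (iline p q i j).
Proof.
move=> nk; pose L := (2 ^ (kap - n))%N%:Z.
pose F i j j' : R := phi i j / M%:R * (2 ^+ n *
  ((icoord p i j + j'%:Z) %/ L == (icoord q i j + j'%:Z) %/ L)%Z%:R).
transitivity (\sum_(pi : param) \prod_i F i (pi i).1 (pi i).2).
  apply: eq_bigr => pi _; rewrite [RHS]big_split/=; congr (_ * _).
  rewrite [RHS]big_split/= prodr_const card_ord -exprM; congr (_ * _).
  rewrite -natr_prod; congr _%:R.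
  have -> : (cell n pi p == cell n pi q) = [forall i,
     (((icoord p i (pi i).1 + (pi i).2%:Z) %/ L)%Z ==
      ((icoord q i (pi i).1 + (pi i).2%:Z) %/ L)%Z)].
    apply/eqP/forallP => [/ffunP E i|E]; first by have := E i; rewrite !ffunE => ->.
    by apply/ffunP => i; rewrite !ffunE; exact/eqP.
  case: forallP => [E|E]; first by rewrite big1// => i _; rewrite E.
  apply/esym/eqP; rewrite -leqn0 leqNgt; apply/negP => h; apply: E => i.
  by move: h; rewrite (bigD1 i)//= muln_gt0 => /andP[]; case: eqP.
rewrite sum_param_prod; apply: eq_bigr => i _; apply: eq_bigr => j _.
rewrite /iline -count_shifted_block_tent// mulrA mulr_sumr; apply: eq_bigr => j' _.
by rewrite /F; ring.
Qed.

Lemma cell_kernelE n p q : (n <= kap)%N ->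
  \sum_(pi : param) pweight pi * (2 ^+ (n * m) * (cell n pi p == cell n pi q)%:R)
  = cell_kernel n p q.
Proof. exact: (weighted_cell_kernelE (fun _ j => chi (slope R M j) / M%:R)). Qed.

Lemma iline_near p q i j :
  `|iline p q i j - line M ((p - q) 0 (lift k i)) ((p - q) 0 k) j| <= M%:R^-1.
Proof.
have M0 : (0 : R) < M%:R by rewrite ltr0n expn_gt0.
rewrite -(ler_pM2r M0) mulVf ?gt_eqF// -(ger0_norm (ltW M0)) -normrM.
rewrite mulrBl /iline divfK ?gt_eqF// /line !mxE.
set s := slope _ _ _.
set x := M%:R * (p 0 (lift k i) - s * p 0 k).
set y := M%:R * (q 0 (lift k i) - s * q 0 k).
have -> : (p 0 (lift k i) - q 0 (lift k i) - s * (p 0 k - q 0 k)) * M%:R = x - y.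
  by rewrite /x /y; ring.
rewrite intrB /icoord -/s -/x -/y.
have := floor_itv x; have := floor_itv y; rewrite !intrD.
by move=> /andP[? ?] /andP[? ?]; rewrite ler_norml; apply/andP; split; lra.
Qed.

Lemma cell_kernel_ge0 n p q : 0 <= cell_kernel n p q.
Proof. by apply: prodr_ge0 => i _; rewrite slope_avg_ge0 ?expn_gt0. Qed.

Lemma cell_kernel_le n p q : cell_kernel n p q <= 8 ^+ m * 2 ^+ (n * m).
Proof.
rewrite exprM -exprMn -[m in X in _ <= X]card_ord -prodr_const; apply: ler_prod => i _.
by rewrite slope_avg_ge0 ?slope_avg_le ?expn_gt0.
Qed.

Lemma sum_pweight_window_le (u : 'I_m -> R) (r : R) : 0 <= r ->
  \sum_(pi : param) pweight pi * ([forall i, `|slope R M (pi i).1 - u i| <= r]%:R : R)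
    <= (2 * r + M%:R^-1) ^+ m.
Proof.
move=> r0; have M0 : (0 : R) < M%:R by rewrite ltr0n expn_gt0.
pose F i (j j' : nat) : R := chi (slope R M j) / M%:R / M%:R * ((`|slope R M j - u i| <= r)%R%:R : R).
apply: (@le_trans _ _ (\sum_(pi : param) \prod_i F i (pi i).1 (pi i).2)).
  apply: ler_sum => pi _; rewrite big_split/= ler_wpM2l ?pweight_ge0//.
  by case: forallP => [h|_]; [rewrite big1// => i _; rewrite h|exact: prodr_ge0].
rewrite sum_param_prod -[m in X in _ <= X]card_ord -prodr_const.
apply: ler_prod => i _; apply/andP; split.
  by do 2!(apply: sumr_ge0 => ? _); rewrite !mulr_ge0 ?chi_ge0 ?invr_ge0.
apply: le_trans (slope_window_le _ (u i) r0); last by rewrite expn_gt0.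
apply: ler_sum => j _; rewrite sumr_const_nat subn0 -[leLHS]mulr_natl.
rewrite le_eqVlt; apply/orP; left; apply/eqP; field.
by rewrite gt_eqF.
Qed.

End CellKernel.

(** * Decay of the cell kernel *)

Section KernelBounds.
Variable R : realType.

(** Telescoping over the factors; multiplying by [B] on the left keeps the exponent [m] on the right
    instead of [m - 1]. *)
Lemma prod_diff_le (m : nat) (a b : 'I_m -> R) (B D : R) : 0 < B -> 0 <= D ->
  (forall i, 0 <= a i <= B) -> (forall i, 0 <= b i <= B) ->
  (forall i, a i - b i <= D) ->
  B * (\prod_i a i - \prod_i b i) <= m%:R * D * B ^+ m.
Proof.
move=> B0 D0; elim: m a b => [|m IH] a b ha hb hab.
  by rewrite !big_ord0 subrr mulr0 !mul0r.
rewrite !big_ord_recr/=; set A := \prod_(i < m) _; set A' := \prod_(i < m) _.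
set x := a _; set y := b _.
have h := IH _ _ (fun i => ha (widen_ord (leqnSn m) i))
  (fun i => hb (widen_ord (leqnSn m) i)) (fun i => hab (widen_ord (leqnSn m) i)).
have /andP[x0 xB] := ha ord_max; have hxy := hab ord_max.
rewrite -/A -/A' -/x -/y in h x0 xB hxy.
have A'0 : 0 <= A' by apply: prodr_ge0 => i _; case/andP: (hb (widen_ord (leqnSn m) i)).
have A'B : A' <= B ^+ m.
  by rewrite -[m in X in _ <= X]card_ord -prodr_const; apply: ler_prod => i _; exact: hb.
have -> : B * (A * x - A' * y) = B * (A - A') * x + B * (A' * (x - y)) by ring.
have -> : m.+1%:R * D * B ^+ m.+1 = m%:R * D * B ^+ m * B + B * (B ^+ m * D).
  by rewrite -natr1 exprS; ring.
apply: lerD.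
  have E : 0 <= m%:R * D * B ^+ m by rewrite !mulr_ge0 ?exprn_ge0 ?(ltW B0).
  by apply: (le_trans (ler_wpM2r x0 h)); rewrite ler_wpM2l.
rewrite ler_pM2l//; apply: (@le_trans _ _ (A' * D)); first by rewrite ler_wpM2l.
by rewrite ler_wpM2r.
Qed.

Variables (m : nat) (k : 'I_m.+1).
Implicit Types (p q : 'rV[R]_m.+1) (kap n l : nat) (Z s : R).

(** A relation that keeps a coordinate attaining the maximum: this coordinate decides whether the
    kernel vanishes. *)
Definition has_supnorm (z : 'rV[R]_m.+1) Z :=
  (forall i, `|z 0 i| <= Z) /\ exists i, `|z 0 i| = Z.

(** If the coordinate [k] carries a fixed part of [p - q], every factor obeys the bounds for lines
    of nonzero [b]. Otherwise a coordinate other than [k] dominates, no admissible slope sends it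
    near 0, and its factor is 0. *)
Lemma cell_kernel_far kap n p q Z : 64 * 8 ^+ n.+1 <= (2 ^ kap)%N%:R :> R ->
  has_supnorm (p - q) Z -> Z <= 1 -> 8 * (2 ^+ n)^-1 < Z ->
  cell_kernel k kap n.+1 p q = 0 \/
  [/\ Z <= 8 * `|(p - q) 0 k|, cell_kernel k kap n.+1 p q <= (4 / `|(p - q) 0 k|) ^+ m &
   cell_kernel k kap n.+1 p q - cell_kernel k kap n p q
     <= m%:R * (2 * ((2 ^+ n)^-1 / `|(p - q) 0 k|)) * (4 / `|(p - q) 0 k|) ^+ m].
Proof.
move=> hM [Zge [i0 Zi0]] Z1 hZ.
set b := (p - q) 0 k; set e := (2 ^+ n)^-1 in hZ *.
have e0 : 0 < e by rewrite invr_gt0 exprn_gt0.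
have d2 : (2 ^+ n.+1)^-1 = e / 2 :> R by rewrite exprS invfM mulrC.
have M0 : (0 < 2 ^ kap)%N by rewrite expn_gt0.
have iM : ((2 ^ kap)%N%:R : R)^-1 <= e.
  rewrite lef_pV2 ?posrE ?exprn_gt0 ?ltr0n//; apply: le_trans hM.
  have h8 : (2 : R) ^+ n <= 8 ^+ n by rewrite lerXn2r ?nnegrE//; lra.
  have : 0 <= (8 : R) ^+ n by rewrite exprn_ge0.
  by rewrite exprS; lra.
case: (lerP Z (8 * `|b|)) => hb.
  right; have bpos : 0 < `|b| by lra.
  have b0 : b != 0 by rewrite -normr_gt0.
  have S i : `|slope_avg (2 ^ kap) n.+1 (iline k kap p q i)
       - slope_avg (2 ^ kap) n (iline k kap p q i)| <= 8 * (e / `|b| ^+ 2)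
    /\ slope_avg (2 ^ kap) n (iline k kap p q i) <= 4 / `|b|
    /\ slope_avg (2 ^ kap) n.+1 (iline k kap p q i) <= 4 / `|b|.
    apply: (slope_avg_diff M0 (a := (p - q) 0 (lift k i))) => //.
    - by rewrite d2; lra.
    - exact: le_trans (Zge k) Z1.
    - exact: iline_near.
  have B0 : 0 < 4 / `|b| by rewrite divr_gt0.
  split=> //.
    rewrite -[m in X in _ <= X]card_ord -prodr_const; apply: ler_prod => i _.
    by rewrite slope_avg_ge0//=; have [_ []] := S i.
  rewrite -(ler_pM2l B0).
  apply: (le_trans (@prod_diff_le m _ _ (4 / `|b|) (8 * (e / `|b| ^+ 2)) B0 _ _ _ _)).
  - by rewrite !mulr_ge0 ?invr_ge0 ?exprn_ge0 ?ltW.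
  - by move=> i; rewrite slope_avg_ge0//=; have [_ []] := S i.
  - by move=> i; rewrite slope_avg_ge0//=; have [_ []] := S i.
  - by move=> i; have [h _] := S i; exact: le_trans (ler_norm _) h.
  rewrite le_eqVlt; apply/orP; left; apply/eqP; field.
  by rewrite gt_eqF.
left; have i0k : i0 != k.
  by apply/eqP => ik; move: Zi0 hb; rewrite ik -/b; have := normr_ge0 b; lra.
have [i iE] : exists i, i0 = lift k i.
  by case: (unliftP k i0) i0k => [i ->|->]; [exists i|rewrite eqxx].
rewrite /cell_kernel (bigD1 i)//= (slope_avg_eq0 (a := (p - q) 0 (lift k i)) (b := b)).
- by rewrite mul0r.
- by move=> j; exact: iline_near.
- by rewrite -iE Zi0 d2; lra.
Qed.

(** For [Z] at most 8 * 2^(-n) the trivial bound 2^(nm) suffices. Beyond, the gain 2^(-n) / [Z] over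
    the size [Z]^(-m) is better than the claim by the factor (2^(-n) / [Z])^(m + 1 - s), which is at
    most 1 because s <= m + 1. *)
Lemma cell_kernel_diff_le s : m%:R < s <= m%:R + 1 -> exists2 C, 0 < C &
  forall kap n p q Z, 64 * 8 ^+ n.+1 <= (2 ^ kap)%N%:R :> R ->
  has_supnorm (p - q) Z -> 0 < Z <= 1 ->
  cell_kernel k kap n.+1 p q - cell_kernel k kap n p q
    <= C * (((2 ^+ n)^-1 `^ (s - m%:R)) * Z `^ (- s)).
Proof.
move=> /andP[ms sm]; have s0 : 0 <= s by apply: le_trans (ltW ms).
pose C1 : R := 16 ^+ m * 8 `^ s; pose C2 : R := m%:R * (16 * 32 ^+ m).
have C10 : 0 < C1 by rewrite mulr_gt0 ?exprn_gt0 ?powR_gt0.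
have C20 : 0 <= C2 by rewrite !mulr_ge0 ?exprn_ge0.
exists (C1 + C2); first by rewrite ltr_wpDr.
move=> kap n p q Z hM hZ /andP[Z0 Z1].
set e := _^-1; have e0 : 0 < e by rewrite invr_gt0 exprn_gt0.
set X := _ `^ _ * _; have X0 : 0 <= X by rewrite mulr_ge0 ?powR_ge0.
have k0 := cell_kernel_ge0 k kap n p q.
case: (lerP Z (8 * e)) => Ze.
  apply: (@le_trans _ _ (C1 * X)); last by rewrite mulrDl lerDl mulr_ge0.
  apply: (@le_trans _ _ (16 ^+ m * e ^- m)).
    apply: (@le_trans _ _ (cell_kernel k kap n.+1 p q)); first by lra.
    apply: (le_trans (cell_kernel_le _ _ _ _ _)).
    rewrite -exprVn invrK exprM -!exprMn exprS mulrA.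
    by rewrite (_ : 8 * 2 = 16 :> R)//; ring.
  rewrite /C1 -!mulrA ler_pM2l ?exprn_gt0//.
  apply: (@le_trans _ _ (8 `^ s * (e `^ (s - m%:R) * (8 * e) `^ (- s)))).
    rewrite powRM// ?(ltW e0)// mulrCA mulrA mulrA.
    rewrite -[X in _ <= X * _]mulrA -powRD; last by rewrite pnatr_eq0 implybT.
    rewrite addrN powRr0 mulr1 -powRD; last by rewrite (gt_eqF e0) implybT.
    have -> : s - m%:R - s = - m%:R by ring.
    by rewrite powRN powR_mulrn ?(ltW e0).
  rewrite ler_pM2l ?powR_gt0// ler_wpM2l ?powR_ge0// !powRN lef_pV2 ?posrE ?powR_gt0//.
    by apply: ge0_ler_powR; rewrite ?nnegrE ?mulr_ge0// ltW.
  by rewrite mulr_gt0.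
have [->|[hb _ h]] := cell_kernel_far hM hZ Z1 Ze.
  by rewrite sub0r (@le_trans _ _ 0)// ?oppr_le0// mulr_ge0// addr_ge0// ltW.
apply: (le_trans h).
apply: (@le_trans _ _ (C2 * X)); last by rewrite mulrDl lerDr mulr_ge0// ltW.
set b := `|_| in hb *; have b0 : 0 < b by lra.
rewrite /C2 -!mulrA ler_wpM2l//.
have ib : b^-1 <= 8 / Z.
  by rewrite -[8]invrK -invfM lef_pV2 ?posrE ?mulr_gt0 ?invr_gt0// ; lra.
have h4 : 4 * b^-1 <= 32 * Z^-1 by move: ib; set y := Z^-1; lra.
apply: (@le_trans _ _ (2 * (e * (8 / Z * (32 / Z) ^+ m)))).
  rewrite ler_pM2l// ler_pM2l// ler_pM ?exprn_ge0 ?mulr_ge0 ?invr_ge0 ?(ltW b0)//.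
  by rewrite lerXn2r// ?nnegrE ?mulr_ge0 ?invr_ge0 ?(ltW b0) ?(ltW Z0).
rewrite exprMn.
have -> : 2 * (e * (8 / Z * (32 ^+ m * Z^-1 ^+ m))) = 16 * (32 ^+ m * (e * Z^-1 ^+ m.+1)).
  by rewrite exprS; ring.
rewrite ler_pM2l// ler_pM2l ?exprn_gt0//.
have -> : e * Z^-1 ^+ m.+1 = X * (e / Z) `^ (m%:R + 1 - s).
  rewrite powRM ?invr_ge0 ?(ltW e0) ?(ltW Z0)// /X mulrACA -powRD; last first.
    by rewrite (gt_eqF e0) implybT.
  have -> : s - m%:R + (m%:R + 1 - s) = 1 by ring.
  rewrite powRr1 ?(ltW e0)//; congr (_ * _).
  have -> : Z^-1 `^ (m%:R + 1 - s) = Z `^ (- (m%:R + 1 - s)).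
    by rewrite -powR_inv1 ?(ltW Z0)// -powRrM mulN1r.
  rewrite -powRD; last by rewrite (gt_eqF Z0) implybT.
  have -> : - s - (m%:R + 1 - s) = - (m.+1%:R) by rewrite -natr1; ring.
  by rewrite powRN powR_mulrn ?(ltW Z0)// exprVn.
rewrite ler_piMr//.
have eZ : e / Z <= 1 by rewrite ler_pdivrMr// mul1r; lra.
have eZ0 : 0 <= e / Z by rewrite divr_ge0 ?ltW.
apply: (@le_trans _ _ (1 `^ (m%:R + 1 - s))); last by rewrite powR1.
by apply: ge0_ler_powR; rewrite ?nnegrE// subr_ge0.
Qed.

(** The kernel is of size |p - q|^(-m), here read off a dyadic scale [l] of the distance; at the
    last scale [l = n] the trivial bound takes over. *)
Lemma cell_kernel_scale_le kap n l p q Z : 64 * 8 ^+ n.+1 <= (2 ^ kap)%N%:R :> R ->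
  (l <= n)%N -> l = n \/
    [/\ has_supnorm (p - q) Z, Z <= 1 & (2 ^+ l.+1)^-1 < Z] ->
  cell_kernel k kap n.+1 p q <= 256 ^+ m * 2 ^+ (l * m).
Proof.
move=> hM ln h; have pl : (0 : R) < 2 ^+ l by rewrite exprn_gt0.
have near : (2 : R) ^+ n <= 16 * 2 ^+ l ->
    cell_kernel k kap n.+1 p q <= 256 ^+ m * 2 ^+ (l * m).
  move=> nl; apply: (le_trans (cell_kernel_le _ _ _ _ _)).
  rewrite !exprM -!exprMn lerXn2r// ?nnegrE ?mulr_ge0 ?exprn_ge0// exprS.
  by move: nl pl; set x := 2 ^+ l; lra.
case: h => [lnE|[hZ Z1 lZ]].
  by apply: near; rewrite -lnE; lra.
have Z0 : 0 < Z by apply: lt_trans lZ; rewrite invr_gt0 exprn_gt0.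
have pn : (0 : R) < 2 ^+ n by rewrite exprn_gt0.
have lZ' : 1 < 2 * 2 ^+ l * Z.
  by rewrite -ltr_pdivrMl ?mulr_gt0// mulr1 -exprS.
case: (lerP Z (8 * (2 ^+ n)^-1)) => Ze.
  apply: near; have : 2 ^+ n * Z <= 8.
    by rewrite mulrC -ler_pdivlMr// mulrC.
  move=> h; rewrite -(ler_pM2r Z0); lra.
have [->|[hb h _]] := cell_kernel_far hM hZ Z1 Ze.
  by rewrite mulr_ge0 ?exprn_ge0.
apply: (le_trans h); rewrite exprM -exprMn lerXn2r// ?nnegrE ?mulr_ge0 ?exprn_ge0//.
set b := `|_| in hb *; have b0 : 0 < b by lra.
rewrite ler_pdivrMr//.
have h3 : 2 * 2 ^+ l * Z <= 2 * 2 ^+ l * (8 * b) by rewrite ler_pM2l ?mulr_gt0.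
lra.
Qed.

End KernelBounds.

(** * Orthogonality of martingale differences *)

Section MartingalePairing.
Variables (R : realFieldType) (T : Type) (C D : eqType) (c : T -> C) (par : C -> D).
Variable K : nat.
Hypothesis children_le : forall (s : seq C) d,
  uniq s -> (forall x, x \in s -> par x = d) -> (size s <= K)%N.
Implicit Types (l nu rho : seq (T * R)) (x y : C).

Definition mass l x : R := \sum_(a <- l) a.2 * (c a.1 == x)%:R.
Definition pmass l (d : D) : R := \sum_(a <- l) a.2 * (par (c a.1) == d)%:R.

Lemma sum_seq_pick (s : seq C) y (f : C -> R) : uniq s -> y \in s ->
  \sum_(x <- s) (y == x)%:R * f x = f y.
Proof.
move=> us ys; rewrite (bigD1_seq y)//= eqxx mul1r big1 ?addr0// => x.
by rewrite eq_sym => /negbTE ->; rewrite mul0r.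
Qed.

Lemma sum_cells l (s : seq C) (f : C -> R) : uniq s ->
  (forall x, x \in [seq c a.1 | a <- l] -> x \in s) ->
  \sum_(a <- l) a.2 * f (c a.1) = \sum_(x <- s) mass l x * f x.
Proof.
move=> us; rewrite /mass; elim: l => [_|a l IH hs].
  by rewrite big_nil big1// => x _; rewrite big_nil mul0r.
rewrite big_cons IH; last by move=> x xl; apply: hs; rewrite inE xl orbT.
under [RHS]eq_bigr do rewrite big_cons mulrDl.
rewrite big_split/=; congr (_ + _).
under eq_bigr do rewrite -mulrA; rewrite -mulr_sumr sum_seq_pick//.
by apply: hs; rewrite inE eqxx.
Qed.

Variables (nu rho : seq (T * R)) (alpha : R).
Hypothesis rho_ge0 : all (fun a => 0 <= a.2) rho.
Hypothesis alpha0 : 0 <= alpha.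

(* With [alpha] the inverse volume of a coarse cell and [K] fine cells in each
   coarse one, this is the difference of the densities at two consecutive scales. *)
Definition mgap x := K%:R * alpha * mass rho x - alpha * pmass rho (par x).

Lemma sum_children (s : seq C) d : uniq s -> \sum_(x <- s) (d == par x)%:R <= K%:R :> R.
Proof.
move=> us; rewrite -natr_sum ler_nat.
have -> : (\sum_(x <- s) (d == par x) = size [seq x <- s | d == par x])%N.
  by rewrite size_filter -sum1_count [RHS]big_mkcond; apply: eq_bigr => x _; case: eqP.
apply: (@children_le _ d); first exact: filter_uniq.
by move=> x; rewrite mem_filter => /andP[/eqP ->].
Qed.

(** In each cell, 2 a |g| <= th a^2 + g^2 / th. Expanding the sum of g^2, the cross term is minus
    twice a coarse energy, and the coarse squares give back at most one of these, since a coarse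
    cell has at most [K] children. What remains is fine minus coarse energy. It is an inequality
    because only cells met by the atoms are summed. *)
Lemma mgap_pairing (th : R) : 0 < th ->
  2 * \sum_(a <- nu) a.2 * `|mgap (c a.1)| <=
    th * (\sum_(a <- nu) \sum_(b <- nu) a.2 * b.2 * (c a.1 == c b.1)%:R)
  + th^-1 * (K%:R * alpha * (\sum_(a <- rho) \sum_(b <- rho) a.2 * b.2 *
      (K%:R * alpha * (c a.1 == c b.1)%:R - alpha * (par (c a.1) == par (c b.1))%:R))).
Proof.
move=> th0; pose s := undup ([seq c a.1 | a <- nu] ++ [seq c a.1 | a <- rho]).
have us : uniq s by exact: undup_uniq.
have s1 x : x \in [seq c a.1 | a <- nu] -> x \in s.
  by move=> h; rewrite mem_undup mem_cat h.
have s2 x : x \in [seq c a.1 | a <- rho] -> x \in s.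
  by move=> h; rewrite mem_undup mem_cat h orbT.
have swap (l : seq (T * R)) (E : eqType) (g : T -> E) :
   \sum_(a <- l) a.2 * (\sum_(b <- l) b.2 * (g b.1 == g a.1)%:R)
   = \sum_(a <- l) \sum_(b <- l) a.2 * b.2 * (g a.1 == g b.1)%:R.
  apply: eq_bigr => a _; rewrite mulr_sumr; apply: eq_bigr => b _.
  by rewrite mulrA eq_sym.
have N2 : \sum_(x <- s) mass nu x ^+ 2 =
    \sum_(a <- nu) \sum_(b <- nu) a.2 * b.2 * (c a.1 == c b.1)%:R.
  by rewrite -swap (sum_cells (mass nu) us s1); apply: eq_bigr => x _; rewrite expr2.
have M2 : \sum_(x <- s) mass rho x ^+ 2 =
    \sum_(a <- rho) \sum_(b <- rho) a.2 * b.2 * (c a.1 == c b.1)%:R.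
  by rewrite -swap (sum_cells (mass rho) us s2); apply: eq_bigr => x _; rewrite expr2.
pose P := \sum_(a <- rho) \sum_(b <- rho) a.2 * b.2 * (par (c a.1) == par (c b.1))%:R.
have MP : \sum_(x <- s) mass rho x * pmass rho (par x) = P.
  by rewrite /P -(swap _ _ (par \o c)) -(sum_cells (pmass rho \o par) us s2).
have pm0 d : 0 <= pmass rho d.
  rewrite /pmass; elim: rho rho_ge0 => [_|a l IH h]; first by rewrite big_nil.
  by case/andP: h => ? /IH h; rewrite big_cons addr_ge0 ?mulr_ge0.
(* Each coarse square is counted once per listed child, hence at most [K] times. *)
have PP : \sum_(x <- s) pmass rho (par x) ^+ 2 <= K%:R * P.
  have -> : \sum_(x <- s) pmass rho (par x) ^+ 2 =
      \sum_(a <- rho) a.2 * (pmass rho (par (c a.1)) *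
         \sum_(x <- s) (par (c a.1) == par x)%:R).
    under [RHS]eq_bigr do rewrite mulr_sumr mulr_sumr.
    rewrite exchange_big/=; apply: eq_bigr => x _.
    rewrite expr2 {1}/pmass mulr_suml; apply: eq_bigr => a _.
    by case: eqP => [->|_]; rewrite ?mulr1 ?mulr0 ?mul0r ?mulr0.
  have -> : K%:R * P = \sum_(a <- rho) a.2 * (pmass rho (par (c a.1)) * K%:R).
    rewrite /P -(swap _ _ (par \o c)) mulr_sumr; apply: eq_bigr => a _.
    by rewrite mulrCA [K%:R * _]mulrC.
  have : forall l, all (fun a => 0 <= a.2) l ->
    \sum_(a <- l) a.2 * (pmass rho (par (c a.1)) *
         \sum_(x <- s) (par (c a.1) == par x)%:R)
    <= \sum_(a <- l) a.2 * (pmass rho (par (c a.1)) * K%:R).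
    elim=> [_|a l IH h]; first by rewrite !big_nil.
    case/andP: h => a0 /IH h; rewrite !big_cons lerD//.
    by rewrite ler_wpM2l// ler_wpM2l// sum_children.
  exact.
rewrite (sum_cells (fun x => `|mgap x|) us s1) mulr_sumr.
apply: (@le_trans _ _ (\sum_(x <- s) (th * mass nu x ^+ 2 + th^-1 * mgap x ^+ 2))).
  apply: ler_sum => x _.
  rewrite -subr_ge0 -(real_normK (num_real (mgap x))).
  have -> : th * mass nu x ^+ 2 + th^-1 * `|mgap x| ^+ 2 - 2 * (mass nu x * `|mgap x|)
     = th * (mass nu x - th^-1 * `|mgap x|) ^+ 2.
    by field; rewrite gt_eqF.
  by rewrite mulr_ge0 ?sqr_ge0 ?ltW.
rewrite big_split/= -!mulr_sumr N2 lerD2l ler_pM2l ?invr_gt0//.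
set A := K%:R * alpha; have A0 : 0 <= A by rewrite mulr_ge0.
have -> : \sum_(a <- rho) \sum_(b <- rho) a.2 * b.2 *
      (A * (c a.1 == c b.1)%:R - alpha * (par (c a.1) == par (c b.1))%:R)
   = A * (\sum_(x <- s) mass rho x ^+ 2) - alpha * P.
  rewrite M2 /P !mulr_sumr -sumrB; apply: eq_bigr => a _.
  by rewrite !mulr_sumr -sumrB; apply: eq_bigr => b _; ring.
have -> : \sum_(x <- s) mgap x ^+ 2 = A ^+ 2 * (\sum_(x <- s) mass rho x ^+ 2)
   - 2 * (A * alpha) * P + alpha ^+ 2 * (\sum_(x <- s) pmass rho (par x) ^+ 2).
  rewrite -MP !mulr_sumr -sumrB -big_split/=; apply: eq_bigr => x _.
  by rewrite /mgap -/A; ring.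
have : alpha ^+ 2 * (\sum_(x <- s) pmass rho (par x) ^+ 2) <= A * alpha * P.
  apply: (le_trans (ler_wpM2l (exprn_ge0 2 alpha0) PP)).
  by rewrite le_eqVlt; apply/orP; left; apply/eqP; rewrite /A; ring.
set Q := alpha ^+ 2 * _; set S := \sum_(x <- s) _; lra.
Qed.

End MartingalePairing.

(** * A finite Frostman lemma *)

Section DyadicFrostman.
Variables (R : realType) (d : nat).
Implicit Types (p q : 'rV[R]_d) (l h : nat) (idx : 'rV[int]_d).

Definition dyad l p : 'rV[int]_d := \row_i Num.floor (2 ^+ l * p 0 i).

Definition child idx (e : {ffun 'I_d -> bool}) : 'rV[int]_d :=
  \row_i (2 * idx 0 i + (e i)%:Z).

Lemma dyad_itv l p idx i : dyad l p = idx ->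
  (idx 0 i)%:~R <= 2 ^+ l * p 0 i < (idx 0 i)%:~R + 1.
Proof. by move=> <-; rewrite !mxE; have := floor_itv (2 ^+ l * p 0 i); rewrite intrD. Qed.

Lemma dyad_def l p idx :
  (forall i, (idx 0 i)%:~R <= 2 ^+ l * p 0 i < (idx 0 i)%:~R + 1) -> dyad l p = idx.
Proof.
by move=> h; apply/rowP => i; rewrite !mxE; apply: floor_def; rewrite intrD h.
Qed.

Lemma childK idx e : (\row_i divz (child idx e 0 i) 2) = idx.
Proof.
apply/rowP => i; rewrite !mxE; case: (e i) => /=; lia.
Qed.

Lemma child_inj idx : injective (child idx).
Proof.
move=> e e' /rowP E; apply/ffunP => i; have := E i; rewrite !mxE.
by case: (e i); case: (e' i) => //=; lia.
Qed.

Lemma dyadS l p : dyad l p = \row_i divz (dyad l.+1 p 0 i) 2.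
Proof.
apply: dyad_def => i; rewrite !mxE.
have := floor_itv (2 ^+ l.+1 * p 0 i); set f := Num.floor _.
rewrite intrD exprS -mulrA; set x := 2 ^+ l * _.
have := divz_eq f 2; have := modz_ge0 f (d := 2) isT.
have := ltz_pmod f (d := 2) isT.
set a := (f %/ 2)%Z; set b := (f %% 2)%Z => b2 b0 ->.
rewrite intrD intrM.
have : (0 : R) <= b%:~R by rewrite ler0z.
have : (b%:~R : R) <= 1 by rewrite -[1]/(1%:~R) ler_int; lia.
by move=> ? ? /andP[? ?]; apply/andP; split; lra.
Qed.

Lemma dyad_coarsen l l' p q : (l <= l')%N -> dyad l' p = dyad l' q -> dyad l p = dyad l q.
Proof.
move=> /subnK <-; elim: (l' - l)%N => [//|n IH] E; apply: IH.
by rewrite dyadS [in RHS]dyadS -addSn E.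
Qed.

Lemma dyad_child l p : exists e, dyad l.+1 p = child (dyad l p) e.
Proof.
exists [ffun i => modz (dyad l.+1 p 0 i) 2 == 1].
apply/rowP => i; rewrite (dyadS l) !mxE ffunE !mxE; set f := Num.floor _.
have := divz_eq f 2; have := modz_ge0 f (d := 2) isT; have := ltz_pmod f (d := 2) isT.
set a := divz f 2; set b := modz f 2 => b2 b0 fE; rewrite {1}fE; case: eqP => /=; lia.
Qed.

(* Weights are built from the leaves up and rescaled on every cube whose mass
   exceeds its cost; each point is covered by the largest cube around it on which
   a rescaling took place, or by its leaf. *)
Lemma dyadic_frostman (A : set 'rV[R]_d) (tau : R) h l idx : 0 <= tau ->
  exists (nu : seq ('rV[R]_d * R)) (F : seq (nat * 'rV[int]_d)),
  [/\ forall a, a \in nu -> [/\ A a.1, dyad l a.1 = idx & 0 <= a.2],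
      forall p, A p -> dyad l p = idx -> exists2 c, c \in F & dyad c.1 p = c.2,
      \sum_(c <- F) tau ^+ c.1 = \sum_(a <- nu) a.2 &
      forall l' idx', (l <= l' <= l + h)%N ->
        \sum_(a <- nu) a.2 * (dyad l' a.1 == idx')%:R <= tau ^+ l'].
Proof.
move=> tau0; elim: h l idx => [|h IH] l idx.
  have [[p [Ap pl]]|nA] := pselect (exists p, A p /\ dyad l p = idx).
    exists [:: (p, tau ^+ l)], [:: (l, idx)]; split.
    - by move=> a; rewrite inE => /eqP -> /=; rewrite exprn_ge0.
    - by move=> q Aq ql; exists (l, idx); rewrite ?inE.
    - by rewrite !big_seq1.
    - move=> l' idx' h; have -> : l' = l by lia.
      by rewrite big_seq1/=; case: eqP; rewrite ?mulr1 ?mulr0 ?exprn_ge0.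
  exists [::], [::]; split=> //; rewrite ?big_nil//.
    by move=> p Ap pl; case: nA; exists p.
  by move=> l' idx' _; rewrite big_nil exprn_ge0.
have /choice[f hf] : forall e, exists x : seq ('rV[R]_d * R) * seq (nat * 'rV[int]_d),
  [/\ forall a, a \in x.1 -> [/\ A a.1, dyad l.+1 a.1 = child idx e & 0 <= a.2],
      forall p, A p -> dyad l.+1 p = child idx e -> exists2 c, c \in x.2 & dyad c.1 p = c.2,
      \sum_(c <- x.2) tau ^+ c.1 = \sum_(a <- x.1) a.2 &
      forall l' idx', (l.+1 <= l' <= l.+1 + h)%N ->
        \sum_(a <- x.1) a.2 * (dyad l' a.1 == idx')%:R <= tau ^+ l'].
  by move=> e; have [nu [F H]] := IH l.+1 (child idx e); exists (nu, F).
pose nu := flatten [seq (f e).1 | e : {ffun 'I_d -> bool}].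
pose F := flatten [seq (f e).2 | e : {ffun 'I_d -> bool}].
have nuP a : a \in nu -> exists e, a \in (f e).1.
  by move=> /flatten_mapP[e _ ?]; exists e.
have nu1 a : a \in nu -> [/\ A a.1, dyad l a.1 = idx & 0 <= a.2].
  move=> /nuP[e ae]; have [+ _ _ _] := hf e => /(_ _ ae)[? E ?]; split=> //.
  by rewrite dyadS E childK.
have sumnu (g : 'rV[R]_d * R -> R) : \sum_(a <- nu) g a = \sum_e \sum_(a <- (f e).1) g a.
  by rewrite big_flatten/= big_map big_enum.
have F2 p : A p -> dyad l p = idx -> exists2 c, c \in F & dyad c.1 p = c.2.
  move=> Ap pl; have [e pe] := dyad_child l p; rewrite pl in pe.
  have [_ /(_ _ Ap pe)[c cF cp] _ _] := hf e; exists c => //.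
  by apply/flatten_mapP; exists e; rewrite ?mem_enum.
have FN : \sum_(c <- F) tau ^+ c.1 = \sum_(a <- nu) a.2.
  rewrite sumnu big_flatten/= big_map big_enum; apply: eq_bigr => e _.
  by have [_ _] := hf e.
have fine l' idx' : (l.+1 <= l' <= l.+1 + h)%N ->
    \sum_(a <- nu) a.2 * (dyad l' a.1 == idx')%:R <= tau ^+ l'.
  move=> hl'; rewrite sumnu.
  (* At a level finer than [l], a cube lies in a single child, so its bound is inherited from the
     measure of that child. *)
  have [[e0 [b b0 bE]]|no] :=
      pselect (exists e, exists2 b, b \in (f e).1 & dyad l' b.1 = idx').
    rewrite (bigD1 e0)//= [X in _ + X]big1 ?addr0.
      by have [_ _ _] := hf e0; exact.
    move=> e ee0; rewrite big_seq big1// => a ae; case: eqP => [aE|]; last by rewrite mulr0.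
    have [/(_ _ ae)[_ a1 _] _ _ _] := hf e; have [/(_ _ b0)[_ b1 _] _ _ _] := hf e0.
    case/eqP: ee0; apply: (@child_inj idx); rewrite -a1 -b1.
    by apply: (@dyad_coarsen _ l'); [case/andP: hl'|rewrite aE bE].
  rewrite big1 ?exprn_ge0// => e _; rewrite big_seq big1// => a ae.
  by case: eqP => [aE|]; [case: no; exists e, a|rewrite mulr0].
have sub l' idx' : \sum_(a <- nu) a.2 * (dyad l' a.1 == idx')%:R <= \sum_(a <- nu) a.2.
  rewrite [leLHS]big_seq [leRHS]big_seq; apply: ler_sum => a /nu1[_ _ a0].
  by case: eqP; rewrite ?mulr1 ?mulr0.
have [le|lt] := lerP (\sum_(a <- nu) a.2) (tau ^+ l).
  exists nu, F; split=> // l' idx' hl'.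
  have [ll'|] := eqVneq l' l; first by rewrite ll'; exact: le_trans le.
  by move=> ?; apply: fine; lia.
set S := \sum_(a <- nu) a.2 in lt sub.
have tl : 0 <= tau ^+ l by rewrite exprn_ge0.
have S0 : 0 < S by exact: le_lt_trans lt.
pose r := tau ^+ l / S.
have r0 : 0 <= r by rewrite divr_ge0// ltW.
have r1 : r <= 1 by rewrite ler_pdivrMr// mul1r ltW.
have rS : r * S = tau ^+ l by rewrite divfK// gt_eqF.
exists [seq (a.1, r * a.2) | a <- nu], [:: (l, idx)]; split.
- by move=> a /mapP[b /nu1[? ? ?] ->]/=; split=> //; rewrite mulr_ge0.
- by move=> q Aq ql; exists (l, idx); rewrite ?inE.
- by rewrite big_seq1 big_map/= -mulr_sumr rS.
move=> l' idx' hl'; rewrite big_map/=.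
under eq_bigr do rewrite -mulrA; rewrite -mulr_sumr.
have [->|ll'] := eqVneq l' l.
  by apply: (le_trans (ler_wpM2l r0 (sub _ _))); rewrite rS.
have fl : \sum_(a <- nu) a.2 * (dyad l' a.1 == idx')%:R <= tau ^+ l'.
  by apply: fine; lia.
apply: le_trans fl; rewrite ler_piMl// big_seq sumr_ge0// => a /nu1[_ _ ?].
by rewrite mulr_ge0.
Qed.

End DyadicFrostman.

(** * Measures on cells and the energy *)

Section StepFunctions.
Context d (T : measurableType d) (R : realType) (mu : {measure set T -> \bar R}).

(** The integral of a nonnegative function is a supremum over simple functions below it, so
    monotonicity needs no measurability. This allows bounding the outer integral of the energy
    without measurability of the inner one. *)
Lemma le_integral_nomeas (f g : T -> \bar R) :
  (forall x, 0 <= f x)%E -> (forall x, f x <= g x)%E ->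
  (\int[mu]_x f x <= \int[mu]_x g x)%E.
Proof.
move=> f0 fg; have g0 x : (0 <= g x)%E by exact: le_trans (fg x).
rewrite !ge0_integralTE//; apply: ge_ereal_sup => _ [h /= hf <-].
by apply: ereal_sup_ubound; exists h => //= x; exact: le_trans (fg x).
Qed.

Lemma step_le_integral (A : finType) (P : A -> set T) (c : A -> R) (f : T -> \bar R) :
  (forall a, measurable (P a)) -> trivIset setT P -> (forall a, 0 <= c a) ->
  (forall x, 0 <= f x)%E -> (forall a x, P a x -> ((c a)%:E <= f x)%E) ->
  (\sum_a (c a)%:E * mu (P a) <= \int[mu]_x f x)%E.
Proof.
move=> mP tP c0 f0 cf.
pose g x : \bar R := (\sum_a (c a * \1_(P a) x)%:E)%E.
have -> : (\sum_a (c a)%:E * mu (P a) = \int[mu]_x g x)%E.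
  rewrite ge0_integral_sum//=.
  - apply: eq_bigr => a _; rewrite (_ : (fun x => _) = (fun x => (c a)%:E * (\1_(P a) x)%:E)%E).
      rewrite ge0_integralZl_EFin//; last by apply/measurable_EFinP; exact: measurable_indic.
      by rewrite integral_indic// setIT.
    by apply/funext => x; rewrite EFinM.
  - move=> a; apply/measurable_EFinP; apply: measurable_funM; first exact: measurable_cst.
    exact: measurable_indic.
  - by move=> a x _; rewrite lee_fin mulr_ge0.
apply: le_integral_nomeas => x.
  by apply: sume_ge0 => a _; rewrite lee_fin mulr_ge0.
rewrite /g; have [[a Pax]|no] := pselect (exists a, P a x).
  rewrite (bigD1 a)//= big1 ?adde0.
    by rewrite indicE mem_set// mulr1; exact: cf.
  move=> b ba; rewrite indicE memNset ?mulr0// => Pbx.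
  by move/eqP: ba; apply; apply: (tP b a) => //; exists x.
rewrite big1// => a _; rewrite indicE memNset ?mulr0// => Pax.
by apply: no; exists a.
Qed.

Lemma measure_fintype (A : finType) (P : A -> set T) :
  (forall a, measurable (P a)) -> trivIset setT P ->
  (mu (\bigcup_a P a) = \sum_a mu (P a))%E.
Proof.
move=> mP tP; rewrite measure_fin_bigcup//; last by exact: finite_finset.
rewrite (_ : [set: A] = [set` enum A]); first by rewrite -fsbig_seq ?enum_uniq// big_enum.
by apply/seteqP; split=> a //= _; rewrite mem_enum.
Qed.

End StepFunctions.

Section BorelSets.
Variables (R : realType) (n : nat).
Notation T := (Borel R n).
Notation E := 'rV[R]_n.

Lemma open_borel (U : set E) : open U -> measurable (U : set T).
Proof. by move=> oU; exact: sub_sigma_algebra. Qed.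

Lemma closed_borel (U : set E) : closed U -> measurable (U : set T).
Proof.
by move=> cU; rewrite -[U]setCK; apply: measurableC; apply: open_borel; exact: closed_openC.
Qed.

Lemma borel_itv (f : E -> R) (a b : R) : continuous f ->
  measurable ([set p | a <= f p < b] : set T).
Proof.
move=> cf.
have -> : [set p | a <= f p < b] = f @^-1` [set x | x >= a] `&` f @^-1` [set x | x < b].
  by apply/seteqP; split => p /=; [move=> /andP[]|move=> [-> ->]].
apply: measurableI.
  by apply: closed_borel; apply: preimage_closed; [move=> x _; exact: cf|exact: closed_ge].
by apply: open_borel; apply: open_comp; [move=> x _; exact: cf|exact: open_lt].
Qed.

Lemma continuous_coord (i : 'I_n) : continuous (fun p : E => p 0 i).
Proof. exact: coord_continuous. Qed.

Lemma borel_floor (f : E -> R) (z : int) : continuous f ->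
  measurable ([set p | Num.floor (f p) = z] : set T).
Proof.
move=> cf; rewrite (_ : [set _ | _] = [set p | z%:~R <= f p < (z + 1)%:~R]).
  exact: borel_itv.
apply/seteqP; split => p /=; first by move=> <-; exact: floor_itv.
exact: floor_def.
Qed.

Lemma borel_forall (I : finType) (P : I -> set E) :
  (forall i, measurable (P i : set T)) -> measurable ([set p | forall i, P i p] : set T).
Proof.
move=> mP; rewrite (_ : [set _ | _] = \bigcap_(i in setT) P i).
  by apply: fin_bigcap_measurable => //; exact: finite_finset.
by apply/seteqP; split => p /= h i; [move=> _|]; exact: h.
Qed.

Lemma borel_dyad l (idx : 'rV[int]_n) : measurable ([set p | dyad l p = idx] : set T).
Proof.
rewrite (_ : [set _ | _] = [set p : E | forall i, Num.floor (2 ^+ l * p 0 i) = idx 0 i]).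
  apply: borel_forall => i; apply: borel_floor => p.
  by apply: (@continuousM R E); [exact: cst_continuous|exact: continuous_coord].
apply/seteqP; split => p /=; first by move=> <- i; rewrite mxE.
by move=> h; apply/rowP => i; rewrite mxE.
Qed.

Lemma dyad_dist l (p q : E) i : dyad l p = dyad l q -> `|p 0 i - q 0 i| <= (2 ^+ l)^-1.
Proof.
move=> h; have /andP[p1 p2] := dyad_itv i (erefl (dyad l p)).
have /andP[q1 q2] := dyad_itv i (esym h).
have t0 : (0 : R) < 2 ^+ l by rewrite exprn_gt0.
rewrite -(ler_pM2l t0) mulfV ?gt_eqF// -{1}(ger0_norm (ltW t0)) -normrM mulrBr.
by rewrite ler_norml; apply/andP; split; lra.
Qed.

Lemma dyad_bounded l (idx : 'rV[int]_n) : exists B : R, forall p, dyad l p = idx ->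
  forall i, `|p 0 i| <= B.
Proof.
exists (\sum_i `|idx 0 i|%:~R + 1) => p pE i.
have /andP[p1 p2] := dyad_itv i pE.
have t0 : (1 : R) <= 2 ^+ l by rewrite exprn_ege1// ler1n.
have h : `|2 ^+ l * p 0 i| <= `|idx 0 i|%:~R + 1.
  rewrite intr_norm; have := ler_norm ((idx 0 i)%:~R : R).
  have := ler_norm (- (idx 0 i)%:~R : R); rewrite normrN ler_norml => ? ?.
  by apply/andP; split; lra.
apply: (@le_trans _ _ `|2 ^+ l * p 0 i|).
  by rewrite normrM ler_peMl// ger0_norm//; lra.
apply: (le_trans h); rewrite lerD2r (bigD1 i)//= lerDl; apply: sumr_ge0 => j _.
by rewrite ler0z.
Qed.

Lemma compact_box (B : R) : compact [set p : E | forall i, `|p 0 i| <= B].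
Proof.
rewrite (_ : [set _ | _] = [set v : E | forall i, v 0 i \in `[(- B), B]]).
  apply: (@rV_compact _ _ (fun=> `[(- B), B]%classic)).
  by move=> _; apply: segment_compact.
by apply/seteqP; split=> p /= h i; have := h i; rewrite in_itv/= ler_norml.
Qed.

Lemma borel_bounded_lty (mu : {measure set T -> \bar R}) (A : set E) B :
  (forall K : set (Rd R n), compact K -> (mu K < +oo)%E) ->
  measurable (A : set T) -> (forall p, A p -> forall i, `|p 0 i| <= B) ->
  (mu A < +oo)%E.
Proof.
move=> hmu mA hA; have cB := @compact_box B.
apply: le_lt_trans (hmu _ cB); apply: le_measure; rewrite ?inE//.
by apply: closed_borel; apply: compact_closed.
Qed.

End BorelSets.

Section EnergyLowerBound.
Variables (R : realType) (n : nat).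
Notation T := (Borel R n).
Notation E := 'rV[R]_n.
Variables (mu : {measure set T -> \bar R}) (s : R).

(** The energy integrand is [+oo] on the diagonal, so [kappa] has to be compared with the Riesz
    kernel at distinct points only; in particular diagonal blocks [kappa a a] are allowed. *)
Lemma energy_step_le (A : finType) (P : A -> set E) (kappa : A -> A -> R) :
  (forall a, measurable (P a : set T)) -> trivIset setT P ->
  (forall a, (mu (P a) < +oo)%E) -> (forall a b, 0 <= kappa a b) ->
  (forall a b x y, P a x -> P b y -> x <> y -> kappa a b <= enorm (x - y) `^ (- s)) ->
  ((\sum_a \sum_b fine (mu (P a)) * fine (mu (P b)) * kappa a b)%:E <= energy mu s)%E.
Proof.
move=> mP tP fP k0 hk.
have muE a : mu (P a) = (fine (mu (P a)))%:E.
  by rewrite fineK// ge0_fin_numE.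
pose f (x y : T) : \bar R := if x == y then +oo%E else (enorm ((x : E) - y) `^ (- s))%:E.
have f0 x y : (0 <= f x y)%E by rewrite /f; case: ifP => // _; rewrite lee_fin powR_ge0.
have step1 a x : P a x -> ((\sum_b fine (mu (P b)) * kappa a b)%:E <= \int[mu]_y f x y)%E.
  move=> Pax; have := @step_le_integral _ T R mu A P (kappa a) (f x) mP tP (k0 a) (f0 x).
  have -> : (\sum_b (kappa a b)%:E * mu (P b) =
     (\sum_b fine (mu (P b)) * kappa a b)%:E)%E.
    rewrite -sumEFin.
    by apply: eq_bigr => b _; rewrite {1}muE -EFinM mulrC.
  apply=> b y Pby; rewrite /f; case: eqP => [_|xy]; first by rewrite leey.
  by rewrite lee_fin; exact: hk Pax Pby xy.
have := @step_le_integral _ T R mu A P (fun a => \sum_b fine (mu (P b)) * kappa a b)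
  (fun x => \int[mu]_y f x y)%E mP tP.
have -> : (\sum_a (\sum_b fine (mu (P b)) * kappa a b)%:E * mu (P a) =
   (\sum_a \sum_b fine (mu (P a)) * fine (mu (P b)) * kappa a b)%:E)%E.
  rewrite -sumEFin; apply: eq_bigr => a _; rewrite {1}(muE a) -EFinM mulrC mulr_sumr.
  by congr (_%:E); apply: eq_bigr => b _; rewrite mulrA.
apply=> //.
- by move=> a; apply: sumr_ge0 => b _; rewrite mulr_ge0 ?fine_ge0.
- by move=> x; apply: integral_ge0 => y _.
Qed.

End EnergyLowerBound.

(** * Replacing the measure by finitely many atoms *)

Section Discretization.
Variables (R : realType) (m : nat) (k : 'I_m.+1) (kap : nat).
Notation T := (Borel R m.+1).
Notation E := 'rV[R]_m.+1.
Notation M := (2 ^ kap)%N.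
Implicit Types p q : E.

(** Cells and kernels are constant on these classes, so collapsing the mass of a class to one point
    does not affect them. *)
Definition same_icoord p q := forall i j, (j < 8 * M)%N -> icoord k kap p i j = icoord k kap q i j.

Lemma same_icoord_cell n pi p q : same_icoord p q -> cell k (kap := kap) n pi p = cell k n pi q.
Proof. by move=> h; apply/ffunP => i; rewrite !ffunE h. Qed.

Lemma same_icoord_kernel n p p' q q' : same_icoord p p' -> same_icoord q q' ->
  cell_kernel k kap n p q = cell_kernel k kap n p' q'.
Proof.
move=> hp hq; apply: eq_bigr => i _; apply: eq_big_nat => j /andP[_ jM].
by rewrite /iline hp ?hq.
Qed.

Lemma icoord_bounded l (idx : 'rV[int]_m.+1) : exists B : nat, forall p i j,
  dyad l p = idx -> (j < 8 * M)%N -> (`|icoord k kap p i j| <= B)%N.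
Proof.
have [B0 hB] := @dyad_bounded R m.+1 l idx.
have M0 : (0 : R) < M%:R by rewrite ltr0n expn_gt0.
(* The 5 is 1 plus the bound 4 on the slopes; one of the two extra units is for the truncation, the
   other for the floor in [icoord]. *)
exists (Num.truncn (M%:R * (5 * `|B0|))).+2 => p i j pE jM.
have h1 := le_trans (hB p pE (lift k i)) (ler_norm _).
have h2 := le_trans (hB p pE k) (ler_norm _).
have sl : `|slope R M j| <= 4.
  rewrite /slope ler_norml; have : (j%:R / M%:R : R) <= 8.
    by rewrite ler_pdivrMr// -natrM ler_nat ltnW.
  have : 0 <= (j%:R / M%:R : R) by rewrite divr_ge0// ltW.
  by set x := j%:R / _ => ? ?; apply/andP; split; lra.
set x := M%:R * (p 0 (lift k i) - slope R M j * p 0 k).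
have hx : `|x| <= M%:R * (5 * `|B0|).
  rewrite normrM (ger0_norm (ltW M0)) ler_pM2l//.
  apply: (le_trans (ler_normB _ _)); rewrite normrM.
  have : `|slope R M j| * `|p 0 k| <= 4 * `|B0| by rewrite ler_pM.
  lra.
have x0 : 0 <= M%:R * (5 * `|B0|) by rewrite !mulr_ge0 ?(ltW M0).
have /andP[_ ] := truncn_itv x0; set t := Num.truncn _ => ht.
have := floor_itv x; rewrite -/(icoord k kap p i j) intrD => /andP[f1 f2].
have h3 : (`|icoord k kap p i j|%N%:R : R) <= t.+2%:R.
  rewrite natr_absz intr_norm ler_norml -!natr1.
  move: hx ht; rewrite ler_norml -natr1 => /andP[? ?] ?.
  by apply/andP; split; lra.
by rewrite ler_nat in h3.
Qed.

Lemma continuous_icoord i j : continuous (fun p : E =>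
  M%:R * (p 0 (lift k i) - slope R M j * p 0 k)).
Proof.
move=> p; apply: (@continuousM R E); first exact: cst_continuous.
apply: (@continuousB R _ E); first exact: continuous_coord.
by apply: (@continuousM R E); [exact: cst_continuous|exact: continuous_coord].
Qed.

Lemma icoord_atoms l (idx : 'rV[int]_m.+1) :
  exists (A : finType) (P : A -> set E) (r : A -> E),
  [/\ forall a, measurable (P a : set T), trivIset setT P,
      \bigcup_a P a = [set p | dyad l p = idx] &
      forall a p, P a p -> same_icoord (r a) p].
Proof.
have [B hB] := icoord_bounded l idx.
pose A : finType := {ffun 'I_m * 'I_(8 * M) -> 'I_(2 * B).+1}.
pose Q (a : A) : set E := [set p |
  forall ij : 'I_m * 'I_(8 * M), icoord k kap p ij.1 ij.2 = (a ij)%:Z - B%:Z].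
pose P (a : A) : set E := [set p | dyad l p = idx] `&` Q a.
have /choice[r hr] : forall a, exists p0 : E, forall p, P a p -> same_icoord p0 p.
  move=> a; have [[p0 Pp0]|no] := pselect (exists p, P a p).
    exists p0 => p [_ Pp] i j jM; have [_ Pp0'] := Pp0.
    by have := Pp (i, Ordinal jM); rewrite -(Pp0' (i, Ordinal jM)).
  (* An empty class receives an arbitrary representative; its atom will have mass 0. *)
  by exists 0 => p Pp; case: no; exists p.
exists A, P, r; split=> //.
- move=> a; apply: measurableI; first exact: borel_dyad.
  apply: (@borel_forall R m.+1 _ (fun ij : 'I_m * 'I_(8 * M) =>
    [set p | icoord k kap p ij.1 ij.2 = (a ij)%:Z - B%:Z])) => ij.
  by apply: borel_floor; exact: continuous_icoord.
- apply/trivIsetP => a b _ _ /eqP ab; apply/seteqP; split=> // p [[_ pa] [_ pb]].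
  apply: ab; apply/ffunP => ij; apply/val_inj => /=.
  by have := pa ij; rewrite pb => /addIr [].
- apply/seteqP; split=> p /=; first by case=> a _ [].
  move=> pE; exists [ffun ij : 'I_m * 'I_(8 * M) =>
    inord (absz (icoord k kap p ij.1 ij.2 + B%:Z))] => //; split=> // ij.
  have := hB p ij.1 ij.2 pE (ltn_ord ij.2); rewrite ffunE.
  set x := icoord _ _ _ _ _ => hx; rewrite inordK; lia.
Qed.

Variables (mu : {measure set T -> \bar R}) (s : R).
Hypothesis mu_fin : forall K : set (Rd R m.+1), compact K -> (mu K < +oo)%E.
Hypothesis mu_energy : (energy mu s < +oo)%E.

Lemma dyad_lty l idx : (mu [set p | dyad l p = idx] < +oo)%E.
Proof.
have [B hB] := @dyad_bounded R m.+1 l idx.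
apply: (borel_bounded_lty mu_fin); first exact: borel_dyad.
exact: hB.
Qed.

(** Each class inside the cube becomes one atom with the mass of the class. Sums of class-invariant
    kernels over the atoms are energies of step kernels, hence bounded by the energy of [mu]. A set
    [D] is tested only through an invariant [H], since a class may lie partly in [D]. *)
Lemma discretization l (idx : 'rV[int]_m.+1) (Y := [set p : E | dyad l p = idx]) :
  exists rho : seq (E * R),
  [/\ all (fun a => 0 <= a.2) rho,
      \sum_(a <- rho) a.2 = fine (mu Y),
      forall kappa : E -> E -> R, (forall p q, 0 <= kappa p q) ->
        (forall p p' q q', same_icoord p p' -> same_icoord q q' -> kappa p q = kappa p' q') ->
        (forall p q, Y p -> Y q -> p <> q -> kappa p q <= enorm (p - q) `^ (- s)) ->
        \sum_(a <- rho) \sum_(b <- rho) a.2 * b.2 * kappa a.1 b.1 <= fine (energy mu s) &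
      forall (D : set E) (H : E -> R) c, measurable (D : set T) -> D `<=` Y ->
        (forall p q, same_icoord p q -> H p = H q) -> (forall p, 0 <= H p) -> 0 <= c ->
        (forall p, D p -> c <= H p) ->
        c * fine (mu D) <= \sum_(a <- rho) a.2 * H a.1].
Proof.
have [A [P [r [mP tP PY hr]]]] := icoord_atoms l idx.
have mY : measurable (Y : set T) by exact: borel_dyad.
have fY : (mu Y < +oo)%E by exact: dyad_lty.
have PsY a : P a `<=` Y by move=> p Pp; rewrite /Y -PY; exists a.
have fP a : (mu (P a) < +oo)%E.
  by apply: le_lt_trans fY; apply: le_measure; rewrite ?inE//; exact: PsY.
pose w a := fine (mu (P a)).
have w0 a : 0 <= w a by rewrite fine_ge0.
have wE a : mu (P a) = (w a)%:E by rewrite fineK// ge0_fin_numE.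
pose rho := [seq (r a, w a) | a <- enum A].
have sumrho (G : E * R -> R) : \sum_(a <- rho) G a = \sum_a G (r a, w a).
  by rewrite big_map big_enum.
exists rho; split.
- by apply/allP => x /mapP[a _ ->] /=.
- rewrite sumrho/= /Y -PY (@measure_fintype _ T R mu A P mP tP).
  by rewrite (eq_bigr (fun a => (w a)%:E))// sumEFin.
- move=> kap0 k0 kinv kle; rewrite sumrho; under eq_bigr do rewrite sumrho/=.
  rewrite -lee_fin fineK; last first.
    rewrite ge0_fin_numE//; apply: integral_ge0 => x _; apply: integral_ge0 => y _.
    by case: ifP => // _; rewrite lee_fin powR_ge0.
  apply: (@energy_step_le R m.+1 mu s A P (fun a b => kap0 (r a) (r b))) => //.
  move=> a b x y Pax Pby xy.
  by rewrite (kinv _ _ _ _ (hr _ _ Pax) (hr _ _ Pby)); apply: kle xy; [exact: PsY Pax|exact: PsY Pby].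
- move=> D H c mD DY Hinv H0 c0 cH; rewrite sumrho/=.
  have mDP a : measurable (D `&` P a : set T) by exact: measurableI.
  have fDP a : (mu (D `&` P a) < +oo)%E.
    by apply: le_lt_trans (fP a); apply: le_measure; rewrite ?inE.
  have tDP : trivIset setT (fun a => D `&` P a).
    exact: trivIset_setIl.
  have -> : fine (mu D) = \sum_a fine (mu (D `&` P a)).
    have -> : D = \bigcup_a (D `&` P a).
      by rewrite -setI_bigcupr PY; apply/esym/setIidPl.
    rewrite (@measure_fintype _ T R mu A _ mDP tDP).
    rewrite (eq_bigr (fun a => (fine (mu (D `&` P a)))%:E)); last first.
      by move=> a _; rewrite fineK// ge0_fin_numE.
    rewrite sumEFin/=; apply: eq_bigr => a _; congr (fine (mu _)).
    by rewrite -setI_bigcupr PY; congr (_ `&` _); apply/esym/setIidPl.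
  rewrite mulr_sumr; apply: ler_sum => a _.
  have [[p [Dp Pp]]|no] := pselect (exists p, D p /\ P a p).
    rewrite (Hinv _ _ (hr _ _ Pp)) mulrC ler_pM ?fine_ge0//; last exact: cH.
    by apply: fine_le; rewrite ?ge0_fin_numE//; apply: le_measure; rewrite ?inE.
  rewrite (_ : D `&` P a = set0) ?measure0 ?mulr0 ?mulr_ge0//.
  by apply/seteqP; split=> // p [? ?]; apply: no; exists p.
Qed.

End Discretization.

Section EuclideanNorm.
Variables (R : realType) (m : nat).
Implicit Types z : 'rV[R]_m.+1.

Lemma supnorm_exists z : exists Z, has_supnorm z Z.
Proof.
pose i0 := [arg max_(i > ord0 : 'I_m.+1) `|z 0 i|]%O.
exists `|z 0 i0|; split; last by exists i0.
by move=> i; rewrite /i0; case: arg_maxP => //= j _; apply.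
Qed.

Lemma supnorm_gt0 z Z : has_supnorm z Z -> z <> 0 -> 0 < Z.
Proof.
move=> [zZ [i iZ]] z0; rewrite lt_neqAle -{2}iZ normr_ge0 andbT.
apply/eqP => Z0; apply: z0; apply/rowP => j; rewrite mxE.
by apply/eqP; rewrite -normr_le0 Z0 zZ.
Qed.

Lemma coord_le_enorm z i : `|z 0 i| <= enorm z.
Proof.
rewrite -sqrtr_sqr ler_sqrt; last by apply: sumr_ge0 => j _; exact: sqr_ge0.
by rewrite (bigD1 i)//= lerDl; apply: sumr_ge0 => j _; exact: sqr_ge0.
Qed.

Lemma enorm_le_supnorm z Z : has_supnorm z Z -> enorm z <= m.+1%:R * Z.
Proof.
move=> [zZ [i iZ]]; have Z0 : 0 <= Z by rewrite -iZ.
rewrite -[leRHS]ger0_norm ?mulr_ge0// -sqrtr_sqr ler_sqrt ?sqr_ge0//.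
apply: (@le_trans _ _ (m.+1%:R * Z ^+ 2)).
  rewrite mulr_natl -[in leRHS](card_ord m.+1) -sumr_const; apply: ler_sum => j _.
  by rewrite -real_normK ?num_real// lerXn2r// nnegrE.
rewrite exprMn ler_wpM2r ?sqr_ge0// expr2 ler_peMl//.
by rewrite ler1n.
Qed.

End EuclideanNorm.

Section CellHierarchy.
Variables (R : realType) (m : nat) (k : 'I_m.+1) (kap : nat).
Implicit Types p : 'rV[R]_m.+1.

Definition coarsen (x : {ffun 'I_m -> int}) : {ffun 'I_m -> int} :=
  [ffun i => divz (x i) 2].

Lemma coarsen_cell n (pi : param m kap) p : (n < kap)%N ->
  coarsen (cell k n.+1 pi p) = cell k n pi p.
Proof.
move=> nk; apply/ffunP => i; rewrite !ffunE.
rewrite -[(kap - n)%N](@subnSK _ _ nk) expnSr PoszM.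
by rewrite divzMA_ge0.
Qed.

(** A child is determined by its parent and the parities of its [m] indices. *)
Lemma coarsen_children (s : seq {ffun 'I_m -> int}) d :
  uniq s -> (forall x, x \in s -> coarsen x = d) -> (size s <= 2 ^ m)%N.
Proof.
move=> us hs; pose par x : {ffun 'I_m -> bool} := [ffun i => modz ((x : {ffun 'I_m -> int}) i) 2 == 1].
have -> : (2 ^ m = #|{ffun 'I_m -> bool}|)%N by rewrite card_ffun card_bool card_ord.
suff /card_uniqP : uniq (map par s) by rewrite size_map => <-; exact: max_card.
rewrite map_inj_in_uniq// => x y xs ys /ffunP E; apply/ffunP => i.
have e1 : (modz (x i) 2 == 1) = (modz (y i) 2 == 1) by have := E i; rewrite !ffunE.
have e2 : divz (x i) 2 = divz (y i) 2.
  have := congr1 (fun f : {ffun 'I_m -> int} => f i) (etrans (hs _ xs) (esym (hs _ ys))).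
  by rewrite !ffunE.
rewrite (divz_eq (x i) 2) (divz_eq (y i) 2) e2; congr (_ + _); move: e1.
have := modz_ge0 (x i) (d := 2) isT; have := ltz_pmod (x i) (d := 2) isT.
have := modz_ge0 (y i) (d := 2) isT; have := ltz_pmod (y i) (d := 2) isT.
set a := modz (x i) 2; set b := modz (y i) 2.
by case: (a =P 1); case: (b =P 1) => //; lia.
Qed.

End CellHierarchy.

(** * Content of the bad sets *)

Section Neighbours.
Variables (R : realType) (d : nat) (nu : seq ('rV[R]_d * R)) (tau : R) (l : nat).
Hypothesis nu_ge0 : forall a, a \in nu -> 0 <= a.2.
Hypothesis nu_dyad : forall idx,
  \sum_(a <- nu) a.2 * (dyad l a.1 == idx)%:R <= tau ^+ l.

Definition near_at (p q : 'rV[R]_d) := [forall i, `|p 0 i - q 0 i| <= (2 ^+ l)^-1].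

Lemma floor_near (x y : R) : `|x - y| <= 1 ->
  exists e : 'I_3, Num.floor y = Num.floor x + e%:Z - 1.
Proof.
move=> h; have := floor_itv x; have := floor_itv y.
set f := Num.floor x; set g := Num.floor y; rewrite !intrD => /andP[g1 g2] /andP[f1 f2].
move: h; rewrite ler_norml => /andP[h1 h2].
have a1 : g < f + 2 by rewrite -(ltr_int R) intrD; lra.
have a2 : f < g + 2 by rewrite -(ltr_int R) intrD; lra.
exists (inord (absz (g - f + 1))); rewrite inordK; lia.
Qed.

(** The points counted lie in the 3^d dyadic cubes formed by the cube of [p] and its neighbours. *)
Lemma near_mass p : \sum_(b <- nu) b.2 * (near_at p b.1)%:R <= 3 ^+ d * tau ^+ l.
Proof.
pose idx (e : {ffun 'I_d -> 'I_3}) : 'rV[int]_d := \row_i (dyad l p 0 i + (e i)%:Z - 1).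
have t0 : (0 : R) < 2 ^+ l by rewrite exprn_gt0.
apply: (@le_trans _ _ (\sum_(b <- nu) b.2 * \sum_e (dyad l b.1 == idx e)%:R)).
  rewrite big_seq [leRHS]big_seq; apply: ler_sum => b /nu_ge0 b0; rewrite ler_wpM2l//.
  case: (boolP (near_at p b.1)) => [/forallP h|_]; last by apply: sumr_ge0.
  have /choice[e he] : forall i, exists e : 'I_3,
      dyad l b.1 0 i = dyad l p 0 i + e%:Z - 1.
    move=> i; rewrite !mxE; apply: floor_near.
    rewrite -mulrBr normrM (ger0_norm (ltW t0)) mulrC.
    by rewrite -ler_pdivlMr// mul1r.
  rewrite (bigD1 [ffun i => e i])//= (_ : dyad l b.1 == _).
    by rewrite lerDl sumr_ge0.
  by apply/eqP/rowP => i; rewrite [RHS]mxE ffunE he.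
under eq_bigr do rewrite mulr_sumr.
rewrite exchange_big/=.
apply: (@le_trans _ _ (\sum_(e : {ffun 'I_d -> 'I_3}) tau ^+ l)).
  by apply: ler_sum => e _; exact: nu_dyad.
by rewrite sumr_const card_ffun !card_ord -[leLHS]mulr_natl natrX.
Qed.

End Neighbours.

(** * Pairing the martingale differences with a Frostman measure *)

Section GapPairing.
Variables (R : realType) (m : nat) (k : 'I_m.+1).
Notation E := 'rV[R]_m.+1.
Variables (n kap : nat) (rho : seq (E * R)).
Hypothesis rho_ge0 : all (fun a => 0 <= a.2) rho.
Hypothesis n_kap : (n < kap)%N.

Definition gap (pi : param m kap) (x : E) : R :=
  mgap (cell k n.+1 pi) (@coarsen m) (2 ^ m) rho (2 ^+ (n * m)) (cell k n.+1 pi x).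

Definition mean_gap (x : E) : R := \sum_pi pweight R pi * `|gap pi x|.

Lemma mean_gap_pairing (nu : seq (E * R)) (lam : R) : 0 < lam ->
  2 * \sum_(a <- nu) a.2 * mean_gap a.1 <=
    lam * (\sum_(a <- nu) \sum_(b <- nu) a.2 * b.2 * cell_kernel k kap n.+1 a.1 b.1)
  + lam^-1 * (\sum_(a <- rho) \sum_(b <- rho) a.2 * b.2 *
      (cell_kernel k kap n.+1 a.1 b.1 - cell_kernel k kap n a.1 b.1)).
Proof.
move=> lam0; set al : R := 2 ^+ (n * m).
have alE : (2 ^ m)%N%:R * al = 2 ^+ (n.+1 * m) by rewrite natrX /al mulSn exprD.
have K0 : 0 < (2 : R) ^+ (n.+1 * m) by rewrite exprn_gt0.
(* This choice supplies the normalisation 2^((n+1)m) that turns common cells of [nu] into the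
   kernel, and cancels the same factor in front of the energy of [rho]. *)
pose th := lam * 2 ^+ (n.+1 * m).
have th0 : 0 < th by rewrite mulr_gt0.
have thV : th^-1 * 2 ^+ (n.+1 * m) = lam^-1.
  by rewrite /th invfM -mulrA mulVf ?mulr1 ?gt_eqF.
have step (pi : param m kap) := mgap_pairing (cell k n.+1 pi) (@coarsen_children m) nu
  rho_ge0 (exprn_ge0 (n * m) (ler0n R 2)) th0.
have pw0 (pi : param m kap) : 0 <= pweight R pi := pweight_ge0 _ _.
apply: (@le_trans _ _ (\sum_pi pweight R pi *
   (2 * \sum_(a <- nu) a.2 * `|gap pi a.1|))).
  rewrite le_eqVlt; apply/orP; left; apply/eqP.
  rewrite /mean_gap; under eq_bigr do rewrite mulr_sumr.
  rewrite exchange_big mulr_sumr; apply: eq_bigr => pi _.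
  by rewrite mulrCA; congr (2 * _); rewrite mulr_sumr; apply: eq_bigr => a _; rewrite mulrCA.
apply: (le_trans (ler_sum _ (fun pi _ => ler_wpM2l (pw0 pi) (step pi)))).
rewrite le_eqVlt; apply/orP; left; apply/eqP.
under eq_bigr do rewrite mulrDr; rewrite big_split/=; congr (_ + _).
  rewrite mulr_sumr.
  under eq_bigr => pi _ do rewrite mulrA mulr_sumr.
  rewrite exchange_big/=; apply: eq_bigr => a _.
  under eq_bigr => pi _ do rewrite mulr_sumr.
  rewrite exchange_big/= mulr_sumr; apply: eq_bigr => b _.
  rewrite -cell_kernelE// !mulr_sumr; apply: eq_bigr => pi _.
  by rewrite /th; ring.
rewrite alE.
under eq_bigr => pi _ do rewrite [th^-1 * _]mulrA thV mulrCA mulr_sumr.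
rewrite -mulr_sumr; congr (_ * _).
rewrite exchange_big/=; apply: eq_bigr => a _.
under eq_bigr => pi _ do rewrite mulr_sumr.
rewrite exchange_big/=; apply: eq_bigr => b _.
rewrite -!cell_kernelE//; last exact: ltnW.
rewrite -sumrB mulr_sumr; apply: eq_bigr => pi _.
by rewrite !coarsen_cell//; ring.
Qed.

End GapPairing.

Section GapEnergy.
Variables (R : realType) (m : nat) (k : 'I_m.+1) (s : R).
Notation E := 'rV[R]_m.+1.
Hypothesis hs : m%:R < s <= m%:R + 1.

Definition energy_bounded kap (Y : set E) (I : R) (rho : seq (E * R)) :=
  forall kappa : E -> E -> R, (forall p q, 0 <= kappa p q) ->
    (forall p p' q q', same_icoord k kap p p' -> same_icoord k kap q q' ->
       kappa p q = kappa p' q') ->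
    (forall p q, Y p -> Y q -> p <> q -> kappa p q <= enorm (p - q) `^ (- s)) ->
    \sum_(a <- rho) \sum_(b <- rho) a.2 * b.2 * kappa a.1 b.1 <= I.

Lemma enorm_powR_ge (z : E) Z : has_supnorm z Z -> 0 < Z ->
  Z `^ (- s) <= m.+1%:R `^ s * enorm z `^ (- s).
Proof.
move=> zZ Z0; have s0 : 0 <= s by case/andP: hs => /ltW + _; apply: le_trans.
have e0 : 0 < enorm z.
  by case: (zZ) => _ [i iZ]; apply: lt_le_trans (coord_le_enorm z i); rewrite iZ.
have h := enorm_le_supnorm zZ.
rewrite !powRN -[m.+1%:R `^ s]invrK -invfM lef_pV2 ?posrE ?mulr_gt0 ?invr_gt0 ?powR_gt0//.
rewrite mulrC ler_pdivrMr ?powR_gt0// -powRM//; last exact: ltW.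
by apply: ge0_ler_powR; rewrite ?nnegrE ?mulr_ge0 ?(ltW Z0) ?(ltW e0)// mulrC.
Qed.

Lemma gap_energy_le : exists2 C : R, 0 < C &
  forall kap n l (idx : 'rV[int]_m.+1) I (rho : seq (E * R)), all (fun a => 0 <= a.2) rho ->
  energy_bounded kap [set p | dyad l p = idx] I rho ->
  64 * 8 ^+ n.+1 <= (2 ^ kap)%N%:R :> R ->
  \sum_(a <- rho) \sum_(b <- rho) a.2 * b.2 *
     (cell_kernel k kap n.+1 a.1 b.1 - cell_kernel k kap n a.1 b.1)
  <= C * I * (2^-1 `^ (s - m%:R)) ^+ n.
Proof.
have [C1 C10 hC1] := cell_kernel_diff_le k hs.
set b := 2^-1 `^ _; have b0 : 0 < b by rewrite powR_gt0.
pose C := C1 * m.+1%:R `^ s.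
have C0 : 0 < C by rewrite mulr_gt0 ?powR_gt0.
exists C => // kap n l idx I rho rho0 rhoI hM.
pose gapk (p q : E) : R := cell_kernel k kap n.+1 p q - cell_kernel k kap n p q.
have Cb0 : 0 < C * b ^+ n by rewrite mulr_gt0 ?exprn_gt0.
(* The difference of kernels may be negative, while the energy dominates nonnegative kernels only:
   its positive part is used, scaled to lie below the Riesz kernel off the diagonal. *)
pose kappa (p q : E) : R := Num.max 0 (gapk p q) / (C * b ^+ n).
have kappa0 p q : 0 <= kappa p q by rewrite divr_ge0 ?le_max ?lexx// ltW.
have kappaI p p' q q' : same_icoord k kap p p' -> same_icoord k kap q q' ->
    kappa p q = kappa p' q'.
  by move=> hp hq; rewrite /kappa /gapk !(same_icoord_kernel _ hp hq).
have kappaE p q : dyad l p = idx -> dyad l q = idx -> p <> q ->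
    kappa p q <= enorm (p - q) `^ (- s).
  move=> pY qY pq; have [Z hZ] := supnorm_exists (p - q).
  have Z0 : 0 < Z by apply: (supnorm_gt0 hZ) => /eqP; rewrite subr_eq0 => /eqP.
  have Z1 : Z <= 1.
    case: (hZ) => _ [i <-]; rewrite !mxE.
    apply: (le_trans (dyad_dist i (etrans pY (esym qY)))).
    by rewrite invf_le1 ?exprn_gt0// exprn_ege1// ler1n.
  have h : gapk p q <= C * b ^+ n * enorm (p - q) `^ (- s).
    have Z01 : 0 < Z <= 1 by rewrite Z0.
    apply: (le_trans (hC1 _ _ _ _ _ hM hZ Z01)).
    have -> : (2 ^+ n)^-1 `^ (s - m%:R) = b ^+ n.
      have h2 : (2 ^+ n)^-1 = 2^-1 `^ n%:R :> R by rewrite -exprVn powR_mulrn ?invr_ge0.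
      have hb : b ^+ n = b `^ n%:R by rewrite powR_mulrn// ltW.
      by rewrite h2 hb /b -!powRrM mulrC.
    rewrite /C -!mulrA ler_pM2l// mulrCA ler_pM2l ?exprn_gt0//.
    exact: enorm_powR_ge.
  rewrite /kappa ler_pdivrMr// mulrC ge_max h andbT.
  by rewrite mulr_ge0 ?powR_ge0// ltW.
have hI := rhoI kappa kappa0 kappaI kappaE.
apply: (@le_trans _ _ (C * b ^+ n *
   (\sum_(a <- rho) \sum_(b <- rho) a.2 * b.2 * kappa a.1 b.1))); last first.
  by rewrite [C * I * _]mulrAC ler_pM2l.
rewrite mulr_sumr big_seq [leRHS]big_seq; apply: ler_sum => a /(allP rho0) a0.
rewrite mulr_sumr big_seq [leRHS]big_seq; apply: ler_sum => a' /(allP rho0) a'0.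
rewrite mulrCA ler_wpM2l ?mulr_ge0// /kappa mulrC divfK ?gt_eqF//.
by rewrite le_max lexx orbT.
Qed.

End GapEnergy.

Section ScaleSum.
Variables (R : realType) (m : nat) (k : 'I_m.+1).
Notation E := 'rV[R]_m.+1.
Variable tau : R.
Hypothesis tau0 : 0 < tau.
Hypothesis tau_big : 1 < 2 ^+ m * tau.

Lemma sum_geo_le (x : R) (n : nat) : 1 < x ->
  \sum_(0 <= l < n.+1) x ^+ l <= x / (x - 1) * x ^+ n.
Proof.
move=> x1; elim: n => [|n IH].
  rewrite big_nat1 expr0 mulr1 ler_pdivlMr ?subr_gt0//; lra.
rewrite big_nat_recr//=; apply: (le_trans (lerD IH (lexx _))).
have x10 : x - 1 != 0 by rewrite gt_eqF// subr_gt0.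
rewrite le_eqVlt; apply/orP; left; apply/eqP; rewrite exprS.
by field.
Qed.

(** Around each atom the others are sorted by the scale [l] of their distance: kernel at most
    2^(lm), mass at most [tau]^l, up to constants. The geometric sum over [l] is dominated by its
    last term because [1 < 2 ^+ m * tau]. *)
Lemma frostman_kernel_le : exists2 C : R, 0 < C &
  forall kap n l0 (idx : 'rV[int]_m.+1) (nu : seq (E * R)), (l0 <= n)%N ->
  64 * 8 ^+ n.+1 <= (2 ^ kap)%N%:R :> R ->
  (forall a, a \in nu -> dyad l0 a.1 = idx /\ 0 <= a.2) ->
  (forall l idx', (l0 <= l <= n)%N ->
     \sum_(a <- nu) a.2 * (dyad l a.1 == idx')%:R <= tau ^+ l) ->
  \sum_(a <- nu) \sum_(b <- nu) a.2 * b.2 * cell_kernel k kap n.+1 a.1 b.1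
  <= C * (2 ^+ m * tau) ^+ n * \sum_(a <- nu) a.2.
Proof.
set x := 2 ^+ m * tau; have x_gt1 : 1 < x := tau_big.
have [A A0 kerA] : exists2 A : R, 0 < A & forall kap n l p q Z,
    64 * 8 ^+ n.+1 <= (2 ^ kap)%N%:R :> R -> (l <= n)%N ->
    l = n \/ [/\ has_supnorm (p - q) Z, Z <= 1 & (2 ^+ l.+1)^-1 < Z] ->
    cell_kernel k kap n.+1 p q <= A * 2 ^+ (l * m).
  exists (256 ^+ m); first by rewrite exprn_gt0 ?ltr0n.
  by move=> *; apply: cell_kernel_scale_le; eassumption.
have [B B0 nearB] : exists2 B : R, 0 < B & forall (nu : seq (E * R)) l,
    (forall a, a \in nu -> 0 <= a.2) ->
    (forall idx, \sum_(a <- nu) a.2 * (dyad l a.1 == idx)%:R <= tau ^+ l) ->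
    forall p, \sum_(b <- nu) b.2 * (near_at l p b.1)%:R <= B * tau ^+ l.
  exists (3 ^+ m.+1) => [|nu l h1 h2 p]; first by rewrite exprn_gt0 ?ltr0n.
  exact: (near_mass h1 h2 p).
have x0 : 0 < x by exact: lt_trans x_gt1.
have x1 : 0 < x - 1 by rewrite subr_gt0.
pose C : R := A * B * (x / (x - 1)).
have AB0 := mulr_gt0 A0 B0.
have C0 : 0 < C := mulr_gt0 AB0 (divr_gt0 x0 x1).
exists C => // kap n l0 idx nu l0n hM nuP nuF.
rewrite mulr_sumr big_seq [leRHS]big_seq; apply: ler_sum => a anu.
have [aX a0] := nuP _ anu.
under eq_bigr do rewrite -mulrA; rewrite -mulr_sumr mulrC ler_wpM2r//.
apply: (@le_trans _ _ (\sum_(b <- nu) \sum_(l0 <= l < n.+1)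
    A * 2 ^+ (l * m) * (b.2 * (near_at l a.1 b.1)%:R))).
  rewrite big_seq [leRHS]big_seq; apply: ler_sum => b bnu.
  have [bX b0] := nuP _ bnu.
  have [Z hZ] := supnorm_exists (a.1 - b.1).
  have nearE l : near_at l a.1 b.1 = (Z <= (2 ^+ l)^-1).
    case: hZ => h [i iZ]; apply/forallP/idP => [/(_ i)|H j].
      by have := iZ; rewrite !mxE => ->.
    by apply: le_trans H; have := h j; rewrite !mxE.
  have n0 : near_at l0 a.1 b.1.
    by apply/forallP => i; apply: dyad_dist; rewrite aX.
  have Z1 : Z <= 1.
    move: n0; rewrite nearE => /le_trans; apply.
    by rewrite invf_le1 ?exprn_gt0// exprn_ege1// ler1n.
  have exl : exists l, (l0 <= l <= n)%N && near_at l a.1 b.1.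
    by exists l0; rewrite leqnn l0n n0.
  have ubl l : (l0 <= l <= n)%N && near_at l a.1 b.1 -> (l <= n)%N by case/andP => /andP[].
  (* The finest scale at which the two atoms are neighbours; maximality bounds their distance from
     below unless [l = n]. *)
  case: (ex_maxnP exl ubl) => l /andP[/andP[l1 l2] nl] lmax.
  have ker : cell_kernel k kap n.+1 a.1 b.1 <= A * 2 ^+ (l * m).
    apply: (kerA kap n l a.1 b.1 Z hM l2).
    have [|ln] := eqVneq l n; first by left.
    right; split=> //; rewrite ltNge -nearE; apply/negP => nS.
    have h : (l0 <= l.+1 <= n)%N by rewrite (leqW l1) ltn_neqAle ln l2.
    by have := lmax l.+1; rewrite h nS ltnn => /(_ isT).
  rewrite (bigD1_seq l)/= ?iota_uniq//; last by rewrite mem_index_iota l1 ltnS.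
  rewrite nl mulr1 mulrC -[leLHS]addr0 lerD//; first by rewrite ler_wpM2r.
  by apply: sumr_ge0 => l' _; rewrite !mulr_ge0 ?exprn_ge0 ?(ltW A0).
rewrite exchange_big/= big_nat.
apply: (@le_trans _ _ (\sum_(l0 <= l < n.+1) A * B * x ^+ l)).
  rewrite [leRHS]big_nat; apply: ler_sum => l /andP[l1 l2].
  rewrite -mulr_sumr.
  have nb : \sum_(b <- nu) b.2 * (near_at l a.1 b.1)%:R <= B * tau ^+ l.
    by apply: nearB => [b /nuP[]//|idx']; apply: nuF; rewrite l1 -ltnS.
  have p0 : 0 <= A * 2 ^+ (l * m) by rewrite mulr_ge0 ?exprn_ge0 ?(ltW A0).
  apply: (le_trans (ler_wpM2l p0 nb)).
  rewrite /x exprMn -exprM [(m * l)%N]mulnC le_eqVlt; apply/orP; left; apply/eqP; ring.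
apply: (@le_trans _ _ (\sum_(0 <= l < n.+1) A * B * x ^+ l)).
  rewrite (@big_cat_nat _ _ _ l0 0 n.+1)//=; last exact: leq_trans l0n _.
  rewrite lerDr; apply: sumr_ge0 => l _.
  by rewrite mulr_ge0 ?exprn_ge0 ?(ltW x0) ?(ltW AB0).
rewrite -mulr_sumr /C -(mulrA _ (x / (x - 1))) ler_pM2l//.
exact: sum_geo_le.
Qed.

End ScaleSum.

Section BadSets.
Variables (R : realType) (m : nat) (k : 'I_m.+1) (s tau q I : R).
Notation E := 'rV[R]_m.+1.
Variables (U : set_system nat) (l0 : nat) (idX idY : 'rV[int]_m.+1) (rho : nat -> seq (E * R)).
Hypothesis UU : UltraFilter U.
Hypothesis Utail : forall N, U [set kap | (N <= kap)%N].
Hypothesis hs : m%:R < s <= m%:R + 1.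
Hypothesis tau0 : 0 < tau.
Hypothesis tau_big : 1 < 2 ^+ m * tau.
Hypothesis q0 : 0 < q.
Hypothesis I0 : 0 < I.
Hypothesis rho_ge0 : forall kap, all (fun a => 0 <= a.2) (rho kap).
Hypothesis rho_energy : forall kap,
  energy_bounded k s kap [set p | dyad l0 p = idY] I (rho kap).

(* A single lattice [kap] must serve for finitely many points and finitely many
   scales at once: an ultrafilter makes both badness and goodness stable under
   finite intersections. *)
Definition bad n : set E := [set x | dyad l0 x = idX /\
  U [set kap | q ^+ n < mean_gap k n kap (rho kap) x]].

Lemma good_eventually n x : dyad l0 x = idX -> ~ bad n x ->
  U [set kap | mean_gap k n kap (rho kap) x <= q ^+ n].
Proof.
move=> xX nb; have [nU|] := @in_ultra_setVsetC _ U [set kap | q ^+ n < mean_gap k n kap (rho kap) x] UU.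
  by case: nb.
by apply: filterS => kap /= /negP; rewrite -leNgt.
Qed.

Lemma ultra_all (A : eqType) (l : seq A) (P : A -> set nat) :
  (forall a, a \in l -> U (P a)) -> U [set kap | forall a, a \in l -> P a kap].
Proof.
elim: l => [_|a l IH h]; first by apply: filterS filterT => kap _ a.
apply: filterS (filterI (h a (mem_head _ _)) (IH (fun b bl => h b (@mem_behead _ (a :: l) b bl)))).
by move=> kap [Pa Pl] b; rewrite inE => /predU1P[->//|/Pl].
Qed.

Lemma lattice_fine n : U [set kap | (n < kap)%N /\ 64 * 8 ^+ n.+1 <= (2 ^ kap)%N%:R :> R].
Proof.
apply: filterS (Utail (3 * n + 9)) => kap /= h; split; first by lia.
have -> : (64 : R) * 8 ^+ n.+1 = (2 ^ (3 * n + 9))%N%:R.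
  rewrite natrX (_ : (3 * n + 9 = 6 + 3 * n.+1)%N); last by lia.
  by rewrite exprD exprM; congr (_ * _ ^+ _); ring.
by rewrite ler_nat leq_pexp2l.
Qed.

Lemma bad_content : exists2 C : R, 0 < C & forall n, (l0 <= n)%N ->
  exists F : seq (nat * 'rV[int]_m.+1),
  (forall x, bad n x -> exists2 c, c \in F & dyad c.1 x = c.2) /\
  \sum_(c <- F) tau ^+ c.1 <= C * (2 ^+ m * tau * (2^-1 `^ (s - m%:R)) / q ^+ 2) ^+ n.
Proof.
have [C1 C10 gapE] := gap_energy_le k hs.
have [C2 C20 frosE] := frostman_kernel_le k tau_big.
set x := 2 ^+ m * tau; set b := _ `^ _.
have x0 : 0 < x by exact: lt_trans tau_big.
have b0 : 0 < b by rewrite powR_gt0.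
exists (C2 * (C1 * I)); first by rewrite !mulr_gt0.
move=> n l0n.
have [nu [F [nu1 nu2 nu3 nu4]]] := dyadic_frostman (bad n) (n - l0) l0 idX (ltW tau0).
exists F; split; first by move=> y yb; apply: nu2 => //; case: yb.
have nu4' l idx' : (l0 <= l <= n)%N ->
    \sum_(a <- nu) a.2 * (dyad l a.1 == idx')%:R <= tau ^+ l.
  by move=> h; apply: nu4; rewrite subnKC.
have nuX a : a \in nu -> dyad l0 a.1 = idX /\ 0 <= a.2 by move=> /nu1[].
have Unu : U [set kap | forall a, a \in nu -> q ^+ n < mean_gap k n kap (rho kap) a.1].
  by apply: ultra_all => a /nu1[[]].
have [kap [hnu [nkap hM]]] := filter_ex (filterI Unu (lattice_fine n)).
set S := \sum_(c <- F) _; have SE : S = \sum_(a <- nu) a.2 by [].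
have qn0 : 0 < q ^+ n by rewrite exprn_gt0.
have bn0 : 0 < b ^+ n by rewrite exprn_gt0.
have xn0 : 0 < x ^+ n by rewrite exprn_gt0.
(* Chosen so that the energy of [nu] contributes exactly [q ^+ n * S], half of the lower bound,
   which absorbs it. *)
pose lam := q ^+ n / (C2 * x ^+ n).
have lam0 : 0 < lam by rewrite divr_gt0 ?mulr_gt0.
have lower : 2 * (q ^+ n * S) <= 2 * \sum_(a <- nu) a.2 * mean_gap k n kap (rho kap) a.1.
  rewrite ler_pM2l// SE mulr_sumr big_seq [leRHS]big_seq; apply: ler_sum => a anu.
  by rewrite mulrC ler_wpM2l ?(ltW (hnu _ anu))//; have [] := nuX _ anu.
have upper := mean_gap_pairing k (rho_ge0 kap) nkap nu lam0.
have e1 := frosE kap n l0 idX nu l0n hM nuX nu4'.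
have e2 := gapE kap n l0 idY I (rho kap) (rho_ge0 kap) (rho_energy (kap := kap)) hM.
have {upper} := le_trans (le_trans lower upper)
  (lerD (ler_wpM2l (ltW lam0) e1) (ler_wpM2l (ltW (etrans (invr_gt0 lam) lam0)) e2)).
rewrite -SE -/x -/b.
have -> : lam * (C2 * x ^+ n * S) = q ^+ n * S.
  by rewrite /lam; field; rewrite !gt_eqF.
have -> : lam^-1 * (C1 * I * b ^+ n) = q ^+ n * (C2 * (C1 * I) * (x * b / q ^+ 2) ^+ n).
  have qE : (q ^+ 2) ^+ n = (q ^+ n) ^+ 2 by rewrite -!exprM mulnC.
  rewrite /lam [(_ / _) ^+ n]exprMn exprVn qE [(x * b) ^+ n]exprMn.
  move: (q ^+ n) (x ^+ n) (b ^+ n) qn0 xn0 => Q X B Q0 X0.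
  by field; rewrite !gt_eqF.
move=> h; rewrite -(ler_pM2l qn0); lra.
Qed.

End BadSets.

(** * Absolute continuity at good points *)

Lemma exists_pow2_ge (R : realType) (K : R) n0 :
  exists2 n, (n0 <= n)%N & forall n', (n <= n')%N -> K <= 2 ^+ n'.
Proof.
exists (n0 + (Num.truncn `|K|).+1)%N; first by rewrite leq_addr.
move=> n' hn; apply: (le_trans (ler_norm K)).
have /andP[_ h] := truncn_itv (normr_ge0 K).
apply: (le_trans (ltW h)); rewrite -natrX ler_nat.
apply: (leq_trans _ (ltnW (ltn_expl n' (ltnSn 1)))).
by apply: leq_trans hn; rewrite leq_addl.
Qed.

Lemma sum_geo_tail (R : realType) (q : R) n0 n1 : 0 < q < 1 ->
  \sum_(n0 <= l < n1) q ^+ l <= q ^+ n0 / (1 - q).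
Proof.
move=> /andP[q0 q1]; have h : 0 < 1 - q by rewrite subr_gt0.
suff: \sum_(n0 <= l < n1) q ^+ l <= (q ^+ n0 - q ^+ (maxn n0 n1)) / (1 - q).
  move=> /le_trans; apply; rewrite ler_pM2r ?invr_gt0// gerBl.
  by rewrite exprn_ge0// ltW.
elim: n1 => [|n1 IH].
  by rewrite big_geq// maxn0 subrr mul0r.
case: (leqP n0 n1) => hn; last first.
  by rewrite big_geq// (maxn_idPl hn) subrr mul0r.
rewrite big_nat_recr//= (maxn_idPr (leqW hn)); rewrite (maxn_idPr hn) in IH.
apply: (le_trans (lerD IH (lexx _))); rewrite le_eqVlt; apply/orP; left; apply/eqP.
by rewrite exprS; field; rewrite gt_eqF.
Qed.

Section CellDensity.
Variables (R : realType) (m : nat) (k : 'I_m.+1) (kap : nat).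
Notation E := 'rV[R]_m.+1.
Variables (rho : seq (E * R)) (x : E).
Hypothesis rho_ge0 : all (fun a => 0 <= a.2) rho.

(** The value at [x] of the density g_n for the slopes and shifts [pi], with [rho] in place of
    [mu]. *)
Definition cell_density n (pi : param m kap) : R :=
  \sum_(a <- rho) a.2 * (2 ^+ (n * m) * (cell k n pi a.1 == cell k n pi x)%:R).

Lemma cell_densityS n pi : (n < kap)%N ->
  gap k n rho pi x = cell_density n.+1 pi - cell_density n pi.
Proof.
move=> nk; rewrite /gap /mgap /cell_density; congr (_ - _).
  rewrite /mass mulr_sumr; apply: eq_bigr => a _.
  by rewrite natrX mulSn exprD; ring.
by rewrite /pmass mulr_sumr; apply: eq_bigr => a _; rewrite !coarsen_cell//; ring.
Qed.

Lemma cell_density_le n0 n1 pi : (n0 <= n1)%N -> (n1 <= kap)%N ->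
  cell_density n1 pi <= cell_density n0 pi + \sum_(n0 <= l < n1) `|gap k l rho pi x|.
Proof.
move=> /subnK <-; elim: (n1 - n0)%N => [|n IH] hk; first by rewrite big_geq// addr0.
rewrite addSn big_nat_recr ?leq_addl//= addrA.
apply: le_trans (lerD (IH (ltnW hk)) (lexx _)).
by rewrite -lerBlDl -cell_densityS// ler_norm.
Qed.

Lemma cell_density_le_total n pi : cell_density n pi <= 2 ^+ (n * m) * \sum_(a <- rho) a.2.
Proof.
rewrite mulr_sumr /cell_density big_seq [leRHS]big_seq; apply: ler_sum => a /(allP rho_ge0) a0.
by rewrite mulrC ler_wpM2r// ler_piMr ?exprn_ge0// lern1 leq_b1.
Qed.

End CellDensity.

Section GoodPoint.
Variables (R : realType) (m : nat) (k : 'I_m.+1).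
Notation E := 'rV[R]_m.+1.
Notation T := (Borel R m.+1).
Variables (mu : {measure set T -> \bar R}) (Y : set E).
Variables (q b0 : R) (rho : nat -> seq (E * R)) (U : set_system nat) (x : E) (n0 : nat).
Hypothesis UU : UltraFilter U.
Hypothesis Utail : forall N, U [set kap | (N <= kap)%N].
Hypothesis q01 : 0 < q < 1.
Hypothesis b00 : 0 < b0.
Hypothesis rho_ge0 : forall kap, all (fun a => 0 <= a.2) (rho kap).
Hypothesis rho_total : forall kap, \sum_(a <- rho kap) a.2 = fine (mu Y).
Hypothesis rho_mass : forall kap (D : set E) (H : E -> R) c,
  measurable (D : set T) -> D `<=` Y ->
  (forall p p', same_icoord k kap p p' -> H p = H p') -> (forall p, 0 <= H p) -> 0 <= c ->
  (forall p, D p -> c <= H p) ->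
  c * fine (mu D) <= \sum_(a <- rho kap) a.2 * H a.1.
Hypothesis x_good : forall n, (n0 <= n)%N ->
  U [set kap | mean_gap k n kap (rho kap) x <= q ^+ n].
Hypothesis Y_sep : forall y, Y y -> [/\ (y - x) 0 k != 0, `|(y - x) 0 k| <= b0 &
  forall i, `|(y - x) 0 i| <= 2 * `|(y - x) 0 k|].

(** A quantitative form of absolute continuity. The density at scale [n1] is at most the density at
    scale [n0], which is bounded by 2^(n0 m) times the mass of [Y], plus the gaps between. Over the
    parameters in the windows, of total weight at most the sum of [(5 * r i) ^+ m], this yields the
    first term; the gaps over all parameters yield the geometric tail. *)
Lemma good_point_mass_le (N : nat) (u : 'I_N -> 'I_m -> R) (r : 'I_N -> R) (D : set E) :
  (forall i, 0 < r i) -> measurable (D : set T) -> D `<=` Y ->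
  (forall y, D y -> exists i, forall j,
     `|(y - x) 0 (lift k j) / (y - x) 0 k - u i j| <= r i) ->
  (16 * b0)^-1 ^+ m * fine (mu D) <=
    2 ^+ (n0 * m) * fine (mu Y) * (\sum_i (5 * r i) ^+ m) + q ^+ n0 / (1 - q).
Proof.
move=> r0 mD DY Du; have /andP[q0 q1] := q01.
(* [S] dominates every inverse radius, so a single [n1] makes [h] at most each [r i] and at most
   1/2, and a single [kap] makes the mesh finer than every [r i], than [h] and than a quarter of
   2^(-n1). *)
pose S : R := \sum_i (r i)^-1.
have rS i : (r i)^-1 <= S.
  by rewrite /S (bigD1 i)//= lerDl; apply: sumr_ge0 => j _; rewrite invr_ge0 ltW.
have S0 : 0 <= S by apply: sumr_ge0 => j _; rewrite invr_ge0 ltW.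
have [n1 n01 /(_ _ (leqnn _)) hn1] := exists_pow2_ge ((S + 2) / (4 * b0)) n0.
set t : R := 2 ^+ n1 in hn1.
have t0 : 0 < t by rewrite exprn_gt0.
pose h := t^-1 / (4 * b0).
have h0 : 0 < h by rewrite divr_gt0 ?invr_gt0 ?mulr_gt0.
have hV : S + 2 <= h^-1.
  by rewrite /h invfM !invrK -ler_pdivrMr// mulr_gt0.
have hr i : h <= r i.
  rewrite -[r i]invrK -[h]invrK lef_pV2 ?posrE ?invr_gt0//.
  by apply: le_trans hV; have := rS i; lra.
have h12 : h <= 1 / 2.
  rewrite div1r -[h]invrK lef_pV2 ?posrE ?invr_gt0//; lra.
have [n2 n12 hn2] := exists_pow2_ge (S + h^-1 + 4 * t) n1.
have good : U [set kap | forall n, n \in iota n0 (n1 - n0) ->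
    mean_gap k n kap (rho kap) x <= q ^+ n].
  by apply: ultra_all => n; rewrite mem_iota => /andP[? _]; exact: x_good.
have [kap [hgood hkap]] := filter_ex (filterI good (Utail n2)).
have M0 : (0 : R) < (2 ^ kap)%N%:R by rewrite ltr0n expn_gt0.
have {hn2} : S + h^-1 + 4 * t <= (2 ^ kap)%N%:R by rewrite natrX hn2.
set M := (2 ^ kap)%N%:R in M0 * => hM.
have hV0 : 0 < h^-1 by rewrite invr_gt0.
have n1k : (n1 <= kap)%N by exact: leq_trans hkap.
have Mr i : M^-1 <= r i.
  by rewrite -[r i]invrK lef_pV2 ?posrE ?invr_gt0//; have := rS i; lra.
have hM1 : 1 <= h * M by rewrite -ler_pdivrMl// mulr1; lra.
have Mt : M^-1 <= t^-1 / 4.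
  rewrite -invfM lef_pV2 ?posrE ?mulr_gt0//; lra.
(* Windows are doubled: a slope within [h <= r i] of the slope of [y] is within [2 * r i] of the
   centre. The lattice adds at most one more [r i], whence the 5. *)
pose W i (pi : param m kap) : bool := [forall j, `|slope R (2 ^ kap) (pi j).1 - u i j| <= 2 * r i].
pose G (pi : param m kap) : bool := [exists i, W i pi].
pose H (y : E) : R := \sum_(pi : param m kap) pweight R pi * (G pi)%:R *
  (2 ^+ (n1 * m) * (cell k n1 pi y == cell k n1 pi x)%:R).
have pw0 (pi : param m kap) : 0 <= pweight R pi := pweight_ge0 _ _.
have H0 y : 0 <= H y.
  by apply: sumr_ge0 => pi _; rewrite !mulr_ge0 ?exprn_ge0.
have Hinv y y' : same_icoord k kap y y' -> H y = H y'.
  by move=> hy; apply: eq_bigr => pi _; rewrite (same_icoord_cell _ _ hy).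
have c0 : 0 <= (16 * b0)^-1 ^+ m by rewrite exprn_ge0// invr_ge0 mulr_ge0// ltW.
have HD y : D y -> (16 * b0)^-1 ^+ m <= H y.
  move=> Dy; have [zk0 zkb zi] := Y_sep (DY _ Dy); have [i hi] := Du _ Dy.
  pose v j := (y - x) 0 (lift k j) / (y - x) 0 k.
  pose phi j j' : R := chi (slope R (2 ^ kap) j') / M *
    (`|slope R (2 ^ kap) j' - v j| <= h)%R%:R.
  apply: (@le_trans _ _ (\sum_(pi : param m kap) (\prod_j (phi j (pi j).1 / M)) *
     (2 ^+ (n1 * m) * (cell k n1 pi y == cell k n1 pi x)%:R))).
    rewrite weighted_cell_kernelE// -[m in X in X <= _]card_ord -prodr_const.
    apply: ler_prod => j _; rewrite invr_ge0 mulr_ge0 ?(ltW b00)//=.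
    apply: (slope_window_ge _ b00 (erefl h)) => //.
    - by rewrite expn_gt0.
    - by rewrite normrM normfV ler_pdivrMr ?normr_gt0.
    - exact: iline_near.
  apply: ler_sum => pi _; rewrite ler_wpM2r ?mulr_ge0 ?exprn_ge0//.
  have -> : \prod_j (phi j (pi j).1 / M) = pweight R pi *
      \prod_j (`|slope R (2 ^ kap) (pi j).1 - v j| <= h)%R%:R.
    by rewrite -big_split/=; apply: eq_bigr => j _; rewrite /phi mulrAC.
  rewrite ler_wpM2l//; case: (boolP (G pi)) => [_|/existsPn/(_ i)/forallPn[j hj]].
    apply: (@le_trans _ _ (\prod_(j < m) 1)); last by rewrite big1.
    by apply: ler_prod => j _; rewrite ler0n lern1 leq_b1.
  rewrite (bigD1 j)//= (_ : (_ <= h) = false) ?mul0r//.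
  apply/negbTE; apply: contra hj => hj.
  have -> : slope R (2 ^ kap) (pi j).1 - u i j =
     (slope R (2 ^ kap) (pi j).1 - v j) + (v j - u i j) by ring.
  apply: (le_trans (ler_normD _ _)); have := hi j; have := hr i; rewrite -/(v j); lra.
apply: (le_trans (rho_mass mD DY Hinv H0 c0 HD)).
have -> : \sum_(a <- rho kap) a.2 * H a.1 =
    \sum_(pi : param m kap) pweight R pi * (G pi)%:R * cell_density k (rho kap) x n1 pi.
  under eq_bigr do rewrite mulr_sumr; rewrite exchange_big/=; apply: eq_bigr => pi _.
  by rewrite mulr_sumr; apply: eq_bigr => a _; rewrite mulrCA.
have GW : \sum_(pi : param m kap) pweight R pi * (G pi)%:R <= \sum_i (5 * r i) ^+ m.
  apply: (@le_trans _ _ (\sum_(pi : param m kap) \sum_i pweight R pi * (W i pi)%:R)).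
    apply: ler_sum => pi _; case: (boolP (G pi)) => [/existsP[i Wi]|_].
      rewrite (bigD1 i)//= Wi lerDl; apply: sumr_ge0 => j _; by rewrite mulr_ge0.
    by rewrite mulr0; apply: sumr_ge0 => j _; rewrite mulr_ge0.
  rewrite exchange_big/=; apply: ler_sum => i _.
  have ri2 : 0 <= 2 * r i by rewrite mulr_ge0// ltW.
  apply: (le_trans (sum_pweight_window_le kap (u i) ri2)).
  rewrite lerXn2r ?nnegrE//.
  - by rewrite addr_ge0 ?mulr_ge0 ?invr_ge0 ?(ltW M0) ?(ltW (r0 i)).
  - by rewrite mulr_ge0// ltW.
  - by have := Mr i; have := r0 i; rewrite -/M; lra.
set A := 2 ^+ (n0 * m) * fine (mu Y).
have A0 : 0 <= A by rewrite mulr_ge0 ?exprn_ge0 ?fine_ge0.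
apply: (@le_trans _ _ (A * (\sum_(pi : param m kap) pweight R pi * (G pi)%:R)
   + \sum_(n0 <= l < n1) mean_gap k l kap (rho kap) x)); last first.
  apply: lerD; first by rewrite ler_wpM2l.
  apply: le_trans (sum_geo_tail n0 n1 q01).
  rewrite big_nat [leRHS]big_nat; apply: ler_sum => l hl; apply: hgood.
  by rewrite mem_iota subnKC.
rewrite /mean_gap exchange_big/= mulr_sumr -big_split/=; apply: ler_sum => pi _.
rewrite -mulr_sumr; set g := \sum_(_ <= _ < _) _.
have g0 : 0 <= g by apply: sumr_ge0.
have dA : cell_density k (rho kap) x n1 pi <= A + g.
  apply: (le_trans (cell_density_le k (rho kap) x pi n01 n1k)); rewrite lerD2r.
  by rewrite /A -(rho_total kap); exact: cell_density_le_total.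
case: (G pi); rewrite ?mulr1 ?mulr0 ?mul0r ?add0r; last by rewrite mulr_ge0.
by rewrite mulrC [A * _]mulrC -mulrDr [leLHS]mulrC ler_wpM2l.
Qed.

End GoodPoint.

(** * Null sets of the sphere in slope coordinates *)

Section HausdorffNull.
Variables (R : realType) (d : nat).
Notation E := 'rV[R]_d.

Lemma enorm_ge0 (z : E) : 0 <= enorm z. Proof. exact: sqrtr_ge0. Qed.

Lemma enorm0 : enorm (0 : E) = 0.
Proof. by rewrite /enorm big1 ?sqrtr0// => i _; rewrite mxE expr0n. Qed.

Lemma enormZ (c : R) (z : E) : 0 <= c -> enorm (c *: z) = c * enorm z.
Proof.
move=> c0; rewrite /enorm -[c in RHS]ger0_norm// -sqrtr_sqr -sqrtrM ?sqr_ge0// mulr_sumr.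
by congr Num.sqrt; apply: eq_bigr => i _; rewrite mxE exprMn.
Qed.

Lemma diam_fin (A : set E) (delta : R) : A !=set0 -> (diam A <= delta%:E)%E ->
  [/\ 0 <= fine (diam A), (fine (diam A))%:E = diam A &
   forall x y, A x -> A y -> enorm (x - y) <= fine (diam A)].
Proof.
move=> [x0 Ax0] hd.
have ge0 : (0 <= diam A)%E.
  by apply: ereal_sup_ubound; exists x0 => //; exists x0 => //; rewrite subrr enorm0.
have fE : (fine (diam A))%:E = diam A.
  by rewrite fineK// ge0_fin_numE// (le_lt_trans hd)// ltry.
split=> //; first by rewrite fine_ge0.
move=> x y Ax Ay; rewrite -lee_fin fE.
by apply: ereal_sup_ubound; exists x => //; exists y.
Qed.

Lemma diam_pow_ge0 t (A : set E) : 0 <= diam_pow t A.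
Proof. by rewrite /diam_pow; case: pselect => // ?; exact: powR_ge0. Qed.

Lemma exprD_le (a b : R) (m : nat) : 0 <= a -> 0 <= b ->
  (a + b) ^+ m <= 2 ^+ m * (a ^+ m + b ^+ m).
Proof.
move=> a0 b0; wlog ab : a b a0 b0 / a <= b.
  move=> H; case: (lerP a b) => [/H|/ltW/H]; first exact.
  by rewrite addrC [a ^+ m + _]addrC; apply.
apply: (@le_trans _ _ ((2 * b) ^+ m)).
  by rewrite lerXn2r ?nnegrE ?addr_ge0 ?mulr_ge0//; lra.
by rewrite exprMn ler_pM2l ?exprn_gt0// lerDr exprn_ge0.
Qed.

Lemma sum_half_le (c : R) N : 0 <= c -> \sum_(0 <= i < N) c * 2^-1 ^+ i.+1 <= c.
Proof.
move=> c0; rewrite -mulr_sumr ler_piMr//.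
suff -> : \sum_(0 <= i < N) (2^-1 : R) ^+ i.+1 = 1 - 2^-1 ^+ N.
  by rewrite gerBl exprn_ge0// invr_ge0.
elim: N => [|N IH]; first by rewrite big_nil expr0 subrr.
by rewrite big_nat_recr//= IH exprS; set x := 2^-1 ^+ N; field.
Qed.

(** A covering set may have diameter 0, while windows need positive radii: the i-th diameter is
    enlarged by c 2^(-i-1), and (a + b)^m <= 2^m (a^m + b^m) keeps the sum small. *)
Lemma hausdorff_null_cover (m : nat) (A : set E) (eps : R) : (0 < m)%N -> 0 < eps ->
  hausdorff m%:R A = 0%E ->
  exists (F : nat -> set E) (r : nat -> R),
  [/\ A `<=` \bigcup_i F i, forall i, 0 < r i,
      forall i x y, F i x -> F i y -> enorm (x - y) <= r i &
      forall N, \sum_(0 <= i < N) r i ^+ m <= eps].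
Proof.
move=> m0 eps0 hA.
pose c : R := Num.min 1 (eps / (2 ^+ m * 2)).
have p0 : (0 : R) < 2 ^+ m by rewrite exprn_gt0.
have c0 : 0 < c by rewrite lt_min ltr01 divr_gt0 ?mulr_gt0.
have c1 : c <= 1 by rewrite ge_min lexx.
have ceps : 2 ^+ m * (c + c) <= eps.
  have : c <= eps / (2 ^+ m * 2) by rewrite ge_min lexx orbT.
  by rewrite ler_pdivlMr ?mulr_gt0// => h; lra.
have : (haus_delta m%:R 1 A < c%:E)%E.
  apply: (@le_lt_trans _ _ 0%E); last by rewrite lte_fin.
  by rewrite -hA; apply: ereal_sup_ubound; exists 1 => //=.
rewrite /haus_delta => hlt; have [z [F [AF Fd] zE] Fc] := ereal_inf_lt hlt.
rewrite -{}zE in Fc.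
pose e i : R := c * 2^-1 ^+ i.+1.
have e0 i : 0 < e i by rewrite mulr_gt0// exprn_gt0// invr_gt0.
have e1 i : e i <= 1.
  by rewrite mulr_ile1 ?(ltW c0) ?exprn_ge0 ?exprn_ile1 ?invr_ge0 ?invf_le1 ?ler1n.
pose r0 i : R := if pselect (F i = set0) then 0 else fine (diam (F i)).
have r00 i : 0 <= r0 i.
  rewrite /r0; case: pselect => // nF; have /set0P Fi : F i != set0 by exact/eqP.
  by have [] := diam_fin Fi (Fd i).
have r0E i : r0 i ^+ m = diam_pow m%:R (F i).
  rewrite /r0 /diam_pow; case: pselect => [F0|nF] /=; first by rewrite expr0n eqn0Ngt m0.
  have /set0P Fi : F i != set0 by exact/eqP.
by rewrite powR_mulrn//; have [] := diam_fin Fi (Fd i).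
exists F, (fun i => r0 i + e i); split=> //.
- by move=> i; rewrite ltr_wpDl.
- move=> i x y Fx Fy; have Fi : F i !=set0 by exists x.
  rewrite /r0; case: pselect => [F0|nF0]; first by rewrite F0 in Fx.
  have [_ _ h] := diam_fin Fi (Fd i).
  by apply: (le_trans (h _ _ Fx Fy)); rewrite lerDl ltW.
- move=> N; apply: le_trans ceps.
  apply: (@le_trans _ _ (2 ^+ m * \sum_(0 <= i < N) (r0 i ^+ m + e i ^+ m))).
    by rewrite mulr_sumr; apply: ler_sum => i _; apply: exprD_le => //; exact: ltW.
  rewrite ler_pM2l// big_split/= lerD//.
    under eq_bigr do rewrite r0E.
    rewrite -lee_fin -sumEFin; apply: le_trans (ltW Fc).
    by apply: (nneseries_lim_ge N) => i _ _; rewrite lee_fin diam_pow_ge0.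
  apply: le_trans (sum_half_le N (ltW c0)); apply: ler_sum => i _.
  by rewrite -[leRHS]expr1 ler_wiXn2l// ltW.
Qed.

End HausdorffNull.

Section RadialProjection.
Variables (R : realType) (n : nat).
Notation T := (Borel R n).
Notation E := 'rV[R]_n.

Lemma continuous_sumr (I : Type) (l : seq I) (f : I -> E -> R) :
  (forall i, continuous (f i)) -> continuous (fun p => \sum_(i <- l) f i p).
Proof.
move=> cf; elim: l => [|i l IH].
  by rewrite (_ : (fun _ => _) = fun=> 0); [exact: cst_continuous|apply/funext => p; rewrite big_nil].
rewrite (_ : (fun _ => _) = fun p => f i p + \sum_(j <- l) f j p); last first.
  by apply/funext => p; rewrite big_cons.
by move=> p; apply: (@continuousD R _ E); [exact: cf|exact: IH].
Qed.

Lemma continuous_coordB (x : E) i : continuous (fun p : E => (p - x) 0 i).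
Proof.
rewrite (_ : (fun _ => _) = fun p : E => p 0 i - x 0 i); last first.
  by apply/funext => p; rewrite !mxE.
by move=> p; apply: (@continuousB R _ E); [exact: continuous_coord|exact: cst_continuous].
Qed.

Lemma continuous_enormB (x : E) : continuous (fun p : E => enorm (p - x)).
Proof.
have cs : continuous (fun p : E => \sum_(i < n) (p - x) ord0 i ^+ 2).
  apply: continuous_sumr => i p.
  by apply: (@continuousM R E); exact: continuous_coordB.
by move=> p; apply: (@continuous_comp E R R _ Num.sqrt); [exact: cs|exact: sqrt_continuous].
Qed.

Lemma enorm_gt0 (z : E) : z != 0 -> 0 < enorm z.
Proof.
move=> z0; rewrite lt_neqAle enorm_ge0 andbT eq_sym; apply: contra z0.
rewrite sqrtr_eq0 => h; apply/eqP/rowP => i; rewrite mxE; apply/eqP.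
rewrite -sqrf_eq0 eq_le sqr_ge0 andbT; apply: le_trans h.
by rewrite (bigD1 i)//= lerDl; apply: sumr_ge0 => j _; exact: sqr_ge0.
Qed.

Lemma radproj_continuous (x y : E) : y <> x -> {for y, continuous (radproj x)}.
Proof.
move=> yx; have y0 : enorm (y - x) != 0.
  by rewrite gt_eqF// enorm_gt0// subr_eq0; apply/eqP.
apply: (@continuousZ R E E (fun p => (enorm (p - x))^-1) (fun p => p - x) y).
  apply: (@continuousV R E (fun p => enorm (p - x))) => //.
  exact: continuous_enormB.
by apply: (@continuousB R E E); [exact: cvg_id|exact: cst_continuous].
Qed.

Lemma measurable_radproj (x : E) (B : set T) : measurable B ->
  measurable ([set y | y <> x /\ B (radproj x y)] : set T).
Proof.
have oD : open [set y : E | y <> x].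
  rewrite (_ : [set _ | _] = ~` [set x]); last by apply/seteqP; split.
  by apply: closed_openC; apply: accessible_closed_set1; apply: hausdorff_accessible; exact: norm_hausdorff.
have mf : measurable_fun ([set y : E | y <> x] : set T) (radproj x : T -> T).
  apply: (@measurability _ _ T T _ _ (@open E)) => //.
  move=> _ [U oU <-]; apply: open_borel.
  rewrite openE => y [/= yx Uy].
  have nU : nbhs (radproj x y) U by exact: open_nbhs_nbhs.
  have nD : nbhs y [set y : E | y <> x] by exact: open_nbhs_nbhs.
  by apply: filterI nD _; apply: (radproj_continuous yx).
move=> mB; have := mf (open_borel oD) B mB.
by congr (measurable _); apply/seteqP; split => y [].
Qed.

Lemma radproj_sphere (x y : E) : y <> x -> sphere (radproj x y).
Proof.
move=> yx; have y0 : 0 < enorm (y - x) by rewrite enorm_gt0// subr_eq0; apply/eqP.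
by rewrite /sphere /= enormZ ?invr_ge0 ?(ltW y0)// mulVf// gt_eqF.
Qed.

End RadialProjection.

Section AffineChart.
Variables (R : realType) (m : nat) (k : 'I_m.+1).
Notation E := 'rV[R]_m.+1.

(** Slopes relative to the coordinate [k] are at most 2 in absolute value, which leaves a margin
    inside the region where [chi] is at least 1/2. *)
Definition in_chart (z : E) := z 0 k != 0 /\ forall i, `|z 0 i| <= 2 * `|z 0 k|.

Lemma in_chart_unit (z : E) : in_chart z ->
  (2 * m.+1%:R)^-1 <= `|((enorm z)^-1 *: z) 0 k|.
Proof.
move=> [zk zi]; have nk : 0 < `|z 0 k| by rewrite normr_gt0.
have z0 : 0 < enorm z by apply: lt_le_trans (coord_le_enorm z k).
have [Z hZ] := supnorm_exists z.
have h : enorm z <= m.+1%:R * (2 * `|z 0 k|).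
  apply: (le_trans (enorm_le_supnorm hZ)); rewrite ler_pM2l ?ltr0n//.
  by case: hZ => _ [i <-].
rewrite mxE normrM ger0_norm ?invr_ge0 ?(ltW z0)//.
rewrite [leRHS]mulrC ler_pdivlMr// [leLHS]mulrC ler_pdivrMr ?mulr_gt0 ?ltr0n//.
by apply: (le_trans h); rewrite le_eqVlt; apply/orP; left; apply/eqP; ring.
Qed.

Lemma unit_coord_le1 (z : E) i : `|((enorm z)^-1 *: z) 0 i| <= 1.
Proof.
apply: (le_trans (coord_le_enorm _ i)); rewrite enormZ ?invr_ge0 ?enorm_ge0//.
have [->|h] := eqVneq (enorm z) 0; first by rewrite mulr0.
by rewrite mulVf.
Qed.

(** With u, v the unit vectors, slopes are u_j / u_k and v_j / v_k, and in the chart |u_k| and |v_k|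
    are at least 1 / (2(m + 1)). The numerator u_j v_k - v_j u_k of the difference is at most twice
    |u - v|. Small sets on the sphere thus become small windows of slopes. *)
Lemma chart_lipschitz (z w : E) j : in_chart z -> in_chart w ->
  `|z 0 j / z 0 k - w 0 j / w 0 k| <=
    8 * m.+1%:R ^+ 2 * enorm ((enorm z)^-1 *: z - (enorm w)^-1 *: w).
Proof.
move=> cz cw; have ez := in_chart_unit cz; have ew := in_chart_unit cw.
set r := enorm _; set u := (enorm z)^-1 *: z in ez r *; set v := (enorm w)^-1 *: w in ew r *.
have c0 : (0 : R) < 2 * m.+1%:R by rewrite mulr_gt0 ?ltr0n.
have uk : u 0 k != 0 by rewrite -normr_gt0; apply: lt_le_trans ez; rewrite invr_gt0.
have vk : v 0 k != 0 by rewrite -normr_gt0; apply: lt_le_trans ew; rewrite invr_gt0.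
have z0 : enorm z != 0 by move: uk; rewrite mxE; apply: contra => /eqP ->; rewrite invr0 mul0r.
have w0 : enorm w != 0 by move: vk; rewrite mxE; apply: contra => /eqP ->; rewrite invr0 mul0r.
have [zk _] := cz; have [wk _] := cw.
have -> : z 0 j / z 0 k = u 0 j / u 0 k.
  by rewrite /u !mxE invfM invrK mulrACA mulVf// mul1r.
have -> : w 0 j / w 0 k = v 0 j / v 0 k.
  by rewrite /v !mxE invfM invrK mulrACA mulVf// mul1r.
have -> : u 0 j / u 0 k - v 0 j / v 0 k =
  ((u - v) 0 j * v 0 k - v 0 j * (u - v) 0 k) * ((u 0 k)^-1 * (v 0 k)^-1).
  rewrite [(u - v) 0 j]mxE [(u - v) 0 k]mxE [(- v) 0 j]mxE [(- v) 0 k]mxE.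
  by field; rewrite uk vk.
rewrite normrM.
have -> : 8 * m.+1%:R ^+ 2 * r = 2 * r * ((2 * m.+1%:R) * (2 * m.+1%:R)) by ring.
have rj i : `|(u - v) 0 i| <= r by exact: coord_le_enorm.
apply: ler_pM => //.
  apply: (le_trans (ler_normB _ _)); rewrite !normrM.
  have h1 : `|(u - v) 0 j| * `|v 0 k| <= r * 1 by rewrite ler_pM// unit_coord_le1.
  have h2 : `|v 0 j| * `|(u - v) 0 k| <= 1 * r by rewrite ler_pM// unit_coord_le1.
  lra.
rewrite normrM !normfV ler_pM ?invr_ge0//.
  by rewrite -[leRHS]invrK lef_pV2 ?posrE ?invr_gt0 ?normr_gt0.
by rewrite -[leRHS]invrK lef_pV2 ?posrE ?invr_gt0 ?normr_gt0.
Qed.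

End AffineChart.

Section GoodPointNull.
Variables (R : realType) (m : nat) (k : 'I_m.+1).
Notation E := 'rV[R]_m.+1.
Notation T := (Borel R m.+1).
Variables (mu : {measure set T -> \bar R}) (Y : set E).
Variables (q b0 : R) (rho : nat -> seq (E * R)) (U : set_system nat) (x : E) (N0 : nat).
Hypothesis UU : UltraFilter U.
Hypothesis Utail : forall N, U [set kap | (N <= kap)%N].
Hypothesis q01 : 0 < q < 1.
Hypothesis b00 : 0 < b0.
Hypothesis rho_ge0 : forall kap, all (fun a => 0 <= a.2) (rho kap).
Hypothesis rho_total : forall kap, \sum_(a <- rho kap) a.2 = fine (mu Y).
Hypothesis rho_mass : forall kap (D : set E) (H : E -> R) c,
  measurable (D : set T) -> D `<=` Y ->
  (forall p p', same_icoord k kap p p' -> H p = H p') -> (forall p, 0 <= H p) -> 0 <= c ->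
  (forall p, D p -> c <= H p) ->
  c * fine (mu D) <= \sum_(a <- rho kap) a.2 * H a.1.
Hypothesis x_good : forall n, (N0 <= n)%N ->
  U [set kap | mean_gap k n kap (rho kap) x <= q ^+ n].
Hypothesis mY : measurable (Y : set T).
Hypothesis fY : (mu Y < +oo)%E.
Hypothesis Y_bound : forall y, Y y -> `|(y - x) 0 k| <= b0.
Hypothesis Y_chart : forall y, Y y -> in_chart k (y - x).

Lemma exists_expr_le (e : R) : 0 < e -> exists2 n, (N0 <= n)%N & q ^+ n <= e.
Proof.
move=> e0; have /andP[q0 q1] := q01.
have q1' : `|q| < 1 by rewrite ger0_norm ?ltW.
have /cvgrPdist_le/(_ _ e0)[n _ hn] := cvg_expr q1'.
exists (maxn N0 n); first exact: leq_maxl.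
have := hn (maxn N0 n) (leq_maxr _ _) => /=; rewrite sub0r normrN.
by rewrite ger0_norm// exprn_ge0// ltW.
Qed.

(** The order of choices matters: [n0] is fixed first to make the geometric tail small, and only
    then is the null set covered so finely that the term with the factor 2^(n0 m) is small as
    well. *)
Lemma good_point_null (B : set T) : (0 < m)%N -> measurable B ->
  hausdorff m%:R (B `&` sphere (R := R) (d := m.+1)) = 0%E ->
  mu (Y `&` [set y | y <> x /\ B (radproj x y)]) = 0%E.
Proof.
move=> m0 mB hB; have /andP[q0 q1] := q01.
set P := _ `&` _; have mP : measurable (P : set T).
  by apply: measurableI => //; exact: measurable_radproj.
have PY : P `<=` Y by move=> y [].
have fP : (mu P < +oo)%E by apply: le_lt_trans fY; apply: le_measure; rewrite ?inE.
suff key eta : 0 < eta -> fine (mu P) <= eta.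
  have h : fine (mu P) <= 0 by apply/ler_addgt0Pl => e e0; rewrite addr0 key.
  apply/eqP; rewrite eq_le measure_ge0 andbT.
  by rewrite -(@fineK _ (mu P)) ?lee_fin// ge0_fin_numE.
move=> eta0; set c := (16 * b0)^-1 ^+ m.
have c0 : 0 < c by rewrite exprn_gt0// invr_gt0 mulr_gt0.
have q1' : 0 < 1 - q by rewrite subr_gt0.
have [n0 n0N hn0] : exists2 n, (N0 <= n)%N & q ^+ n <= c * (eta / 2) * (1 - q).
  by apply: exists_expr_le; rewrite !mulr_gt0// divr_gt0.
pose K : R := 8 * m.+1%:R ^+ 2.
have K0 : 0 < K by rewrite mulr_gt0 ?exprn_gt0 ?ltr0n.
pose A := 2 ^+ (n0 * m) * fine (mu Y) * (5 * K) ^+ m + 1.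
have A0 : 0 < A.
  by rewrite ltr_wpDl// mulr_ge0 ?mulr_ge0 ?exprn_ge0 ?fine_ge0 ?mulr_ge0 ?(ltW K0).
have eps0 : 0 < c * (eta / 2) / A by rewrite divr_gt0// mulr_gt0// divr_gt0.
have [F [r [BF r0 Fr rsum]]] := hausdorff_null_cover m0 eps0 hB.
(* Each window is centred at the slope of an actual point of [P], so that the centre lies in the
   chart; covering sets missed by [P] get a default centre. *)
have /choice[y0 hy0] : forall i, exists y0, forall y, P y -> F i (radproj x y) ->
    P y0 /\ F i (radproj x y0).
  move=> i; have [[y [Py Fy]]|no] := pselect (exists y, P y /\ F i (radproj x y)).
    by exists y.
  by exists x => y Py Fy; case: no; exists y.
pose u i j := (y0 i - x) 0 (lift k j) / (y0 i - x) 0 k.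
(* The window condition on the slope with its denominator cleared, so that it is given by continuous
   functions of [y]. *)
pose D i : set E := Y `&` [set y | forall j,
  0 <= K * r i * `|(y - x) 0 k| - `|(y - x) 0 (lift k j) - u i j * (y - x) 0 k| <
   K * r i * `|(y - x) 0 k| + 1].
have mD i : measurable (D i : set T).
  apply: measurableI => //.
  apply: (@borel_forall R m.+1 _ (fun j : 'I_m => [set y | _])) => j.
  pose f1 (y : E) := K * r i * `|(y - x) 0 k|.
  pose f2 (y : E) := `|(y - x) 0 (lift k j) - u i j * (y - x) 0 k|.
  have cf1 : continuous f1.
    move=> y; apply: (@continuousM R E (fun=> K * r i) (fun y => `|(y - x) 0 k|)).
      exact: cst_continuous.
    by apply: continuous_comp; [exact: continuous_coordB|exact: norm_continuous].
  have cf2 : continuous f2.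
    move=> y; apply: (@continuous_comp E R R (fun y => (y - x) 0 (lift k j) - u i j * (y - x) 0 k)
      (fun t => `|t|)); last exact: norm_continuous.
    apply: (@continuousB R _ E); first exact: continuous_coordB.
    by apply: (@continuousM R E); [exact: cst_continuous|exact: continuous_coordB].
  have cf y : {for y, continuous (fun y => f1 y - f2 y)}.
    by apply: (@continuousB R _ E); [exact: cf1|exact: cf2].
  rewrite (_ : [set y | _] = [set y | 0 <= f1 y - f2 y]); last first.
    apply/seteqP; split=> y /=; first by case/andP.
    by move=> ->/=; rewrite ltrBlDr -addrA ltrDl; apply: ltr_pwDl => //.
  apply: closed_borel; rewrite (_ : [set _ | _] = (fun y => f1 y - f2 y) @^-1` [set t | t >= 0])//.
  by apply: preimage_closed; [move=> y _; exact: cf|exact: closed_ge].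
have DE i y : Y y -> D i y <-> forall j,
    `|(y - x) 0 (lift k j) / (y - x) 0 k - u i j| <= K * r i.
  move=> Yy; have [zk _] := Y_chart Yy; have nk : 0 < `|(y - x) 0 k| by rewrite normr_gt0.
  have e j : (`|(y - x) 0 (lift k j) / (y - x) 0 k - u i j| <= K * r i) =
    (`|(y - x) 0 (lift k j) - u i j * (y - x) 0 k| <= K * r i * `|(y - x) 0 k|).
    rewrite -(ler_pM2r nk) -normrM; congr (`|_| <= _).
    by rewrite mulrBl divfK.
  split=> [[_ h] j|h]; first by rewrite e -subr_ge0; case/andP: (h j).
  split=> // j; rewrite subr_ge0 -e h/= ltrBlDr -addrA ltrDl.
  by apply: ltr_pwDl.
(* The mass estimate handles finitely many windows with a bound independent of their number;
   continuity from below then passes to all of them. *)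
pose G N : set E := \big[setU/set0]_(i < N) D i.
have GP N y : G N y <-> exists i : 'I_N, D i y.
  rewrite /G -bigcup_mkord; split=> [[i /= iN Di]|[i Di]]; first by exists (Ordinal iN).
  by exists i => //=.
have mG N : measurable (G N : set T) by apply: bigsetU_measurable => i _; exact: mD.
have GY N : G N `<=` Y by move=> y /GP[i []].
have Gle N : (mu (G N) <= eta%:E)%E.
  have fG : (mu (G N) < +oo)%E.
    by apply: le_lt_trans fY; apply: le_measure; rewrite ?inE//; exact: GY.
  rewrite -(@fineK _ (mu (G N))) ?ge0_fin_numE// lee_fin -(ler_pM2l c0).
  have Kr (i : 'I_N) : 0 < K * r i by rewrite mulr_gt0.
  have Gu y : G N y -> exists i : 'I_N, forall j,
      `|(y - x) 0 (lift k j) / (y - x) 0 k - u i j| <= K * r i.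
    by move=> Gy; have /GP[i Di] := Gy; exists i; apply/DE => //; exact: GY Gy.
  have sep y : Y y -> [/\ (y - x) 0 k != 0, `|(y - x) 0 k| <= b0 &
      forall i, `|(y - x) 0 i| <= 2 * `|(y - x) 0 k|].
    by move=> Yy; have [? ?] := Y_chart Yy; split=> //; exact: Y_bound.
  have xg n : (n0 <= n)%N -> U [set kap | mean_gap k n kap (rho kap) x <= q ^+ n].
    by move=> hn; apply: x_good; exact: leq_trans hn.
  apply: (le_trans (good_point_mass_le UU Utail q01 b00 rho_ge0 rho_total rho_mass xg sep
    Kr (mG N) (GY N) Gu)).
  have -> : \sum_(i < N) (5 * (K * r i)) ^+ m = (5 * K) ^+ m * \sum_(0 <= i < N) r i ^+ m.
    by rewrite big_mkord mulr_sumr; apply: eq_bigr => i _; rewrite mulrA exprMn.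
  have h1 : q ^+ n0 / (1 - q) <= c * (eta / 2) by rewrite ler_pdivrMr.
  have S0 : 0 <= \sum_(0 <= i < N) r i ^+ m.
    by apply: sumr_ge0 => i _; rewrite exprn_ge0// ltW.
  have h2 : 2 ^+ (n0 * m) * fine (mu Y) * ((5 * K) ^+ m * \sum_(0 <= i < N) r i ^+ m)
     <= c * (eta / 2).
    rewrite mulrA; apply: (@le_trans _ _ (A * \sum_(0 <= i < N) r i ^+ m)).
      by rewrite ler_wpM2r// /A lerDl.
    by rewrite mulrC -ler_pdivlMr.
  apply: (le_trans (lerD h2 h1)).
  by rewrite le_eqVlt; apply/orP; left; apply/eqP; field.
have PG : P `<=` \bigcup_N G N.
  move=> y Py; have [Yy [yx By]] := Py.
  have [i _ Fi] := BF _ (conj By (radproj_sphere yx)).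
  have [Py0 Fy0] := hy0 i y Py Fi.
  exists i.+1 => //; apply/GP; exists ord_max => /=; apply/DE => // j.
  apply: (le_trans (chart_lipschitz _ (Y_chart Yy) (Y_chart (PY _ Py0)))).
  by rewrite ler_pM2l//; exact: Fr.
have mcG : measurable (\bigcup_N G N : set T) by exact: bigcup_measurable.
have ndG : nondecreasing_seq G.
  move=> a b ab; apply/subsetPset => y /GP[i Di]; apply/GP.
  by exists (widen_ord ab i).
have cG := nondecreasing_cvg_mu (mu := mu) mG mcG ndG.
have muG : (mu (\bigcup_N G N) <= eta%:E)%E.
  have <- := cvg_lim (@ereal_hausdorff R) cG.
  by apply: lime_le; [apply/cvg_ex; eexists; exact: cG|exact: nearW].
rewrite -lee_fin fineK ?ge0_fin_numE//; apply: le_trans muG.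
by apply: le_measure; rewrite ?inE.
Qed.

End GoodPointNull.

(** * Exceptional points as a countable union *)

Section SmallSets.
Variables (R : realType) (d : nat) (tau : R).
Notation E := 'rV[R]_d.
Hypothesis tau0 : 0 < tau.

(** Zero dyadic content of dimension t, for [tau] = 2^(-t): a cube of side 2^(-l) costs [tau]^l.
    Covers are sequences of finite lists because each [bad n] comes with one finite list. *)
Definition small (A : set E) := forall eta : R, 0 < eta ->
  exists F : nat -> seq (nat * 'rV[int]_d),
  (forall x, A x -> exists n, exists2 c, c \in F n & dyad c.1 x = c.2) /\
  forall N, \sum_(0 <= n < N) \sum_(c <- F n) tau ^+ c.1 <= eta.

(** Countably many covers are merged along antidiagonals, which keeps every block a finite list. *)
Lemma sum_antidiagonal (g : nat -> nat -> R) N :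
  \sum_(0 <= n < N) \sum_(0 <= i < n.+1) g i (n - i)%N =
  \sum_(0 <= i < N) \sum_(0 <= n < N - i) g i n.
Proof.
elim: N => [|N IH]; first by rewrite !big_nil.
rewrite big_nat_recr//= IH [RHS]big_nat_recr//= subSnn big_nat1.
rewrite [X in _ + X]big_nat_recr//= subnn addrA; congr (_ + _).
rewrite -big_split/= big_nat [RHS]big_nat; apply: eq_bigr => i /andP[_ iN].
by rewrite subSn 1?ltnW// big_nat_recr.
Qed.

Lemma small_bigcup (A : nat -> set E) : (forall i, small (A i)) -> small (\bigcup_i A i).
Proof.
move=> sA eta eta0.
have e0 i : 0 < eta * 2^-1 ^+ i.+1 by rewrite mulr_gt0// exprn_gt0// invr_gt0.
have /choice[F hF] : forall i, exists F : nat -> seq (nat * 'rV[int]_d),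
  (forall x, A i x -> exists n, exists2 c, c \in F n & dyad c.1 x = c.2) /\
  forall N, \sum_(0 <= n < N) \sum_(c <- F n) tau ^+ c.1 <= eta * 2^-1 ^+ i.+1.
  by move=> i; exact: sA (e0 i).
exists (fun n => flatten [seq F i (n - i)%N | i <- iota 0 n.+1]); split.
  move=> x [i _ Aix]; have [/(_ _ Aix)[n [c cF cx]] _] := hF i.
  exists (i + n)%N, c => //; apply/flatten_mapP; exists i; last by rewrite addKn.
  by rewrite mem_iota/= add0n ltnS leq_addr.
move=> N; rewrite (eq_bigr (fun n => \sum_(0 <= i < n.+1) \sum_(c <- F i (n - i)%N) tau ^+ c.1));
  last by move=> n _; rewrite big_flatten big_map /index_iota subn0.
rewrite (@sum_antidiagonal (fun i n => \sum_(c <- F i n) tau ^+ c.1)).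
apply: le_trans (sum_half_le N (ltW eta0)); apply: ler_sum => i _.
by have [_] := hF i.
Qed.

Lemma small_sub (A B : set E) : A `<=` B -> small B -> small A.
Proof.
move=> AB sB eta eta0; have [F [F1 F2]] := sB _ eta0.
by exists F; split=> // x /AB; exact: F1.
Qed.

End SmallSets.

Section FarCubes.
Variables (R : realType) (m : nat).
Notation E := 'rV[R]_m.+1.
Notation T := (Borel R m.+1).
Variables (mu : {measure set T -> \bar R}) (s tau : R).
Hypothesis mu_fin : forall K : set (Rd R m.+1), compact K -> (mu K < +oo)%E.
Hypothesis mu_energy : (energy mu s < +oo)%E.
Hypothesis m0 : (0 < m)%N.
Hypothesis hs : m%:R < s <= m%:R + 1.
Hypothesis tau0 : 0 < tau.
Hypothesis tau_big : 1 < 2 ^+ m * tau.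
Hypothesis tau_small : 2 ^+ m * tau * (2^-1 `^ (s - m%:R)) < 1.
Variables (l : nat) (idX idY : 'rV[int]_m.+1).

(* Indices 3 apart force the two cubes to be separated in the direction [k] of
   largest index difference, with slopes of absolute value at most 2. *)
Definition far := exists i, 3 <= `|idX 0 i - idY 0 i|.

(** If D is the largest index difference, attained at [k], then 2^l |y - x|_i <= D + 1 and 2^l |y -
    x|_k >= D - 1, and D + 1 <= 2 (D - 1) exactly when D >= 3. *)
Lemma far_chart : far -> exists (k : 'I_m.+1) (b0 : R), 0 < b0 /\
  forall x y : E, dyad l x = idX -> dyad l y = idY ->
    `|(y - x) 0 k| <= b0 /\ in_chart k (y - x).
Proof.
move=> [i0 hi0]; pose k := [arg max_(i > i0) `|idX 0 i - idY 0 i|]%O.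
have kmax i : `|idX 0 i - idY 0 i| <= `|idX 0 k - idY 0 k|.
  by rewrite /k; case: arg_maxP => //= j _; apply.
set D := `|idX 0 k - idY 0 k| in kmax.
have D3 : 3 <= D by exact: le_trans (kmax i0).
have D3' : (3 : R) <= D%:~R by rewrite (ler_int R 3).
have t0 : (0 : R) < 2 ^+ l by rewrite exprn_gt0.
exists k, ((D%:~R + 1) / 2 ^+ l); split; first by rewrite divr_gt0//; lra.
move=> x y xX yY.
have near i : `|2 ^+ l * (y - x) 0 i - ((idY 0 i)%:~R - (idX 0 i)%:~R)| <= 1.
  have /andP[x1 x2] := dyad_itv i xX; have /andP[y1 y2] := dyad_itv i yY.
  rewrite !mxE mulrBr ler_norml; apply/andP; split; lra.
have up i : 2 ^+ l * `|(y - x) 0 i| <= D%:~R + 1.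
  have h : `|(idY 0 i)%:~R - (idX 0 i)%:~R : R| <= D%:~R.
    by rewrite distrC -intrB -intr_norm ler_int.
  rewrite -[2 ^+ l]ger0_norm ?(ltW t0)// -normrM.
  have -> : 2 ^+ l * (y - x) 0 i = (2 ^+ l * (y - x) 0 i - ((idY 0 i)%:~R - (idX 0 i)%:~R))
    + ((idY 0 i)%:~R - (idX 0 i)%:~R) by ring.
  by apply: (le_trans (ler_normD _ _)); rewrite addrC lerD.
have lo : D%:~R - 1 <= 2 ^+ l * `|(y - x) 0 k|.
  have h : `|(idY 0 k)%:~R - (idX 0 k)%:~R : R| = D%:~R.
    by rewrite distrC -intrB -intr_norm.
  rewrite -[2 ^+ l]ger0_norm ?(ltW t0)// -normrM -h lerBlDr.
  have {1}-> : (idY 0 k)%:~R - (idX 0 k)%:~R = 2 ^+ l * (y - x) 0 k -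
     (2 ^+ l * (y - x) 0 k - ((idY 0 k)%:~R - (idX 0 k)%:~R)) by ring.
  by apply: (le_trans (ler_normB _ _)); rewrite lerD2l.
split; first by rewrite ler_pdivlMr// mulrC.
split=> [|i].
  rewrite -normr_gt0 -(pmulr_rgt0 _ t0); lra.
rewrite -(ler_pM2l t0) mulrCA; have := up i; lra.
Qed.

Definition exceptional_piece : set E := [set x | dyad l x = idX /\
  exists B : set T, [/\ measurable B,
    hausdorff m%:R (B `&` sphere (R := R) (d := m.+1)) = 0%E &
    mu ([set y | dyad l y = idY] `&` [set y | y <> x /\ B (radproj x y)]) <> 0%E]].

(** A point outside [bad n] for all [n >= N0] is good from [N0] on, so the piece lies in the union
    of these bad sets. The threshold [N0] makes the geometric tail of their covers cost at most
    [eta]. *)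
Lemma exceptional_piece_small : far -> small tau exceptional_piece.
Proof.
move=> /far_chart[k [b0 [b00 hk]]].
pose b := 2^-1 `^ (s - m%:R); pose w := 2 ^+ m * tau * b; have w1 : w < 1 := tau_small.
have w0 : 0 < w.
  by rewrite mulr_gt0 ?powR_gt0// (lt_trans _ tau_big).
(* The arithmetic mean gives w < q^2 < 1, so that both the gaps [q ^+ n] at good points and the
   contents [(w / q ^+ 2) ^+ n] of the bad sets are summable. *)
pose q := (1 + w) / 2.
have q01 : 0 < q < 1 by apply/andP; split; rewrite /q; lra.
have /andP[q0 q1] := q01.
have wq : w / q ^+ 2 < 1.
  rewrite ltr_pdivrMr ?exprn_gt0// mul1r -subr_gt0.
  have -> : q ^+ 2 - w = ((1 - w) / 2) ^+ 2 by rewrite /q; field.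
  by rewrite exprn_gt0// divr_gt0// subr_gt0.
have wq0 : 0 < w / q ^+ 2 by rewrite divr_gt0 ?exprn_gt0.
pose Y : set E := [set p | dyad l p = idY].
pose I := fine (energy mu s) + 1.
have I0 : 0 < I.
  rewrite ltr_wpDl// fine_ge0//; apply: integral_ge0 => x _; apply: integral_ge0 => y _.
  by case: ifP => // _; rewrite lee_fin powR_ge0.
have /choice[rho hrho] := fun kap => discretization k kap mu_fin mu_energy l idY.
have rho0 kap : all (fun a => 0 <= a.2) (rho kap) by have [] := hrho kap.
have rhoT kap : \sum_(a <- rho kap) a.2 = fine (mu Y) by have [] := hrho kap.
have rhoE kap : energy_bounded k s kap Y I (rho kap).
  move=> kappa h1 h2 h3; have [_ _ h _] := hrho kap.
  by apply: (le_trans (h _ h1 h2 h3)); rewrite lerDl.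
have rhoM kap : forall (D : set E) (H : E -> R) c, measurable (D : set T) -> D `<=` Y ->
  (forall p p', same_icoord k kap p p' -> H p = H p') -> (forall p, 0 <= H p) -> 0 <= c ->
  (forall p, D p -> c <= H p) -> c * fine (mu D) <= \sum_(a <- rho kap) a.2 * H a.1.
  by have [_ _ _] := hrho kap.
have [U [UU ooU]] := ultraFilterLemma (F := \oo) _.
have Utail N : U [set kap | (N <= kap)%N] by apply: ooU; exact: nbhs_infty_ge.
have [C C0 hC] := bad_content idX UU Utail hs tau0 tau_big q0 I0 rho0 rhoE.
move=> eta eta0.
have [N0 lN0 hN0] : exists2 N0, (l <= N0)%N & (w / q ^+ 2) ^+ N0 <= eta / C * (1 - w / q ^+ 2).
  apply: exists_expr_le; first by rewrite wq0.
  by rewrite mulr_gt0 ?divr_gt0// subr_gt0.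
have /choice[F hF] : forall n, exists F : seq (nat * 'rV[int]_m.+1),
  (forall x, bad k q U l idX rho (N0 + n) x -> exists2 c, c \in F & dyad c.1 x = c.2) /\
  \sum_(c <- F) tau ^+ c.1 <= C * (w / q ^+ 2) ^+ (N0 + n).
  by move=> n; apply: hC; rewrite (leq_trans lN0)// leq_addr.
exists F; split.
  move=> x [xX [B [mB hB muB]]].
  apply: contrapT => no; apply: muB.
  apply: (@good_point_null R m k mu Y q b0 rho U x N0 UU Utail q01 b00 rho0 rhoT rhoM) => //.
  - move=> n hn; apply: (good_eventually UU xX) => bx.
    apply: no; exists (n - N0)%N; have [+ _] := hF (n - N0)%N.
    by rewrite subnKC//; exact.
  - exact: borel_dyad.
  - exact: dyad_lty.
  - by move=> y yY; have [] := hk _ _ xX yY.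
  - by move=> y yY; have [] := hk _ _ xX yY.
move=> N; apply: (@le_trans _ _ (C * \sum_(N0 <= n < N0 + N) (w / q ^+ 2) ^+ n)).
  rewrite mulr_sumr -{1}[N0]add0n big_addn addKn; apply: ler_sum => n _.
  by rewrite addnC; have [_] := hF n.
rewrite mulrC -ler_pdivlMr//; apply: (le_trans (sum_geo_tail _ _ _)); first by rewrite wq0.
by rewrite ler_pdivrMr ?subr_gt0.
Qed.

End FarCubes.

Section Enumeration.
Variables (R : realType) (T : eqType) (F : nat -> seq T) (g : T -> R).
Hypothesis g0 : forall x, 0 <= g x.

(* The [None]s make the concatenation of the first [N] blocks at least [N] long. *)
Let block N := flatten [seq rcons (map Some (F n)) None | n <- iota 0 N].

Let blockS N : block N.+1 = block N ++ rcons (map Some (F N)) None.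
Proof. by rewrite /block -addn1 iotaD map_cat flatten_cat/= cats0. Qed.

Let size_block N : (N <= size (block N))%N.
Proof. by elim: N => // N IH; rewrite blockS size_cat size_rcons addnS ltnS (leq_trans IH)// leq_addr. Qed.

Let nth_block N N' i : (N <= N')%N -> (i < size (block N))%N ->
  nth None (block N') i = nth None (block N) i.
Proof.
move=> /subnK <-; elim: (N' - N)%N => [//|n IH] hi.
rewrite addSn blockS nth_cat IH//; case: ltnP => //.
suff : (i < size (block (n + N)))%N by rewrite ltnNge => /negbTE ->.
apply: leq_trans hi _; elim: n {IH} => [//|n IH].
by rewrite addSn blockS size_cat (leq_trans IH)// leq_addr.
Qed.

Lemma flatten_enumeration : exists e : nat -> option T,
  (forall n x, x \in F n -> exists N, e N = Some x) /\
  forall N, \sum_(0 <= i < N) oapp g 0 (e i) <= \sum_(0 <= n < N) \sum_(x <- F n) g x.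
Proof.
exists (fun N => nth None (block N.+1) N); split.
  move=> n x xF; have : Some x \in block n.+1.
    by rewrite blockS mem_cat mem_rcons inE map_f ?orbT.
  move=> /(nthP None)[i hi ix]; exists i; rewrite -ix.
  case: (leqP n i) => h; first by apply: nth_block.
  by apply/esym/nth_block; [exact: ltnW|exact: size_block].
move=> N; have -> : \sum_(0 <= n < N) \sum_(x <- F n) g x = \sum_(o <- block N) oapp g 0 o.
  elim: N => [|N IH]; first by rewrite !big_nil.
  rewrite big_nat_recr//= IH blockS big_cat/=; congr (_ + _).
  by rewrite -cats1 big_cat big_map big_seq1/= addr0.
rewrite (big_nth None) (@big_cat_nat _ _ _ N 0 (size (block N)))//=.
rewrite -[leLHS]addr0 lerD//.
  rewrite big_nat [leRHS]big_nat; apply: ler_sum => i /andP[_ iN].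
  by rewrite (@nth_block i.+1 N)// size_block.
by apply: sumr_ge0 => i _; case: nth.
Qed.

End Enumeration.

(** * From dyadic content to Hausdorff measure *)

Section HausdorffOfSmall.
Variables (R : realType) (m : nat).
Notation E := 'rV[R]_m.+1.

Lemma diam_le (A : set E) (D : R) : (forall x y, A x -> A y -> enorm (x - y) <= D) ->
  (diam A <= D%:E)%E.
Proof.
move=> h; apply: ge_ereal_sup => _ [x Ax [y Ay <-]].
by rewrite lee_fin h.
Qed.

Lemma diam_pow_le (A : set E) (D t : R) : 0 <= t -> 0 <= D ->
  (forall x y, A x -> A y -> enorm (x - y) <= D) -> diam_pow t A <= D `^ t.
Proof.
move=> t0 D0 h; rewrite /diam_pow; case: pselect => [A0|nA]; first exact: powR_ge0.
have /set0P An : A != set0 by exact/eqP.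
have [d0 dE _] := diam_fin An (diam_le h).
apply: ge0_ler_powR; rewrite ?nnegrE// -lee_fin dE.
exact: diam_le.
Qed.

Lemma dyad_enorm l (p q : E) : dyad l p = dyad l q -> enorm (p - q) <= m.+1%:R * (2 ^+ l)^-1.
Proof.
move=> h; have [Z hZ] := supnorm_exists (p - q).
apply: (le_trans (enorm_le_supnorm hZ)); rewrite ler_pM2l ?ltr0n//.
by case: hZ => _ [i <-]; rewrite !mxE; exact: dyad_dist.
Qed.

Lemma powR_invl (x t : R) : 0 <= x -> x^-1 `^ t = (x `^ t)^-1.
Proof. by move=> x0; rewrite -powR_inv1// -powRrM mulN1r powRN. Qed.

Lemma powR2N_exprn (t : R) n : (2 `^ (- t)) ^+ n = (2 ^+ n)^-1 `^ t.
Proof.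
rewrite powR_invl ?exprn_ge0// powRN exprVn; congr (_^-1).
by rewrite -powR_mulrn ?powR_ge0// -powRrM mulrC powRrM powR_mulrn.
Qed.

(** A small total cost bounds the cost, hence the size, of every single cube, so the restriction on
    diameters comes for free. Diameters at most 1 allow passing from [t] to the larger [t']. *)
Lemma small_hausdorff (A : set E) (t t' : R) : 0 < t -> t <= t' ->
  small (2 `^ (- t)) A -> hausdorff t' A = 0%E.
Proof.
move=> t0 tt' sA; have t'0 : 0 <= t' by rewrite (le_trans _ tt')// ltW.
apply/eqP; rewrite eq_le; apply/andP; split; last first.
  apply: (@le_trans _ _ (haus_delta t' 1 A)).
    apply: le_ereal_inf_tmp => _ [F _ <-]; apply: nneseries_ge0 => i _ _.
    by rewrite lee_fin diam_pow_ge0.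
  by apply: ereal_sup_ubound; exists 1 => //=.
apply: ge_ereal_sup => _ [delta /= delta0 <-].
apply/lee_addgt0Pr => eps eps0; rewrite add0e.
pose D : R := m.+1%:R; have D0 : 0 < D by rewrite ltr0n.
pose v := Num.min delta 1 / D.
have v0 : 0 < v by rewrite divr_gt0// lt_min delta0 ltr01.
have vD : v * D <= delta by rewrite divfK ?gt_eqF// ge_min lexx.
have vD1 : v * D <= 1 by rewrite divfK ?gt_eqF// ge_min lexx orbT.
(* The first bound forces all cubes to have side at most [v], the second makes the sum of powers of
   diameters at most [eps]. *)
pose eta := Num.min (v `^ t) (eps / D `^ t).
have eta0 : 0 < eta by rewrite lt_min powR_gt0// divr_gt0// powR_gt0.
have [F [F1 F2]] := sA _ eta0.
pose tau : R := 2 `^ (- t); have tau0 : 0 < tau by rewrite powR_gt0.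
have g0 (c : nat * 'rV[int]_m.+1) : 0 <= tau ^+ c.1 by rewrite exprn_ge0// ltW.
have [e [e1 e2]] := flatten_enumeration F g0.
have {}e2 N : \sum_(0 <= i < N) oapp (fun c => tau ^+ c.1) 0 (e i) <= eta.
  exact: le_trans (e2 N) (F2 N).
have ei i c : e i = Some c -> (2 ^+ c.1)^-1 <= v.
  move=> eic; have h : tau ^+ c.1 <= v `^ t.
    have : tau ^+ c.1 <= eta.
      apply: le_trans (e2 i.+1); rewrite big_nat_recr//= eic lerDr.
      by apply: sumr_ge0 => j _; case: (e j).
    by move=> /le_trans; apply; rewrite ge_min lexx.
  rewrite leNgt; apply/negP => vl; suff : v `^ t < tau ^+ c.1 by rewrite ltNge h.
  rewrite /tau powR2N_exprn.
  by apply: gt0_ltr_powR; rewrite ?nnegrE ?invr_ge0 ?exprn_ge0 ?(ltW v0).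
pose G i : set E := if e i is Some c then [set p | dyad c.1 p = c.2] else set0.
have Gd i x y c : e i = Some c -> G i x -> G i y -> enorm (x - y) <= (2 ^+ c.1)^-1 * D.
  move=> eic; rewrite /G eic /= => xc yc; rewrite mulrC; apply: dyad_enorm.
  by rewrite xc yc.
have small_diam i c : e i = Some c -> (2 ^+ c.1)^-1 * D <= v * D.
  by move=> eic; rewrite ler_pM2r// (ei _ _ eic).
have l0 n : 0 <= ((2 ^+ n)^-1 : R) by rewrite invr_ge0 exprn_ge0.
apply: (@le_trans _ _ (\sum_(0 <= i <oo) (diam_pow t' (G i))%:E)%E).
  apply: ereal_inf_lbound; exists G => //; split.
    move=> x Ax; have [n [c cF cx]] := F1 _ Ax; have [N eN] := e1 _ _ cF.
    by exists N => //; rewrite /G eN.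
  move=> i; apply: diam_le => x y; case eic : (e i) => [c|]; last by rewrite /G eic.
  move=> Gx Gy; apply: (le_trans (Gd _ _ _ _ eic Gx Gy)).
  exact: le_trans (small_diam _ _ eic) vD.
apply: lime_le.
  by apply: is_cvg_nneseries => i _ _; rewrite lee_fin diam_pow_ge0.
apply: nearW => N; rewrite sumEFin lee_fin.
apply: (@le_trans _ _ (D `^ t * eta)); last first.
  by rewrite mulrC -ler_pdivlMr ?powR_gt0// ge_min lexx orbT.
apply: le_trans (ler_wpM2l (powR_ge0 _ _) (e2 N)).
rewrite mulr_sumr; apply: ler_sum => i _.
case eic : (e i) => [c|] /=; last first.
  by rewrite mulr0 /diam_pow /G eic; case: pselect.
apply: (@le_trans _ _ (((2 ^+ c.1)^-1 * D) `^ t')).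
  by apply: diam_pow_le => [//||x y]; [rewrite mulr_ge0// ltW|exact: Gd].
have w0 : 0 < (2 ^+ c.1)^-1 * D by rewrite mulr_gt0// invr_gt0 exprn_gt0.
apply: (@le_trans _ _ (((2 ^+ c.1)^-1 * D) `^ t)).
  have h1 : (2 ^+ c.1)^-1 * D <= 1 by apply: le_trans (small_diam _ _ eic) vD1.
  by apply: ger_powR => //; rewrite w0.
by rewrite powRM// ?(ltW D0)// /tau powR2N_exprn mulrC.
Qed.

End HausdorffOfSmall.

Lemma sum_sqr_le (R : realFieldType) (A : finType) (x : A -> R) :
  (\sum_a x a) ^+ 2 <= #|A|%:R * \sum_a x a ^+ 2.
Proof.
set S := \sum_a x a; set N : R := #|A|%:R.
have [N0|N0] := eqVneq N 0.
  rewrite N0 mul0r /S big1 ?expr0n// => a _.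
  move: N0 => /eqP; rewrite pnatr_eq0 => /eqP A0.
  by have := card0_eq A0 a; rewrite inE.
have Npos : 0 < N by rewrite lt_neqAle eq_sym N0 ler0n.
rewrite -subr_ge0 -(pmulr_rge0 _ Npos).
have -> : N * (N * (\sum_a x a ^+ 2) - S ^+ 2) = \sum_a (N * x a - S) ^+ 2.
  rewrite [RHS](eq_bigr (fun a => N ^+ 2 * x a ^+ 2 - 2 * N * S * x a + S ^+ 2)); last first.
    by move=> a _; ring.
  rewrite big_split/= sumrB sumr_const -[S ^+ 2 *+ _]mulr_natl -!mulr_sumr -/S -/N; ring.
by apply: sumr_ge0 => a _; exact: sqr_ge0.
Qed.

Lemma powR2_lt (R : realType) (a b : R) : a < b -> 2 `^ a < 2 `^ b.
Proof. by move=> ab; rewrite /powR gt_eqF// ltr_expR ltr_pM2r// ln_gt0// ltr1n. Qed.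

(** * Null cubes when the energy exponent exceeds the dimension *)

Section LocalMeasure.
Variables (R : realType) (m : nat).
Notation E := 'rV[R]_m.+1.
Notation T := (Borel R m.+1).
Variables (mu : {measure set T -> \bar R}) (s : R).
Hypothesis mu_fin : forall K : set (Rd R m.+1), compact K -> (mu K < +oo)%E.
Hypothesis mu_energy : (energy mu s < +oo)%E.

Lemma dyad_null_cover l (P : set E) : measurable (P : set T) ->
  (forall idx, mu ([set p | dyad l p = idx] `&` P) = 0%E) -> mu P = 0%E.
Proof.
move=> mP h0; pose F n : set E :=
  if unpickle n is Some idx then [set p | dyad l p = idx] `&` P else set0.
have mF n : measurable (F n : set T).
  by rewrite /F; case: unpickle => [idx|//]; apply: measurableI => //; exact: borel_dyad.
have F0 n : mu (F n) = 0%E by rewrite /F; case: unpickle.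
apply/eqP; rewrite eq_le measure_ge0 andbT.
have <- : (\sum_(0 <= n <oo) mu (F n) = 0)%E by apply: eseries0 => n _ _; exact: F0.
apply: measure_sigma_subadditive => //.
by move=> p Pp; exists (pickle (dyad l p)) => //; rewrite /F pickleK.
Qed.

(** Cut the unit cube into 2^(n(m+1)) cubes. Cauchy-Schwarz bounds the squared mass by their number
    times the sum of squared masses, and the diagonal blocks of the energy bound that sum by a
    multiple of 2^(-ns). The product tends to 0 because s > m + 1. *)
Lemma energy_null : m.+1%:R < s -> forall idx, mu [set p | dyad 0 p = idx] = 0%E.
Proof.
move=> ms idx; set Y := [set p | _].
have s0 : 0 <= s by apply: le_trans (ltW ms).
have mY : measurable (Y : set T) by exact: borel_dyad.
have fY : (mu Y < +oo)%E by exact: dyad_lty.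
pose D : R := m.+1%:R; have D0 : 0 < D by rewrite ltr0n.
pose I := fine (energy mu s).
have e0 : (0 <= energy mu s)%E.
  apply: integral_ge0 => x _; apply: integral_ge0 => y _.
  by case: ifP => // _; rewrite lee_fin powR_ge0.
have I0 : 0 <= I by exact: fine_ge0.
pose y : R := 2 ^+ m.+1 * 2^-1 `^ s.
have y0 : 0 < y by rewrite mulr_gt0 ?exprn_gt0 ?powR_gt0.
have y1 : y < 1.
  rewrite /y -powR_mulrn// powR_invl// ltr_pdivrMr ?powR_gt0// mul1r.
  exact: powR2_lt.
have main n : fine (mu Y) ^+ 2 <= D `^ s * I * y ^+ n.
  pose A : finType := {ffun 'I_m.+1 -> 'I_(2 ^ n)}.
  pose sub (a : A) : 'rV[int]_m.+1 := \row_i ((2 ^ n)%N%:Z * idx 0 i + (a i)%:Z).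
  pose P (a : A) : set E := Y `&` [set p | dyad n p = sub a].
  have mP a : measurable (P a : set T) by apply: measurableI => //; exact: borel_dyad.
  have fP a : (mu (P a) < +oo)%E.
    by apply: le_lt_trans fY; apply: le_measure; rewrite ?inE//; move=> p [].
  have tP : trivIset setT P.
    apply/trivIsetP => a b _ _ /eqP ab; apply/seteqP; split=> // p [[_ pa] [_ pb]].
    apply: ab; apply/ffunP => i; apply/val_inj => /=.
    have := congr1 (fun v : 'rV[int]_m.+1 => v 0 i) (etrans (esym pa) pb).
    by rewrite !mxE => /addrI/eqP; rewrite eqz_nat => /eqP.
  have PY : \bigcup_a P a = Y.
    apply/seteqP; split=> p; first by case=> a _ [].
    move=> pY; have n0 : (0 : R) < 2 ^+ n by rewrite exprn_gt0.
    have nE : (2 ^+ n : R) = ((2 ^ n)%N%:Z)%:~R by rewrite -pmulrn natrX.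
    have bnd i : 0 <= dyad n p 0 i - (2 ^ n)%N%:Z * idx 0 i < (2 ^ n)%N%:Z.
      have := dyad_itv i pY; rewrite expr0 mul1r => /andP[h1 h2].
      have := dyad_itv i (erefl (dyad n p)) => /andP[g1 g2].
      have k1 : 2 ^+ n * (idx 0 i)%:~R <= 2 ^+ n * p 0 i by rewrite ler_pM2l.
      have k2 : 2 ^+ n * p 0 i < 2 ^+ n * ((idx 0 i)%:~R + 1) by rewrite ltr_pM2l.
      rewrite subr_ge0 -ltzD1 -(ltr_int R) ltrBlDr -(ltr_int R) !intrD !intrM -nE.
      by apply/andP; split; lra.
    exists [ffun i => insubd (Ordinal (expn_gt0 2 n : 0 < 2 ^ n)%N)
      (absz (dyad n p 0 i - (2 ^ n)%N%:Z * idx 0 i)%R)] => //; split=> //=.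
    apply/rowP => i; rewrite [RHS]mxE ffunE val_insubd; have := bnd i.
    by case: ifP; lia.
  pose w a := fine (mu (P a)).
  have wE a : mu (P a) = (w a)%:E by rewrite fineK// ge0_fin_numE.
  have YE : fine (mu Y) = \sum_a w a.
    rewrite -PY (@measure_fintype _ T R mu A P mP tP).
    by rewrite (eq_bigr (fun a => (w a)%:E))// sumEFin.
  pose c : R := (D * (2 ^+ n)^-1) `^ (- s).
  have Dn0 : 0 < D * (2 ^+ n)^-1 by rewrite mulr_gt0// invr_gt0 exprn_gt0.
  have c0 : 0 < c by rewrite powR_gt0.
  have := @energy_step_le R m.+1 mu s A P (fun a b => (a == b)%:R * c) mP tP fP.
  have -> : \sum_a \sum_b fine (mu (P a)) * fine (mu (P b)) * ((a == b)%:R * c) =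
     c * \sum_a w a ^+ 2.
    rewrite mulr_sumr; apply: eq_bigr => a _; rewrite (bigD1 a)//= eqxx big1 ?addr0.
      by rewrite /w mul1r expr2 mulrC.
    by move=> b; rewrite eq_sym => /negbTE ->; rewrite mul0r mulr0.
  rewrite -(@fineK _ (energy mu s)) ?ge0_fin_numE// lee_fin -/I => h.
  have {}h : c * \sum_a w a ^+ 2 <= I.
    apply: h => [a b|a b p q [_ pa] [_ qb] pq]; first by rewrite mulr_ge0// ltW.
    case: eqP => [ab|_]; last by rewrite mul0r powR_ge0.
    rewrite mul1r /c !powRN.
    have pq0 : 0 < enorm (p - q) by rewrite enorm_gt0// subr_eq0; apply/eqP.
    rewrite lef_pV2 ?posrE ?powR_gt0//; apply: ge0_ler_powR; rewrite ?nnegrE ?(ltW pq0) ?(ltW Dn0)//.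
    by apply: dyad_enorm; rewrite pa qb ab.
  rewrite YE; apply: (le_trans (sum_sqr_le _)).
  rewrite card_ffun !card_ord natrX natrX.
  apply: (@le_trans _ _ ((2 ^+ n) ^+ m.+1 * (I / c))).
    by rewrite ler_pM2l ?exprn_gt0// ler_pdivlMr// mulrC.
  rewrite /c -powRN opprK powRM ?(ltW D0) ?invr_ge0 ?exprn_ge0//.
  have -> : (2 ^+ n)^-1 `^ s = (2^-1 `^ s) ^+ n :> R.
    by rewrite -powR2N_exprn powRN powR_invl.
  rewrite /y exprMn -!exprM [(n * _)%N]mulnC le_eqVlt; apply/orP; left; apply/eqP; ring.
have fin0 : fine (mu Y) ^+ 2 <= 0.
  apply/ler_addgt0Pl => e e_gt0; rewrite addr0.
  have DI : 0 < D `^ s * I + 1 by rewrite ltr_wpDl// mulr_ge0 ?powR_ge0.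
  have y01 : 0 < y < 1 by rewrite y0.
  have [n _ hn] := exists_expr_le 0 y01 (divr_gt0 e_gt0 DI).
  apply: (le_trans (main n)); apply: (@le_trans _ _ ((D `^ s * I + 1) * y ^+ n)).
    by rewrite ler_wpM2r ?exprn_ge0 ?(ltW y0)// lerDl.
  by rewrite mulrC -ler_pdivlMr.
have : fine (mu Y) = 0.
  by apply/eqP; rewrite -sqrf_eq0 eq_le fin0 sqr_ge0.
by move=> h; rewrite -(@fineK _ (mu Y)) ?h// ge0_fin_numE.
Qed.

End LocalMeasure.

Lemma hausdorff_set0 (R : realType) (d : nat) (t : R) :
  hausdorff t (set0 : set 'rV[R]_d) = 0%E.
Proof.
have h delta : haus_delta t delta (set0 : set 'rV[R]_d) = 0%E.
  apply/eqP; rewrite eq_le; apply/andP; split.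
    apply: ereal_inf_lbound; exists (fun=> set0).
      by split=> // i; apply: ge_ereal_sup => z [x []].
    by apply: eseries0 => i _ _; rewrite /diam_pow; case: pselect.
  apply: le_ereal_inf_tmp => _ [F _ <-]; apply: nneseries_ge0 => i _ _.
  by rewrite lee_fin diam_pow_ge0.
apply/eqP; rewrite eq_le; apply/andP; split.
  by apply: ge_ereal_sup => _ [delta _ <-]; rewrite h.
by rewrite -(h 1); apply: ereal_sup_ubound; exists 1 => //=.
Qed.

(** * Assembling the exceptional set *)

Section ExceptionalSet.
Variables (R : realType) (m : nat).
Notation E := 'rV[R]_m.+1.
Notation T := (Borel R m.+1).
Variables (mu : {measure set T -> \bar R}) (s : R).
Hypothesis mu_fin : forall K : set (Rd R m.+1), compact K -> (mu K < +oo)%E.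
Hypothesis mu_energy : (energy mu s < +oo)%E.

Lemma nbhs_dyad_nbhs (x : E) (U : set E) : nbhs x U -> exists l : nat, forall y : E,
  (forall i, `|dyad l x 0 i - dyad l y 0 i| < 3) -> U y.
Proof.
move=> /nbhs_ballP[e /= e0 eU].
have [l _ /(_ _ (leqnn _)) hl] := exists_pow2_ge (4 / e) 0.
exists l => y xy; apply: eU; rewrite -ball_normE /ball_/= /Num.norm/= mx_normrE.
apply/bigmax_ltP; split=> // -[i j] _ /=; rewrite !mxE (ord1 i).
have t0 : (0 : R) < 2 ^+ l by rewrite exprn_gt0.
rewrite -(ltr_pM2l t0) -{1}(ger0_norm (ltW t0)) -normrM mulrBr.
have he : 4 <= 2 ^+ l * e by rewrite -ler_pdivrMr.
apply: lt_le_trans he.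
have /andP[x1 x2] := dyad_itv j (erefl (dyad l x)).
have /andP[y1 y2] := dyad_itv j (erefl (dyad l y)).
have : `|(dyad l x 0 j)%:~R - (dyad l y 0 j)%:~R : R| < 3.
  by rewrite -intrB -intr_norm (ltr_int R _ 3).
rewrite !ltr_norml => /andP[h1 h2]; apply/andP; split; lra.
Qed.

(** A neighbourhood of [x] is null, and at a fine enough level it contains every cube that is not
    far from the cube of [x]. A null set of directions charged by the projection must therefore be
    charged by some far cube. *)
Lemma Sset_piece x : Sset mu x -> exists l idX idY,
  far idX idY /\ exceptional_piece mu l idX idY x.
Proof.
have dE : m.+1%:R - 1 = m%:R :> R by rewrite -natr1 addrK.
move=> [xspt xac].
have [U [oU Ux muU]] : exists U : set E, [/\ open U, U x & mu U = 0%E].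
  apply: contrapT => no; apply: xspt => U oU Ux; rewrite lt0e measure_ge0 andbT.
  by apply/eqP => U0; apply: no; exists U.
have [B [mB hB muB]] : exists B : set T, [/\ measurable B,
    hausdorff m%:R (B `&` sphere (R := R) (d := m.+1)) = 0%E & radpush mu x B <> 0%E].
  apply: contrapT => no; apply: xac => B mB hB; apply: contrapT => h; apply: no.
  by exists B; rewrite -dE.
have [l hl] := nbhs_dyad_nbhs (open_nbhs_nbhs (conj oU Ux)).
have mP := measurable_radproj x mB.
have [idY hY] : exists idY, mu ([set p | dyad l p = idY] `&`
    [set y | y <> x /\ B (radproj x y)]) <> 0%E.
  apply: contrapT => no; apply: muB; apply: (@dyad_null_cover R m mu l) => // idY.
  by apply: contrapT => h; apply: no; exists idY.
exists l, (dyad l x), idY; split; last by split=> //; exists B.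
apply: contrapT => nfar; apply: hY; apply/eqP; rewrite eq_le measure_ge0 andbT -muU.
apply: le_measure; rewrite ?inE//.
- by apply: measurableI => //; exact: borel_dyad.
- exact: open_borel.
- move=> y [yY _]; apply: hl => i; rewrite ltNge; apply/negP => h.
  by apply: nfar; exists i; rewrite -yY.
Qed.

(** For [tau] = 2^(-t), [2 ^+ m * tau] = 2^(m - t) exceeds 1 because t < m, and 2^(2m - s - t) is
    below 1 because t > 2m - s. *)
Lemma Sset_small (t : R) : (0 < m)%N -> m%:R < s <= m%:R + 1 ->
  2 * m%:R - s < t < m%:R -> small (2 `^ (- t)) (Sset mu).
Proof.
move=> m0 hs /andP[ts tm]; set tau := 2 `^ (- t).
have tau0 : 0 < tau by rewrite powR_gt0.
have xE : 2 ^+ m * tau = 2 `^ (m%:R - t).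
  by rewrite -powR_mulrn// -powRD// pnatr_eq0 implybT.
have tau_big : 1 < 2 ^+ m * tau.
  by rewrite xE -[ltLHS](powRr0 2); apply: powR2_lt; rewrite subr_gt0.
have tau_small : 2 ^+ m * tau * (2^-1 `^ (s - m%:R)) < 1.
  rewrite xE powR_invl// -powRN -powRD; last by rewrite pnatr_eq0 implybT.
  by rewrite -[ltRHS](powRr0 2); apply: powR2_lt; lra.
pose A N : set E := if unpickle N is Some (l, (idX, idY)) then
  [set x | far idX idY /\ exceptional_piece mu l idX idY x] else set0.
apply: (@small_sub _ _ _ _ (\bigcup_N A N)).
  move=> x /Sset_piece[l [idX [idY [f p]]]].
  by exists (pickle (l, (idX, idY))) => //; rewrite /A pickleK.
apply: small_bigcup => // N; rewrite /A; case: unpickle => [[l [idX idY]]|]; last first.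
  move=> eta eta0; exists (fun=> [::]); split=> // K.
  by rewrite big1 ?ltW// => i _; rewrite big_nil.
have [f|nf] := pselect (far idX idY); last first.
  move=> eta eta0; exists (fun=> [::]); split=> [x []//|K].
  by rewrite big1 ?ltW// => i _; rewrite big_nil.
have := exceptional_piece_small mu_fin mu_energy m0 hs tau0 tau_big tau_small l f.
by apply: small_sub => x [].
Qed.

Lemma hausdorff_Sset (t : R) : (0 < m)%N -> m%:R < s -> 0 <= t -> 2 * m%:R - s < t ->
  hausdorff t (Sset mu) = 0%E.
Proof.
move=> m0 ms t0 st; have m1 : (1 : R) <= m%:R by rewrite ler1n.
have [sm|sm] := lerP s (m%:R + 1).
  (* The midpoint of 2m - s and min(t, m): it is below m, as the Frostman sum requires, and positive
     because s <= m + 1 and m >= 1 give 2m - s >= 0. *)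
  pose t1 := (2 * m%:R - s + Num.min t m%:R) / 2.
  have h1 : 2 * m%:R - s < Num.min t m%:R by rewrite lt_min st; lra.
  have h2 : Num.min t m%:R <= t by rewrite ge_min lexx.
  have h3 : Num.min t m%:R <= m%:R by rewrite ge_min lexx orbT.
  apply: (@small_hausdorff R m _ t1); rewrite /t1; [lra|lra|].
  by apply: Sset_small; rewrite ?ms//; apply/andP; split; lra.
(* Here s > m + 1, so [mu] vanishes on every unit cube; all projections are zero and no point is
   exceptional. *)
have S0 : Sset mu = set0.
  apply/seteqP; split=> // x [_ xac]; apply: xac => B mB _.
  apply: (@dyad_null_cover R m mu 0); first exact: measurable_radproj.
  move=> idx; apply/eqP; rewrite eq_le measure_ge0 andbT.
  rewrite -(energy_null mu_fin mu_energy (s := s) _ idx); last by rewrite -natr1.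
  apply: le_measure; rewrite ?inE.
  - by apply: measurableI; [exact: borel_dyad|exact: measurable_radproj].
  - exact: borel_dyad.
  - exact: subIsetl.
by rewrite S0 hausdorff_set0.
Qed.

End ExceptionalSet.

Theorem theorem1p1 (R : realType) (d : nat) (hd : (2 <= d)%N)
  (mu : {measure set (Borel R d) -> \bar R})
  (mu_radon : forall K : set (Rd R d), compact K -> (mu K < +oo)%E)
  (mu_cpt : compact (spt mu))
  (s : R) (hs : d%:R - 1 < s) (hI : (energy mu s < +oo)%E) :
  (dimH (Sset mu) <= (2 * (d%:R - 1) - s)%:E)%E.
Proof.
case: d hd mu mu_radon mu_cpt hs hI => [//|m] hd mu mu_radon _.
have -> : m.+1%:R - 1 = m%:R :> R by rewrite -natr1 addrK.
move=> hs hI; apply: ge_ereal_sup => _ [t [t0 ht] <-]; rewrite lee_fin leNgt.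
apply/negP => st; move: ht.
by rewrite (hausdorff_Sset mu_radon hI _ hs t0 st) ?ltxx.
Qed.
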